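(* Let $f\in L_2(\Omega)$ be given and assume the Poincaré–Friedrichs inequality: there is $C_{\mathrm{PF}}>0$ with $\|v\|\le C_{\mathrm{PF}}\|Av\|$ for all $v\in H_0(A)$. Consider the generalized primal hybrid formulation: find $u\in\widetilde H(A,\mathcal T)$ and $\psi\in H(A^*,\mathcal S)$ such that \[ (\mathcal C Au, A\delta u)_{\mathcal T}+\langle\psi,\delta u\rangle_{\mathcal S}=(f,\delta u)\quad\forall \delta u\in\widetilde H(A,\mathcal T),\qquad \langle\delta\psi,u\rangle_{\mathcal S}=0\quad\forall\delta\psi\in H(A^*,\mathcal S). \] This problem is well posed (it has exactly one solution, depending continuously on $f$). Its solution $(u,\psi)$ satisfies \[ \|u\|_{A,\mathcal T}+\|\psi\|_{A^*,\mathcal S}\le C\|f\| \] with a constant $C$ that is independent of $f$ and $\mathcal T$. Furthermore, $u\in H_0(A)$, $\psi=\gamma_{A^*,\mathcal S}(\mathcal C Au)$, and $u$ solves $A^*\mathcal C Au=f$.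
   Context: Setting. $\Omega\subset\mathbb R^d$ ($d\in\mathbb N$) is a bounded Lipschitz domain and $U\in\{\mathbb R,\mathbb R^d,\mathbb R^{d\times d}\}$ or $U=\mathbb S:=\{w\in\mathbb R^{d\times d}: w=w^\top\}$. $A$ is a linear differential operator with constant coefficients taking scalar functions to $U$-valued functions, and $A^*$ is its formal adjoint (taking $U$-valued functions to scalar functions); both are applied in the distributional sense. $(\cdot,\cdot)$ and $\|\cdot\|$ are the $L_2(\Omega)$ inner product and norm (for scalar or $U$-valued functions). Set $H(A)=\{v\in L_2(\Omega): Av\in L_2(\Omega;U)\}$ with $\|v\|_A^2=\|v\|^2+\|Av\|^2$, and $H(A^* )=\{w\in L_2(\Omega;U): A^*w\in L_2(\Omega)\}$ with $\|w\|_{A^*}^2=\|w\|^2+\|A^*w\|^2$. The trace operator $\gamma_{A,\Gamma}:H(A)\to H(A^* )^*$ is $\langle\gamma_{A,\Gamma}(v),w\rangle_\Gamma:=(Av,w)-(v,A^*w)$, and $H_0(A):=\{v\in H(A):\gamma_{A,\Gamma}(v)=0\}$. $\mathcal C\in L_\infty(\Omega;U\times U)$ is a symmetric, (uniformly) positive definite tensor field, acting pointwise as a linear map $U\to U$. $\mathcal T=\{T\}$ is a regular mesh of polyhedral elements covering $\Omega$, with skeleton $\mathcal S=\bigcup\{\partial T: T\in\mathcal T\}$. $(\cdot,\cdot)_{\mathcal T}$ is the sum over $T\in\mathcal T$ of the $L_2(T)$ inner products, differential operators inside it being taken elementwise, and $\|\cdot\|_{\mathcal T}^2=(\cdot,\cdot)_{\mathcal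 T}$. Set $H(A,\mathcal T)=\{v\in L_2(\Omega): A(v|_T)\in L_2(T;U)\ \forall T\in\mathcal T\}$ with $\|v\|_{A,\mathcal T}^2=\|v\|^2+\|Av\|_{\mathcal T}^2$. $\widetilde H(A,\mathcal T)$ is a given closed subspace of $H(A,\mathcal T)$ with $H_0(A)\subset\widetilde H(A,\mathcal T)\subset H(A,\mathcal T)$. Trace operator: $\gamma_{A^*,\mathcal S}:H(A^* )\to\widetilde H(A,\mathcal T)^*$, $\langle\gamma_{A^*,\mathcal S}(w),v\rangle_{\mathcal S}:=(A^*w,v)-(w,Av)_{\mathcal T}$. Trace space: $H(A^*,\mathcal S):=\gamma_{A^*,\mathcal S}(H(A^* ))$ with norm $\|\psi\|_{A^*,\mathcal S}:=\inf\{\|w\|_{A^*}: w\in H(A^* ),\ \gamma_{A^*,\mathcal S}(w)=\psi\}$; for $\psi\in H(A^*,\mathcal S)$ and $v\in\widetilde H(A,\mathcal T)$, $\langle\psi,v\rangle_{\mathcal S}:=\langle\gamma_{A^*,\mathcal S}(w),v\rangle_{\mathcal S}$ for any $w\in H(A^* )$ with $\gamma_{A^*,\mathcal S}(w)=\psi$. *)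

(* Defs.v *)
From HB Require Import structures.
From mathcomp Require Import all_boot all_order all_algebra.
From mathcomp Require Import all_classical all_reals all_analysis.

Set Implicit Arguments.
Unset Strict Implicit.
Unset Printing Implicit Defensive.
Import Order.TTheory GRing.Theory Num.Theory.
Import numFieldNormedType.Exports.
Local Open Scope classical_set_scope.
Local Open Scope ring_scope.

Section rV_measurable.
Context {R : realType} {n : nat}.

Let coord (i : 'I_n) (x : 'rV[R]_n) : measurableTypeR R := x ord0 i.

Let rV_measurable0 : g_sigma_preimage coord set0.
Proof. exact: sigma_algebra0. Qed.

Let rV_measurableC B : g_sigma_preimage coord B -> g_sigma_preimage coord (~` B).
Proof. exact: sigma_algebraC. Qed.

Let rV_measurable_bigcup (F : (set 'rV[R]_n)^nat) :
  (forall i, g_sigma_preimage coord (F i)) ->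
  g_sigma_preimage coord (\bigcup_i F i).
Proof. exact: sigma_algebra_bigcup. Qed.

(* The Borel sigma-algebra of R^n, generated by the coordinates. *)
HB.instance Definition _ := @isMeasurable.Build default_measure_display
  'rV[R]_n (g_sigma_preimage coord)
  rV_measurable0 rV_measurableC rV_measurable_bigcup.

Lemma measurable_coord (i : 'I_n) :
  measurable_fun [set: 'rV[R]_n] (fun x => x ord0 i : measurableTypeR R).
Proof.
move=> _ Y mY; rewrite setTI; apply: sub_sigma_algebra => /=.
rewrite -bigcup_seq/=; exists i => /=; first by rewrite mem_index_enum.
by exists Y => //; rewrite setTI.
Qed.

Lemma measurable_fun_rV d (T : measurableType d) (f : T -> 'rV[R]_n) :
  (forall i, measurable_fun [set: T] (fun x => f x ord0 i : measurableTypeR R)) ->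
  measurable_fun [set: T] f.
Proof.
move=> mf; apply: measurability; first by [].
move=> _ [B B_coord <-]; move: B_coord; rewrite -bigcup_seq/=.
move=> [i _ [Y mY <-]]; rewrite [X in _ `&` X](_ : _ =
  (fun x => f x ord0 i) @^-1` Y); last by rewrite setTI.
exact: mf.
Qed.

End rV_measurable.

Lemma sigma_finite_product d1 d2 (T1 : measurableType d1)
    (T2 : measurableType d2) (R : realType)
    (m1 : {sigma_finite_measure set T1 -> \bar R})
    (m2 : {sigma_finite_measure set T2 -> \bar R}) :
  sigma_finite [set: T1 * T2] (m1 \x m2)%E.
Proof.
have /sigma_finiteP[F [TF ndF Foo]] := sigma_finiteT m1.
have /sigma_finiteP[G [TG ndG Goo]] := sigma_finiteT m2.
exists (fun n => F n `*` G n).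
  rewrite -setXTT TF TG predeqE => -[x y]; split.
    move=> [/= [n _ Fnx] [k _ Gky]]; exists (maxn n k) => //; split.
    - by move: x Fnx; exact/subsetPset/ndF/leq_maxl.
    - by move: y Gky; exact/subsetPset/ndG/leq_maxr.
  by move=> [n _ []/= ? ?]; split; exists n.
move=> k; have [? ?] := Foo k; have [? ?] := Goo k.
split; first exact: measurableX.
by rewrite product_measure1E// lte_mul_pinfty// ge0_fin_numE.
Qed.

Lemma sigma_finite_pushforward d1 d2 (T1 : measurableType d1)
    (T2 : measurableType d2) (R : realType)
    (m : {measure set T1 -> \bar R}) (f : T1 -> T2) (g : T2 -> T1) :
  sigma_finite [set: T1] m -> measurable_fun [set: T1] f -> measurable_fun [set: T2] g -> cancel f g ->
  sigma_finite [set: T2] (pushforward m f).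
Proof.
move=> [E ET Efin] mf mg fK.
exists (fun k => g @^-1` E k); first by rewrite -preimage_bigcup -ET.
move=> k; have [mE mEfin] := Efin k; split.
  by rewrite -[X in measurable X]setTI; exact: mg.
rewrite /pushforward -comp_preimage.
by rewrite (_ : g \o f = id)//; apply/funext => x /=; rewrite fK.
Qed.

Section lebesgue_rV.
Context {R : realType}.

Definition rV_cons n (p : measurableTypeR R * 'rV[R]_n) : 'rV[R]_n.+1 :=
  \row_i oapp (p.2 ord0) p.1 (unlift ord0 i).

Definition rV_uncons n (v : 'rV[R]_n.+1) : measurableTypeR R * 'rV[R]_n :=
  (v ord0 ord0, \row_j v ord0 (lift ord0 j)).

Lemma rV_consK n : cancel (@rV_cons n) (@rV_uncons n).
Proof.
move=> [a v]; rewrite /rV_uncons /rV_cons !mxE unlift_none/=; congr pair.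
by apply/rowP => j; rewrite !mxE liftK.
Qed.

Lemma measurable_rV_cons n : measurable_fun [set: _] (@rV_cons n).
Proof.
apply: measurable_fun_rV => i; rewrite /rV_cons.
case: (unliftP ord0 i) => [j ->|->].
  under eq_fun do rewrite mxE liftK/=.
  exact: (measurableT_comp (measurable_coord j) measurable_snd).
under eq_fun do rewrite mxE unlift_none/=.
exact: measurable_fst.
Qed.

Lemma measurable_rV_uncons n : measurable_fun [set: _] (@rV_uncons n).
Proof.
apply/measurable_fun_pairP; split; first exact: measurable_coord.
apply: measurable_fun_rV => i /=.
under eq_fun do rewrite mxE.
exact: measurable_coord.
Qed.

Section step.
Context n (m : {sigma_finite_measure set 'rV[R]_n -> \bar R}).

Definition lebesgue_rV_step : set 'rV[R]_n.+1 -> \bar R :=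
  pushforward (@lebesgue_measure R \x m)%E (@rV_cons n).

Let pm : {measure set (measurableTypeR R * 'rV[R]_n)%type -> \bar R} :=
  (@lebesgue_measure R \x m)%E.

Let step0 : lebesgue_rV_step set0 = 0%E.
Proof. by rewrite /lebesgue_rV_step /pushforward preimage_set0 (measure0 pm). Qed.

Let step_ge0 B : (0 <= lebesgue_rV_step B)%E.
Proof. exact: (measure_ge0 pm). Qed.

Let step_sigma_additive : semi_sigma_additive lebesgue_rV_step.
Proof.
move=> F mF tF mUF; rewrite /lebesgue_rV_step /pushforward preimage_bigcup.
apply: measure_semi_sigma_additive.
- by move=> k; rewrite -[X in measurable X]setTI; exact: measurable_rV_cons.
- apply/trivIsetP => /= i j _ _ ij; rewrite -preimage_setI.
  by move/trivIsetP : tF => /(_ _ _ _ _ ij) ->//; rewrite preimage_set0.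
- by rewrite -preimage_bigcup -[X in measurable X]setTI; exact: measurable_rV_cons.
Qed.

HB.instance Definition _ := isMeasure.Build _ _ _
  lebesgue_rV_step step0 step_ge0 step_sigma_additive.

Let step_sigma_finite : sigma_finite [set: 'rV[R]_n.+1] lebesgue_rV_step.
Proof.
apply: (sigma_finite_pushforward (m := pm) _ (@measurable_rV_cons n)
  (@measurable_rV_uncons n) (@rV_consK n)).
exact: sigma_finite_product.
Qed.

HB.instance Definition _ := @Measure_isSigmaFinite.Build _ _ _ lebesgue_rV_step
  step_sigma_finite.

End step.

(* Lebesgue measure on R^n, as the iterated product of the one-dimensional
   one. *)
Fixpoint lebesgue_rV n : {sigma_finite_measure set 'rV[R]_n -> \bar R} :=
  if n is n'.+1 then lebesgue_rV_step (lebesgue_rV n') else \d_(0 : 'rV[R]_0).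

End lebesgue_rV.

Section Euclidean.
Context {R : realType}.

Definition mdot m n (M N : 'M[R]_(m, n)) : R := \sum_i \sum_j M i j * N i j.
Definition enorm m n (M : 'M[R]_(m, n)) : R := Num.sqrt (mdot M M).

End Euclidean.

Section geometry.
Context {R : realType} {d : nat}.
Implicit Types (D : set 'rV[R]_d).

(* Near each boundary point, D is the strict subgraph, in some unit direction
   e, of a Lipschitz function g of the component orthogonal to e; the latter is
   encoded as a function of the full variable which is constant along e. *)
Definition lipschitz_boundary D :=
  forall x0, (closure D `\` D) x0 ->
  exists (e : 'rV[R]_d) (g : 'rV[R]_d -> R),
    [/\ mdot e e = 1,
        exists k : R, forall x y, `|g x - g y| <= k * enorm (x - y),
        forall x (t : R), g (x + t *: e) = g x &
        \forall x \near x0, D x <-> mdot x e < g x].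

Definition domain D := [/\ open D, connected D & D !=set0].

Definition bounded_lipschitz_domain D :=
  [/\ domain D, bounded_set D & lipschitz_boundary D].

(* Interiors of bounded polyhedra, not necessarily convex; the last two
   conditions exclude slits and say that the boundary consists of finitely many
   flat pieces. *)
Definition polyhedral_domain D :=
  [/\ domain D, bounded_set D, interior (closure D) = D &
      exists s : seq ('rV[R]_d * R),
        (forall p, p \in s -> p.1 != 0) /\
        closure D `\` D `<=` [set x | exists2 p, p \in s & mdot p.1 x = p.2]].

(* D contains a ball whose radius is at least kappa times the diameter of D. *)
Definition shape_regular (kappa : R) D :=
  exists (x : 'rV[R]_d) (r : R),
    [/\ 0 < r, [set y | enorm (y - x) < r] `<=` D &
        forall y z, D y -> D z -> kappa * enorm (y - z) <= r].

(* A finite mesh of shape-regular polyhedra with shape parameter kappa. Hanging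
   nodes are not excluded. *)
Definition regular_mesh (Omega : set 'rV[R]_d) (kappa : R) N
    (T : 'I_N -> set 'rV[R]_d) :=
  [/\ forall i, polyhedral_domain (T i) /\ T i `<=` Omega,
      trivIset [set: 'I_N] T,
      closure Omega = \bigcup_i closure (T i) &
      forall i, shape_regular kappa (T i)].

End geometry.

(* The range spaces R, R^d, R^(d x d) and the symmetric matrices, all realized
   as subspaces of a space of matrices. *)
Inductive range_space := Scalars | Vectors | Matrices | SymMatrices.

Definition range_rows d (U : range_space) : nat :=
  match U with Scalars | Vectors => 1 | Matrices | SymMatrices => d end.
Definition range_cols d (U : range_space) : nat :=
  match U with Scalars => 1 | _ => d end.

Notation range_mx R d U := 'M[R]_(range_rows d U, range_cols d U).

Definition in_range (R : realType) d (U : range_space) :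
    range_mx R d U -> Prop :=
  match U return range_mx R d U -> Prop with
  | SymMatrices => fun M => M^T = M
  | _ => fun=> True
  end.

Section L2.
Context {R : realType} {d : nat} (U : range_space).
Implicit Types (D : set 'rV[R]_d) (v f : 'rV[R]_d -> R)
  (w z : 'rV[R]_d -> range_mx R d U).

Notation mu := (lebesgue_rV (R := R) d).

(* The elements of L2(D) are represented by functions on the whole space, of
   which only the restriction to D matters. Measurability is Borel measurability,
   so the symmetry constraint on U-valued representatives is imposed at every
   point of D, not only almost everywhere. *)
Definition L2 D : set ('rV[R]_d -> R) :=
  [set v | v \_ D \in Lfun mu 2%:E].

Definition L2U D : set ('rV[R]_d -> range_mx R d U) :=
  [set w : 'rV[R]_d -> range_mx R d U | (forall i j, L2 D (fun x => w x i j)) /\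
           forall x, D x -> in_range (w x)].

Definition ip_L2 D v f : R := (\int[mu]_(x in D) (v x * f x))%R.
Definition ip_L2U D w z : R := (\int[mu]_(x in D) mdot (w x) (z x))%R.

Definition norm_L2 D v : R := Num.sqrt (ip_L2 D v v).
Definition norm_L2U D w : R := Num.sqrt (ip_L2U D w w).

End L2.
Arguments L2U {R d} U D.

Section test_functions.
Context {R : realType} {d : nat}.

Definition partial (i : 'I_d) (f : 'rV[R]_d -> R) : 'rV[R]_d -> R :=
  fun x => 'D_(delta_mx ord0 i) f x.

Definition smooth (f : 'rV[R]_d -> R) :=
  forall s : seq 'I_d, let g := foldr partial f s in
    continuous g /\ forall i x, derivable g x (delta_mx ord0 i).

Definition multi_partial k (al : {ffun 'I_d -> 'I_k}) (f : 'rV[R]_d -> R) :=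
  foldr (fun i g => iter (al i) (partial i) g) f (enum 'I_d).

Definition test_function (D : set 'rV[R]_d) : set ('rV[R]_d -> R) :=
  [set phi | [/\ smooth phi, compact (closure [set x | phi x != 0]) &
                 closure [set x | phi x != 0] `<=` D]].

Definition test_functionU U (D : set 'rV[R]_d) :
    set ('rV[R]_d -> range_mx R d U) :=
  [set Phi : 'rV[R]_d -> range_mx R d U | (forall i j, test_function D (fun x => Phi x i j)) /\
             forall x, in_range (Phi x)].

End test_functions.
Arguments test_functionU {R d} U D.

(* The operator sum_al a_al d^al with coefficients a_al in U, where al ranges
   over the multi-indices with entries at most diffop_order. *)
Record diffop (R : realType) (d : nat) (U : range_space) := Diffop {
  diffop_order : nat ;
  diffop_coef : {ffun 'I_d -> 'I_diffop_order.+1} -> range_mx R d U ;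
  diffop_coef_range : forall al, in_range (diffop_coef al)
}.

Arguments diffop_coef {R d U} _ _.

Section operators.
Context {R : realType} {d : nat} {U : range_space} (A : diffop R d U).
Implicit Types (D Omega : set 'rV[R]_d) (v f : 'rV[R]_d -> R)
  (w g : 'rV[R]_d -> range_mx R d U).

Definition smooth_op v : 'rV[R]_d -> range_mx R d U := fun x =>
  \sum_al multi_partial al v x *: diffop_coef A al.

Definition smooth_adj w : 'rV[R]_d -> R := fun x =>
  \sum_(al : {ffun 'I_d -> 'I_(diffop_order A).+1})
    (-1) ^+ (\sum_i al i)%N
    * multi_partial al (fun y => mdot (diffop_coef A al) (w y)) x.

(* A v = g, resp. A^* w = f, in the sense of distributions on D. *)
Definition distr_op D v g :=
  forall Phi, test_functionU U D Phi -> ip_L2U D g Phi = ip_L2 D v (smooth_adj Phi).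
Definition distr_adj D w f :=
  forall phi, test_function D phi -> ip_L2 D f phi = ip_L2U D w (smooth_op phi).

Definition has_op D v := exists2 g, L2U U D g & distr_op D v g.
Definition has_adj D w := exists2 f, L2 D f & distr_adj D w f.

(* Chosen representatives of the classes A v in L2(D; U) and A^* w in L2(D)
   (zero if there are none). *)
Definition op_L2 D v : 'rV[R]_d -> range_mx R d U :=
  xget (fun=> 0) [set g | L2U U D g /\ distr_op D v g].
Definition adj_L2 D w : 'rV[R]_d -> R :=
  xget (fun=> 0) [set f | L2 D f /\ distr_adj D w f].

Definition H_op D : set ('rV[R]_d -> R) := [set v | L2 D v /\ has_op D v].
Definition H_adj D : set ('rV[R]_d -> range_mx R d U) :=
  [set w | L2U U D w /\ has_adj D w].

Definition norm_adj D w : R :=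
  Num.sqrt (norm_L2U D w ^+ 2 + norm_L2 D (adj_L2 D w) ^+ 2).

End operators.

Section domain_operators.
Context {R : realType} {d : nat} {U : range_space} (A : diffop R d U).
Context (Omega : set 'rV[R]_d).

(* The pairing <gamma_(A, Gamma)(v), w>_Gamma of the trace of v with w. *)
Definition trace_boundary (v : 'rV[R]_d -> R)
    (w : 'rV[R]_d -> range_mx R d U) : R :=
  ip_L2U Omega (op_L2 A Omega v) w - ip_L2 Omega v (adj_L2 A Omega w).

Definition H0_op : set ('rV[R]_d -> R) :=
  [set v | H_op A Omega v /\ forall w, H_adj A Omega w -> trace_boundary v w = 0].

Definition poincare_friedrichs :=
  exists2 CPF : R, 0 < CPF &
    forall v, H0_op v ->
      norm_L2 Omega v <= CPF * norm_L2U Omega (op_L2 A Omega v).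

(* C : Omega -> L(U, U) is essentially bounded, symmetric and uniformly
   positive definite; its values off the subspace U are irrelevant. *)
Definition coefficient_tensor
    (C : 'rV[R]_d -> {linear range_mx R d U -> range_mx R d U}) :=
  [/\ forall x M, Omega x -> in_range M -> in_range (C x M),
      forall M i j, in_range M -> measurable_fun Omega (fun x => C x M i j),
      exists K : R, {ae lebesgue_rV (R := R) d, forall x, Omega x ->
        forall M, in_range M -> enorm (C x M) <= K * enorm M},
      {ae lebesgue_rV (R := R) d, forall x, Omega x ->
        forall M N, in_range M -> in_range N ->
        mdot (C x M) N = mdot M (C x N)} &
      exists2 c : R, 0 < c & {ae lebesgue_rV (R := R) d, forall x, Omega x ->
        forall M, in_range M -> c * enorm M ^+ 2 <= mdot (C x M) M}].

End domain_operators.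

Section broken.
Context {R : realType} {d : nat} {U : range_space} (A : diffop R d U).
Context (Omega : set 'rV[R]_d) {N : nat} (T : 'I_N -> set 'rV[R]_d).

(* H(A, T) *)
Definition H_broken : set ('rV[R]_d -> R) :=
  [set v | L2 Omega v /\ forall i, has_op A (T i) v].

Definition norm_broken (v : 'rV[R]_d -> R) : R :=
  Num.sqrt (norm_L2 Omega v ^+ 2
            + \sum_i norm_L2U (T i) (op_L2 A (T i) v) ^+ 2).

Definition closed_subspace_broken (Ht : set ('rV[R]_d -> R)) :=
  [/\ Ht `<=` H_broken,
      Ht !=set0,
      forall (a : R) u v, Ht u -> Ht v -> Ht (fun x => a * u x + v x) &
      forall (u : nat -> 'rV[R]_d -> R) v, (forall n, Ht (u n)) -> H_broken v ->
        norm_broken (fun x => u n x - v x) @[n --> \oo] --> (0 : R) -> Ht v].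

Context (Ht : set ('rV[R]_d -> R)).

(* gamma_(A^*, S)(w), as a function on the space Ht. *)
Definition trace_skeleton (w : 'rV[R]_d -> range_mx R d U) : Ht -> R := fun v =>
  ip_L2 Omega (adj_L2 A Omega w) (val v)
  - \sum_i ip_L2U (T i) w (op_L2 A (T i) (val v)).

(* H(A^*, S) *)
Definition H_skeleton : set (Ht -> R) := trace_skeleton @` H_adj A Omega.

Definition norm_skeleton (psi : Ht -> R) : R :=
  inf [set norm_adj A Omega w | w in
        [set w | H_adj A Omega w /\ trace_skeleton w = psi]].

Definition hybrid_solution
    (C : 'rV[R]_d -> {linear range_mx R d U -> range_mx R d U})
    (f : 'rV[R]_d -> R) (u : Ht) (psi : Ht -> R) :=
  [/\ H_skeleton psi,
      forall du : Ht,
        \sum_i ip_L2U (T i) (fun x => C x (op_L2 A (T i) (val u) x))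
                         (op_L2 A (T i) (val du)) + psi du
        = ip_L2 Omega f (val du) &
      forall dpsi, H_skeleton dpsi -> dpsi u = 0].

End broken.

(* Main.v *)
(* By the Poincare-Friedrichs inequality, (C A u, A v) is coercive on H_0(A), which
   is complete; Riesz' theorem gives a unique weak solution u in H_0(A) of
   (C A u, A v) = (f, v) for all v in H_0(A). Test functions belong to H_0(A), so
   q = C A u satisfies A^* q = f, and psi = gamma(q) solves the first hybrid
   equation. Conversely the second hybrid equation forces u into H_0(A), on which
   the traces of H(A^* ) vanish, so that u is the weak solution; the first equation
   then determines psi. All constants come from Omega, A and C alone, since
   the skeleton has measure zero and elementwise integrals add up to integrals over
   Omega. *)

From HB Require Import structures.
From mathcomp Require Import all_boot all_order all_algebra.
From mathcomp Require Import all_classical all_reals all_analysis.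
From mathcomp Require Import measurable_realfun.
From mathcomp Require Import ring lra.
Require Import Defs.

Set Implicit Arguments.
Unset Strict Implicit.
Unset Printing Implicit Defensive.
Import Order.TTheory GRing.Theory Num.Theory.
Import numFieldNormedType.Exports.
Local Open Scope classical_set_scope.
Local Open Scope ring_scope.

(** * Boxes and iterated integrals in R^n *)

Section boxes.
Context {R : realType} {n : nat}.
Implicit Types (a b x : 'rV[R]_n).

(** Functions are not identified with their classes: each space is a set of representatives, the
    energy form is only semidefinite, and the chosen images [op_L2] are linear only almost
    everywhere. Equalities of functions on Omega therefore hold up to null sets, whereas psi is a
    genuine function on [Ht], since its values are integrals and do not see the choice of
    representatives. Most of the work is the analysis that the argument presupposes. That v
    determines A v needs the fundamental lemma of the calculus of variations, hence explicit bump
    functions. That test functions lie in H(A) and H(A^* ) needs iterated integration by parts,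
    hence Fubini's theorem on R^n and the symmetry of second derivatives. That H_0(A) is complete
    needs the Riesz-Fischer theorem. The four range spaces are treated together by means of the
    orthogonal projection [rproj] onto U, which is the identity except for symmetric matrices. *)

Definition box a b : set 'rV[R]_n := [set x | forall i, a ord0 i < x ord0 i < b ord0 i].
Definition cbox a b : set 'rV[R]_n := [set x | forall i, a ord0 i <= x ord0 i <= b ord0 i].

Lemma coord_preimage_measurable i (Y : set (measurableTypeR R)) :
  measurable Y -> measurable [set x : 'rV[R]_n | Y (x ord0 i)].
Proof.
by move=> mY; rewrite -[X in measurable X]setTI; exact: measurable_coord.
Qed.

Lemma forall_coord_measurable (Y : 'I_n -> set (measurableTypeR R)) :
  (forall i, measurable (Y i)) ->
  measurable [set x : 'rV[R]_n | forall i, Y i (x ord0 i)].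
Proof.
move=> mY; rewrite (_ : [set x | _] = \bigcap_i [set x : 'rV[R]_n | Y i (x ord0 i)]).
  apply: fin_bigcap_measurable => // i _; exact: coord_preimage_measurable.
by apply/seteqP; split => x /= => [xY i _ //|xY i]; apply: xY.
Qed.

Lemma measurable_box a b : measurable (box a b).
Proof.
have := @forall_coord_measurable (fun i => `]a ord0 i, b ord0 i[%classic).
rewrite (_ : [set x | _] = box a b); first by apply => i; exact: measurable_itv.
by apply/seteqP; split => x /= + i => /(_ i); rewrite in_itv.
Qed.

Lemma measurable_cbox a b : measurable (cbox a b).
Proof.
have := @forall_coord_measurable (fun i => `[a ord0 i, b ord0 i]%classic).
rewrite (_ : [set x | _] = cbox a b); first by apply => i; exact: measurable_itv.
by apply/seteqP; split => x /= + i => /(_ i); rewrite in_itv.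
Qed.

Lemma box_cbox a b : box a b `<=` cbox a b.
Proof. by move=> x xab i; have /andP[/ltW-> /ltW->] := xab i. Qed.

Lemma closed_cbox a b : closed (cbox a b).
Proof.
rewrite (_ : cbox a b = \bigcap_i ((fun x : 'rV[R]_n =>
  x ord0 i) @^-1` `[a ord0 i, b ord0 i]%classic)).
  apply: closed_bigI => i _; apply: preimage_closed => //.
    by move=> x _; exact: coord_continuous.
  exact: interval_closed.
apply/seteqP; split => x /=; first by move=> + i _ => /(_ i); rewrite /= in_itv.
by move=> + i => /(_ i I); rewrite /= in_itv.
Qed.

Lemma compact_cbox a b : compact (cbox a b).
Proof.
rewrite (_ : cbox a b = [set v | forall i, `[a ord0 i, b ord0 i]%classic (v ord0 i)]).
  by apply: (@rV_compact R n (fun i => `[a ord0 i, b ord0 i]%classic)) => i;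
    exact: segment_compact.
by apply/seteqP; split => x /= + i => /(_ i); rewrite in_itv.
Qed.

Lemma ball_rV (x : 'rV[R]_n) (e : R) : 0 < e ->
  ball x e = box (\row_i (x ord0 i - e)) (\row_i (x ord0 i + e)).
Proof.
move=> e0; apply/seteqP; split => y /=.
  move=> [_ xy] i; have := xy ord0 i; rewrite /ball/= ltr_distl !mxE => /andP[? ?].
  by apply/andP; split; lra.
move=> xy; split => // i j; rewrite (ord1 i); have := xy j;
  rewrite !mxE /ball/= ltr_distl => /andP[? ?].
by apply/andP; split; lra.
Qed.

(** Boxes with rational centres and half-widths 1/(k+1) are countably many. Keeping even the closed
    boxes inside [D] is what later makes a bump function on such a box a test function on [D]. *)
Lemma open_cbox_cover (D : set 'rV[R]_n) : open D ->
  exists (I : countType) (a b : I -> 'rV[R]_n),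
    (forall k, cbox (a k) (b k) `<=` D) /\ D = \bigcup_k box (a k) (b k).
Proof.
move=> oD.
pose lo (p : 'rV[rat]_n * nat) : 'rV[R]_n := \row_i (ratr (p.1 ord0 i) - p.2.+1%:R^-1).
pose hi (p : 'rV[rat]_n * nat) : 'rV[R]_n := \row_i (ratr (p.1 ord0 i) + p.2.+1%:R^-1).
pose ok p := `[< cbox (lo p) (hi p) `<=` D >].
pose z : 'rV[R]_n := \row_i 1.
have z0 : box z 0 `<=` D -> cbox z 0 `<=` D.
  by move=> h x xz; apply: h => i; have := xz i; rewrite !mxE => /andP[? ?]; exfalso; lra.
exists {p : 'rV[rat]_n * nat | ok p}, (fun p => lo (val p)), (fun p => hi (val p)); split.
  by move=> [p pok] /=; apply/asboolP.
apply/seteqP; split => [x Dx|x [[p /= /asboolP pD] _ /box_cbox]]; last exact: pD.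
have /nbhs_ballP[e /= e0 xeD] := open_nbhs_nbhs (conj oD Dx).
(* A half-width c < e/3 and a centre within c of x put the closed box within distance 2c < e of
   x. *)
have [k ke] : exists k : nat, k.+1%:R^-1 < e / 3.
  have e30 : 0 < e / 3 by rewrite divr_gt0.
  by have [k _ /(_ k (leqnn _))] := near_infty_natSinv_lt (PosNum e30); exists k.
have [c cE] : exists c : R, c = k.+1%:R^-1 by exists k.+1%:R^-1.
have c0 : 0 < c by rewrite cE invr_gt0.
rewrite -cE in ke.
have qP i : exists q : rat, ratr q \in `](x ord0 i - c), (x ord0 i + c)[.
  by apply: rat_in_itvoo; rewrite ltrD2l -subr_gt0 opprK addr_gt0.
have [q qE] : exists q :
  'rV[rat]_n, forall i, x ord0 i - c < ratr (q ord0 i) < x ord0 i + c.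
  by exists (\row_i xchoose (qP i)) => i; have := xchooseP (qP i); rewrite mxE in_itv.
have okqk : ok (q, k).
  apply/asboolP => y yq; apply: xeD; rewrite ball_rV// => i.
  have := yq i; have := qE i; rewrite /lo /hi !mxE /= -cE;
    move: (ratr (q ord0 i) : R) => r /andP[? ?] /andP[? ?].
  by apply/andP; split; lra.
exists (exist _ (q, k) okqk) => //= i.
by have := qE i; rewrite /lo /hi !mxE /= -cE;
  move: (ratr (q ord0 i) : R) => r /andP[? ?]; apply/andP; split; lra.
Qed.

Lemma open_rV_measurable (D : set 'rV[R]_n) : open D -> measurable D.
Proof.
move=> /open_cbox_cover[I [a [b [_ ->]]]].
by apply: countable_bigcupT_measurable => // k; exact: measurable_box.
Qed.

Lemma continuous_rV_measurable (f : 'rV[R]_n -> R) : continuous f ->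
  measurable_fun [set: 'rV[R]_n] f.
Proof.
move=> cf; apply: (measurability _ (RGenOInfty.measurableE R)).
move=> _ [_ [r ->] <-]; rewrite setTI; apply: open_rV_measurable.
apply: open_comp; first by move=> x _; exact: cf.
exact: interval_open.
Qed.

Definition boxes : set (set 'rV[R]_n) := [set B | exists a b, B = box a b].

Lemma box_setI a b a' b' : box a b `&` box a' b' =
  box (\row_i Num.max (a ord0 i) (a' ord0 i)) (\row_i Num.min (b ord0 i) (b' ord0 i)).
Proof.
apply/seteqP; split => x /=.
  by move=> [xab xab'] i; rewrite !mxE gt_max lt_min; have /andP[-> ->] := xab i;
    have /andP[-> ->] := xab' i.
move=> xab; split => i; have := xab i;
  rewrite !mxE gt_max lt_min => /andP[/andP[? ?] /andP[? ?]];
  by apply/andP.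
Qed.

Lemma boxes_setI : setI_closed boxes.
Proof. by move=> _ _ [a [b ->]] [a' [b' ->]]; rewrite box_setI; do 2 eexists. Qed.

(** Together with [boxes_setI], this presents the Borel sets as generated by a pi-system, the form
    in which Dynkin's theorem applies. *)
Lemma measurable_boxesE : @measurable _ 'rV[R]_n = <<s boxes >>.
Proof.
apply/seteqP; split; last first.
  apply: smallest_sub; first exact: sigma_algebra_measurable.
  by move=> _ [a [b ->]]; exact: measurable_box.
apply: smallest_sub; first exact: smallest_sigma_algebra.
move=> B; rewrite -bigcup_seq/= => -[i _ [Y mY <-]].
suff : measurable_fun [set: g_sigma_algebraType boxes] (fun x :
  g_sigma_algebraType boxes => (x : 'rV[R]_n) ord0 i : measurableTypeR R).
  by move=> /(_ measurableT _ mY).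
apply: (measurability _ (RGenOInfty.measurableE R)).
move=> _ [_ [r ->] <-]; rewrite setTI.
(* Boxes are bounded, so the half-space is exhausted by boxes all of whose faces, except the one at
   [r], move to infinity with k. *)
rewrite (_ : _ @^-1` _ = \bigcup_k box (\row_j if j == i then r else - k%:R) (\row_j k%:R)).
  by apply: bigcupT_measurable => k; apply: sub_sigma_algebra; do 2 eexists.
apply/seteqP; split => x /=.
  rewrite in_itv/= andbT => rx.
  exists (Num.Def.truncn `|x|).+1 => // j; rewrite !mxE.
  have xj : `|x ord0 j| <= `|x|.
    by rewrite [leRHS]/Num.norm/= mx_normrE; apply/bigmax_geP; right; exists (ord0, j).
  have : `|x ord0 j| < (Num.Def.truncn `|x|).+1%:R by apply: le_lt_trans xj _;
    rewrite truncnS_gt.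
  by rewrite ltr_norml => /andP[? ->]; rewrite andbT; case: eqP => // ->.
by move=> [k _ /(_ i)]; rewrite !mxE eqxx in_itv/= => /andP[->].
Qed.

End boxes.

(** * Fubini's theorem for [lebesgue_rV], and null hyperplanes *)

Section rV_step.
Context {R : realType} {n : nat}.
Local Notation mu := (lebesgue_rV (R := R)).
Local Notation leb := (@lebesgue_measure R).
Local Open Scope ereal_scope.

Lemma lebesgue_rVS_set (E : set 'rV[R]_n.+1) :
  mu n.+1 E = (leb \x mu n) (@rV_cons R n @^-1` E).
Proof. by []. Qed.

Lemma integrable_rVS (f : 'rV[R]_n.+1 -> \bar R) : (mu n.+1).-integrable setT f ->
  (leb \x mu n).-integrable setT (f \o @rV_cons R n).
Proof.
move=> /integrableP[mf foo]; apply/integrableP; split.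
  exact: (measurableT_comp mf (@measurable_rV_cons R n)).
apply: le_lt_trans foo.
rewrite [leRHS](@ge0_integral_pushforward _ _ _ _ _ (@rV_cons R n) (@measurable_rV_cons R
  n) (leb \x mu n) setT)//.
exact: measurableT_comp.
Qed.

Lemma integral_rVS (f : 'rV[R]_n.+1 -> \bar R) : (mu n.+1).-integrable setT f ->
  \int[mu n.+1]_x f x = \int[leb \x mu n]_p f (rV_cons p).
Proof.
move=> fi.
rewrite [LHS](@integral_pushforward _ _ _ _ _ (@rV_cons R n) (@measurable_rV_cons R n)
  (leb \x mu n) setT)//.
  exact: measurable_int fi.
by rewrite preimage_setT; exact: integrable_rVS.
Qed.

Lemma integral_rVS_F (f : 'rV[R]_n.+1 -> \bar R) : (mu n.+1).-integrable setT f ->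
  \int[mu n.+1]_x f x = \int[leb]_t \int[mu n]_x f (rV_cons (t, x)).
Proof. by move=> fi; rewrite integral_rVS// -integral12_prod_meas1//;
  exact: integrable_rVS. Qed.

Lemma integral_rVS_G (f : 'rV[R]_n.+1 -> \bar R) : (mu n.+1).-integrable setT f ->
  \int[mu n.+1]_x f x = \int[mu n]_x \int[leb]_t f (rV_cons (t, x)).
Proof. by move=> fi; rewrite integral_rVS// -integral21_prod_meas1//;
  exact: integrable_rVS. Qed.

End rV_step.

Lemma lebesgue_cbox_fin {R : realType} n (a b : 'rV[R]_n) :
  (lebesgue_rV n (cbox a b) < +oo)%E.
Proof.
elim: n => [|n IH] in a b *; first by rewrite /= diracE; case: (_ \in _); rewrite /= ltry.
rewrite lebesgue_rVS_set.
rewrite (_ : _ @^-1` _ = `[a ord0 ord0,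
  b ord0 ord0]%classic `*` cbox (rV_uncons a).2 (rV_uncons b).2).
  rewrite product_measure1E//; last exact: measurable_cbox.
  rewrite lte_mul_pinfty// ?IH//.
    by have /= -> := @lebesgue_measure_itv R `[a ord0 ord0, b ord0 ord0]; case: ifP.
apply/seteqP; split => -[t x] /=.
  move=> h; split; first by have := h ord0; rewrite /rV_cons mxE unlift_none in_itv.
  by move=> i; have := h (lift ord0 i); rewrite /rV_cons !mxE liftK.
rewrite in_itv/= => -[h1 h2] i; rewrite /rV_cons mxE.
case: (unliftP ord0 i) => [j ->|->] //=.
by have := h2 j; rewrite !mxE.
Qed.

Lemma measurable_hyperplane {R : realType} n (p : 'rV[R]_n) (c : R) :
  measurable [set x : 'rV[R]_n | mdot p x = c].
Proof.
rewrite (_ : [set x | _] = (mdot p) @^-1` [set c]) //.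
rewrite -[X in measurable X]setTI; apply: (_ : measurable_fun _ _) => //.
apply: measurable_sum => i; apply: measurable_sum => j.
by apply: measurable_funM => //; rewrite (ord1 i); exact: measurable_coord.
Qed.

(** Induction on the dimension by slicing. If the first entry of [p] is zero, the slices at a fixed
    first coordinate are hyperplanes one dimension lower; otherwise the slices along the first
    coordinate are single points. *)
Lemma hyperplane_null {R : realType} n (p : 'rV[R]_n) (c : R) : p != 0 ->
  lebesgue_rV n [set x | mdot p x = c] = 0%E.
Proof.
elim: n => [|n IH] in p c *; first by move=> /eqP[]; apply/rowP => -[].
have dotE (t : R) (x : 'rV[R]_n) :
  mdot p (rV_cons (t, x)) = p ord0 ord0 * t + mdot (rV_uncons p).2 x.
  rewrite /mdot !big_ord1 big_ord_recl/= /rV_cons !mxE unlift_none/=; congr (_ + _).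
  by apply: eq_bigr => i _; rewrite !mxE liftK.
have mH := @measurable_hyperplane R n.+1 p c.
have mH' : measurable (@rV_cons R n @^-1` [set x : 'rV[R]_n.+1 | mdot p x = c]).
  by rewrite -[X in measurable X]setTI; exact: (@measurable_rV_cons R n).
move=> p0; rewrite lebesgue_rVS_set.
have [p00|p00] := eqVneq (p ord0 ord0) 0.
  rewrite /product_measure1 integral0_eq// => t _ /=.
  rewrite (_ : xsection _ _ = [set x | mdot (rV_uncons p).2 x = c]).
    apply: IH; apply: contra_neq p0 => h; apply/rowP => i; rewrite mxE.
    case: (unliftP ord0 i) => [j ->|->] //.
    by move/rowP: h => /(_ j); rewrite !mxE.
  by apply/seteqP; split => x; rewrite /xsection/= inE/= dotE p00 mul0r add0r.
(* Slices along the first coordinate belong to the other iterated product, so the order of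
   integration is exchanged. *)
have -> : (lebesgue_measure \x lebesgue_rV n)%E (@rV_cons R n @^-1` [set x :
  'rV[R]_n.+1 | mdot p x = c]) =
    (lebesgue_measure \x^ lebesgue_rV n)%E (@rV_cons R n @^-1` [set x :
      'rV[R]_n.+1 | mdot p x = c]).
  apply: product_measure_unique => // A B mA mB; exact: product_measure2E.
rewrite /product_measure2 integral0_eq// => x _ /=.
rewrite (_ : ysection _ _ = [set (c - mdot (rV_uncons p).2 x) / p ord0 ord0]).
  by rewrite lebesgue_measure_set1.
apply/seteqP; split => t; rewrite /ysection/= inE/= dotE.
  by move=> <-; rewrite addrK mulrC mulKf.
by move=> ->; rewrite mulrC divfK// subrK.
Qed.

(** * Square integrable functions *)

Section square_integrable.
Context d (T : measurableType d) (R : realType) (mu : {measure set T -> \bar R}).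
Context (D : set T).
Hypothesis mD : measurable D.

Definition sqint (f : T -> R) :=
  measurable_fun D f /\ mu.-integrable D (EFin \o (fun x => f x ^+ 2)).

Definition ipD (f g : T -> R) : R := (\int[mu]_(x in D) (f x * g x))%R.

Lemma Lfun2_sqint (f : T -> R) : f \_ D \in Lfun mu 2%:E <-> sqint f.
Proof.
split=> [fL|[mf fi]].
  have mfD : measurable_fun setT (f \_ D).
    by move: fL; rewrite inE => /andP[+ _]; rewrite inE.
  split; first by apply/(measurable_restrictT _ _).2.
  have := Lfun2_integrable_sqr fL.
  rewrite (_ : EFin \o _ = (EFin \o (fun x => f x ^+ 2)) \_ D).
    by move/(integrable_mkcond _ mD).2.
  apply/funext => x /=; rewrite !patchE; case: ifPn => //= _.
  by rewrite expr0n.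
have mfD : measurable_fun setT (f \_ D) by apply/(measurable_restrictT _ _).1.
rewrite inE; apply/andP; split; first by rewrite inE.
rewrite inE/= /finite_norm unlock/=.
rewrite poweR_lty//.
move: fi => /(integrable_mkcond _ mD).1 /integrableP[_].
apply: le_lt_trans; apply: ge0_le_integral => //.
- apply/measurable_EFinP; apply: (measurableT_comp (measurable_powR _)) => //.
  exact: measurableT_comp.
- by apply: measurableT_comp => //; apply/(measurable_restrictT _ _).1 => //;
  apply/measurable_EFinP; exact: measurable_funX.
- move=> x _; rewrite !patchE; case: ifPn => //= _.
    by rewrite lee_fin powR_mulrn// normrX.
  by rewrite normr0 powR0// normr0.
Qed.

Lemma sqint_ae_le (f g : T -> R) : measurable_fun D f -> sqint g ->
  {ae mu, forall x, D x -> `|f x| <= `|g x|} -> sqint f.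
Proof.
move=> mf [mg gi] fg; split=> //; apply/integrableP; split.
  by apply/measurable_EFinP; exact: measurable_funX.
move/integrableP : gi => [_]; apply: le_lt_trans.
apply: ae_ge0_le_integral => //.
- by apply: measurableT_comp => //; apply/measurable_EFinP; exact: measurable_funX.
- by apply: measurableT_comp => //; apply/measurable_EFinP; exact: measurable_funX.
apply: filterS fg => x + Dx => /(_ Dx) h /=.
by rewrite lee_fin !normrX lerXn2r// nnegrE.
Qed.

Lemma sqint_mul_integrable f g : sqint f -> sqint g ->
  mu.-integrable D (EFin \o (fun x => f x * g x)).
Proof.
move=> [mf fi] [mg gi].
have := @integrableD _ _ _ mu D mD _ _ fi gi.
apply: le_integrable => //.
  by apply/measurable_EFinP; exact: measurable_funM.
move=> x Dx /=; rewrite lee_fin normrM.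
rewrite [leRHS]ger0_norm ?addr_ge0 ?sqr_ge0//.
rewrite -(real_normK (num_real (f x))) -(real_normK (num_real (g x))).
by have := sqr_ge0 (`|f x| - `|g x|);
  have := mulr_ge0 (normr_ge0 (f x)) (normr_ge0 (g x)); nra.
Qed.

Lemma sqint_lin k f g : sqint f -> sqint g -> sqint (fun x => k * f x + g x).
Proof.
move=> sf sg; have [mf fi] := sf; have [mg gi] := sg.
split; first by apply: measurable_funD => //; exact: measurable_funM.
have h := sqint_mul_integrable sf sg.
rewrite (_ : _ \o _ = ((fun x => (k ^+ 2)%:E * (EFin \o (fun x => (f x ^+ 2)%R)) x) \+
   ((fun x => (2 * k)%:E * (EFin \o (fun x => (f x * g x)%R)) x) \+ (EFin \o (fun x =>
     (g x ^+ 2)%R))))%E).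
  by apply: integrableD => //; [exact: integrableZl|apply: integrableD => //;
    exact: integrableZl].
by apply/funext => x /=; rewrite -!EFinM -!EFinD; congr (_%:E); ring.
Qed.

Lemma sqint0 : sqint (fun=> 0).
Proof. by split => //=; under eq_fun do rewrite expr0n; exact: integrable0. Qed.

Lemma sqintZ k f : sqint f -> sqint (fun x => k * f x).
Proof.
by move=> sf; have := sqint_lin k sf sqint0; under eq_fun do rewrite addr0.
Qed.

Lemma sqintD f g : sqint f -> sqint g -> sqint (fun x => f x + g x).
Proof.
by move=> sf sg; have := sqint_lin 1 sf sg; under eq_fun do rewrite mul1r.
Qed.

Lemma sqintB f g : sqint f -> sqint g -> sqint (fun x => f x - g x).
Proof.
move=> sf sg; have := sqint_lin (-1) sg sf.
by under eq_fun do rewrite mulN1r addrC.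
Qed.

Lemma sqint_sum I (s : seq I) (F : I -> T -> R) :
  (forall i, sqint (F i)) -> sqint (fun x => \sum_(i <- s) F i x).
Proof.
move=> h; elim: s => [|i s IH].
  by under eq_fun do rewrite big_nil; exact: sqint0.
by under eq_fun do rewrite big_cons; exact: sqintD.
Qed.

Lemma ipDC f g : ipD f g = ipD g f.
Proof. by apply: eq_Rintegral => x _; rewrite mulrC. Qed.

Lemma ipD_linl k f g h : sqint f -> sqint g -> sqint h ->
  ipD (fun x => k * f x + g x) h = k * ipD f h + ipD g h.
Proof.
move=> sf sg sh; rewrite /ipD.
have fh := sqint_mul_integrable sf sh; have gh := sqint_mul_integrable sg sh.
under eq_Rintegral do rewrite mulrDl -mulrA.
rewrite RintegralD// ?RintegralZl//.
by rewrite (_ : _ \o _ = (fun x => k%:E * (EFin \o (fun x => (f x * h x)%R)) x)%E)//;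
  exact: integrableZl.
Qed.

Lemma ipD_ge0 f : 0 <= ipD f f.
Proof. by apply: Rintegral_ge0 => x _; rewrite -expr2 sqr_ge0. Qed.

Lemma ipDZl k f h : sqint f -> sqint h -> ipD (fun x => k * f x) h = k * ipD f h.
Proof.
move=> sf sh; have z : ipD (fun=> 0) h = 0.
  by rewrite /ipD; under eq_Rintegral do rewrite mul0r; rewrite /Rintegral integral0.
have := ipD_linl k sf sqint0 sh.
by under eq_fun do rewrite addr0; rewrite z addr0.
Qed.

Lemma ipD_ae f f' g : measurable_fun D f -> measurable_fun D f' -> measurable_fun D g ->
  f = f' %[ae mu in D] -> ipD f g = ipD f' g.
Proof.
move=> mf mf' mg ff'; congr fine; apply: ae_eq_integral => //.
- by apply/measurable_EFinP; exact: measurable_funM.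
- by apply/measurable_EFinP; exact: measurable_funM.
by apply: filterS ff' => x + Dx => /(_ Dx) ->.
Qed.

Lemma ipD_eq0 f : sqint f -> ipD f f = 0 -> f = (fun=> 0) %[ae mu in D].
Proof.
move=> [mf fi]; rewrite /ipD => h.
have h2 : (\int[mu]_(x in D) `|(f x ^+ 2)%:E| = 0)%E.
  have := integrable_fin_num mD fi.
  rewrite (_ : (\int[mu]_(x in D) _)%E = (\int[mu]_(x in D) `|(f x ^+ 2)%:E|)%E).
    move=> ff; rewrite -(fineK ff); congr (_%:E); rewrite -[RHS]h; congr fine.
    by apply: eq_integral => x _ /=; rewrite -expr2 ger0_norm ?sqr_ge0.
  by apply: eq_integral => x _ /=; rewrite ger0_norm ?sqr_ge0.
have /(ae_eq_integral_abs mu mD) := h2.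
move=> /(_ (measurable_int _ fi)); apply: filterS => x + Dx => /(_ Dx) /= /eqP.
by rewrite eqe sqrf_eq0 => /eqP.
Qed.

End square_integrable.

Section Rintegral_sum.
Context d (T : measurableType d) (R : realType) (mu : {measure set T -> \bar R}).
Context (D : set T) (I : Type) (F : I -> T -> R).
Hypothesis mD : measurable D.
Hypothesis iF : forall i, mu.-integrable D (EFin \o F i).

Lemma integrable_Rsum (r : seq I) : mu.-integrable D (EFin \o (fun x =>
  \sum_(i <- r) F i x)).
Proof.
rewrite (_ : _ \o _ = (fun x => \sum_(i <- r) (EFin \o F i) x)%E);
  first exact: integrable_sum.
by apply/funext => x /=; rewrite sumEFin.
Qed.

Lemma Rintegral_sum (r : seq I) :
  (\int[mu]_(x in D) (\sum_(i <- r) F i x) = \sum_(i <- r) \int[mu]_(x in D) F i x)%R.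
Proof.
elim: r => [|i r IH].
  by under eq_Rintegral do rewrite big_nil; rewrite big_nil /Rintegral integral0.
under eq_Rintegral do rewrite big_cons.
by rewrite RintegralD// ?IH ?big_cons//; exact: integrable_Rsum.
Qed.

End Rintegral_sum.

Lemma ae_le_Rintegral d (T : measurableType d) (R : realType) (mu :
  {measure set T -> \bar R})
    (D : set T) (f g : T -> R) : measurable D ->
  mu.-integrable D (EFin \o f) -> mu.-integrable D (EFin \o g) ->
  {ae mu, forall x, D x -> f x <= g x} ->
  (\int[mu]_(x in D) f x <= \int[mu]_(x in D) g x)%R.
Proof.
move=> mD fi gi [N [mN N0 hN]].
have mDN : measurable (D `\` N) by exact: measurableD.
have E h : mu.-integrable D (EFin \o h) ->
  (\int[mu]_(x in D) h x = \int[mu]_(x in D `\` N) h x)%R.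
  by move=> hi; congr fine; exact: negligible_integral.
rewrite !E//; apply: le_Rintegral => //; [exact: integrableS fi|exact: integrableS gi|].
by move=> x [Dx Nx]; apply: contrapT => h; apply: Nx; apply: hN => /= /(_ Dx).
Qed.

(** * Completeness of the space of square integrable functions *)

Section riesz_fischer.
Context d (T : measurableType d) (R : realType) (mu : {measure set T -> \bar R}).
Context (D : set T).
Hypothesis mD : measurable D.
Local Notation sqint := (sqint mu D).
Local Notation ip := (ipD mu D).

Lemma ipD_sqE (f : T -> R) : sqint f ->
  (\int[mu]_(x in D) ((f x) ^+ 2)%:E = (ip f f)%:E)%E.
Proof.
move=> [mf fi]; rewrite /ipD /Rintegral; under [in RHS]eq_integral do rewrite -expr2.
by rewrite fineK//; exact: integrable_fin_num.
Qed.

Lemma sqint_ge0_lty (f : T -> R) : measurable_fun D f ->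
  (\int[mu]_(x in D) ((f x) ^+ 2)%:E < +oo)%E -> sqint f.
Proof.
move=> mf h; split=> //; apply/integrableP; split.
  by apply/measurable_EFinP; exact: measurable_funX.
apply: le_lt_trans h; rewrite le_eqVlt; apply/orP; left; apply/eqP.
by apply: eq_integral => x _ /=; rewrite ger0_norm ?sqr_ge0.
Qed.

Lemma cvg_geometric_increments (u : nat -> R) (M : R) :
  (forall k, `|u k.+1 - u k| <= M * (2^-1) ^+ k) -> cvgn u.
Proof.
move=> h; pose v k := u k.+1 - u k.
have uE : u = (fun k => u 0%N + series v k).
  apply/funext; elim=> [|k IH]; first by rewrite /series/= big_geq ?addr0.
  by rewrite /series/= big_nat_recr//= addrA -[X in X + _]IH /v addrC subrK.
rewrite uE; apply: is_cvgD; first exact: is_cvg_cst.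
apply: normed_cvg; apply: (@series_le_cvg _ _ (geometric M 2^-1)) => [n|n|n|].
- by rewrite /= normr_ge0.
- by apply: le_trans (h n); rewrite normr_ge0.
- exact: h.
by apply: is_cvg_geometric_series; rewrite ger0_norm// invf_lt1// ltr1n.
Qed.

(* Along such a sequence the series of 4^k (f_(k+1) - f_k)^2 has a finite
   integral, hence finite sums almost everywhere, and the increments are
   pointwise O(2^-k). *)
Lemma ae_cvg_fast (f : nat -> T -> R) : (forall n, sqint (f n)) ->
  (forall k, ip (fun x => f k.+1 x - f k x) (fun x => f k.+1 x - f k x) <= (8^-1) ^+ k) ->
  {ae mu, forall x, D x -> cvgn (fun k => f k x)}.
Proof.
move=> sf hf; pose h k x := ((4 ^+ k) * (f k.+1 x - f k x) ^+ 2)%:E.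
have mfn n : measurable_fun D (f n) by case: (sf n).
have mh k : measurable_fun D (h k).
  by apply/measurable_EFinP; apply: measurable_funM => //; apply: measurable_funX;
    exact: measurable_funB.
have h0 k x : D x -> (0 <= h k x)%E by move=> _; rewrite /h lee_fin; apply: mulr_ge0;
  [exact: exprn_ge0|exact: sqr_ge0].
have ih k : (\int[mu]_(x in D) h k x <= ((2^-1) ^+ k)%:E)%E.
  under eq_integral do rewrite /h EFinM.
  rewrite ge0_integralZl//; last 2 first.
    by apply/measurable_EFinP; apply: measurable_funX; exact: measurable_funB.
    by move=> x _; rewrite lee_fin sqr_ge0.
  rewrite ipD_sqE; last exact: sqintB.
  rewrite -EFinM lee_fin; apply: le_trans (ler_wpM2l _ (hf k)) _;
    first by rewrite exprn_ge0.
  by rewrite -exprMn le_eqVlt; apply/orP; left; apply/eqP; congr (_ ^+ k); field.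
have hS : (\int[mu]_(x in D) \sum_(k <oo) h k x < +oo)%E.
  rewrite integral_nneseries//.
  apply: (@le_lt_trans _ _ (\sum_(k <oo) ((2^-1) ^+ k)%:E)%E).
    by apply: lee_nneseries => // k _ _; apply: integral_ge0 => x; exact: h0.
  have := @cvg_geometric_series R 1 2^-1;
    rewrite ger0_norm// invf_lt1// ltr1n => /(_ isT) hc.
  rewrite (_ : (\sum_(k <oo) _)%E = (limn (series (geometric 1 (2^-1 : R))))%:E) ?ltry//.
  rewrite -EFin_lim; last by apply/cvg_ex; eexists; exact: hc.
  congr (limn _); apply/funext => n /=; rewrite /series/= sumEFin; congr (_%:E).
  by apply: eq_bigr => i _; rewrite mul1r.
have iS : mu.-integrable D (fun x => \sum_(k <oo) h k x)%E.
  apply/integrableP; split.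
    by apply: ge0_emeasurable_sum => // k x Dx _; exact: h0.
  apply: le_lt_trans hS; rewrite le_eqVlt; apply/orP; left; apply/eqP.
  by apply: eq_integral => x /set_mem Dx; rewrite gee0_abs//; apply: nneseries_ge0 => *;
    exact: h0.
have := integrable_ae mD iS; apply: filterS => x + Dx => /(_ Dx) hx.
pose S := fine (\sum_(k <oo) h k x)%E.
have hkS k : 4 ^+ k * (f k.+1 x - f k x) ^+ 2 <= S.
  rewrite -lee_fin /S fineK//.
  apply: le_trans (nneseries_lim_ge k.+1 _) => [|i _ _]; last exact: h0.
  by rewrite big_nat_recr//= leeDr//; apply: sume_ge0 => i _; exact: h0.
apply: (@cvg_geometric_increments _ (Num.sqrt S)) => k.
have S0 : 0 <= S by apply: le_trans (hkS 0%N); rewrite expr0 mul1r sqr_ge0.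
rewrite -(@ler_pXn2r _ 2)// ?nnegrE ?mulr_ge0 ?sqrtr_ge0 ?exprn_ge0 ?invr_ge0//.
rewrite real_normK ?num_real// exprMn sqr_sqrtr// exprAC (_ : (2^-1) ^+ 2 = 4^-1);
  last by field.
by rewrite exprVn ler_pdivlMr ?exprn_gt0// mulrC.
Qed.

(** A subsequence whose increments have squared norms below 8^-k converges almost everywhere by
    [ae_cvg_fast]; Fatou's lemma then passes the Cauchy estimate to the limit in one of its two
    indices. *)
Lemma sqint_complete (f : nat -> T -> R) : (forall n, sqint (f n)) ->
  (forall e : R, 0 < e -> exists N, forall n m, (N <= n)%N -> (N <= m)%N ->
     ip (fun x => f n x - f m x) (fun x => f n x - f m x) < e) ->
  exists2 g, sqint g & forall e : R, 0 < e -> exists N, forall n, (N <= n)%N ->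
     ip (fun x => f n x - g x) (fun x => f n x - g x) < e.
Proof.
move=> sf cf.
have mfn n : measurable_fun D (f n) by case: (sf n).
have phiP k : exists N, forall n m, (N <= n)%N -> (N <= m)%N ->
     ip (fun x => f n x - f m x) (fun x => f n x - f m x) < (8^-1) ^+ k.
  by apply: cf; rewrite exprn_gt0// invr_gt0.
pose phi0 k := projT1 (cid (phiP k)).
have phi0P k n m : (phi0 k <= n)%N -> (phi0 k <= m)%N ->
     ip (fun x => f n x - f m x) (fun x => f n x - f m x) < (8^-1) ^+ k.
  by rewrite /phi0; case: cid => N /= h; exact: h.
(* Summing the thresholds makes [phi] nondecreasing, and adding k makes it tend to infinity. *)
pose phi k := (\sum_(i < k.+1) phi0 i + k)%N.
have phi0_le k : (phi0 k <= phi k)%N by rewrite /phi big_ord_recr/= -addnA addnCA leq_addr.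
have phi_le k : (phi k <= phi k.+1)%N.
  by rewrite /phi [in leqRHS]big_ord_recr/= -addnA leq_add2l addnS leqW// leq_addl.
have k_phi k : (k <= phi k)%N by exact: leq_addl.
have aec : {ae mu, forall x, D x -> cvgn (fun k => f (phi k) x)}.
  apply: ae_cvg_fast => // k; apply/ltW/phi0P; last exact: phi0_le.
  exact: leq_trans (phi0_le k) (phi_le k).
(* The upper limit is defined and measurable everywhere, and equals the limit wherever the latter
   exists; [fine] discards infinite values. *)
pose g x := fine (limn_esup (fun k => (f (phi k) x)%:E)).
have mg : measurable_fun D g.
  apply: measurableT_comp => //; apply: measurable_fun_limn_esup => n.
  by apply/measurable_EFinP.
have gE : {ae mu, forall x, D x -> f (phi k) x @[k --> \oo] --> g x}.
  apply: filterS aec => x + Dx => /(_ Dx) /cvg_ex[l fl].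
  have fle : (f (phi k) x)%:E @[k --> \oo] --> l%:E by apply: cvg_EFin => //; exact: nearW.
  by rewrite /g (cvg_limn_einf_sup fle).2.
have key e : 0 < e -> exists N, forall n, (N <= n)%N ->
    (\int[mu]_(x in D) ((f n x - g x) ^+ 2)%:E <= e%:E)%E.
  move=> /cf[N hN]; exists N => n Nn.
  pose q k x := ((f n x - f (phi k) x) ^+ 2)%:E.
  have mq k : measurable_fun D (q k).
    by apply/measurable_EFinP; apply: measurable_funX; exact: measurable_funB.
  (* Written as a lower limit, the integrand has the form required by Fatou's lemma. *)
  rewrite (@ge0_ae_eq_integral _ _ _ mu D _ (fun x => limn_einf (q ^~ x))) //; last 4 first.
  - rewrite /limn_einf; apply: measurableT_comp => //; apply: measurable_fun_limn_esup => k.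
    by apply: measurableT_comp.
  - by move=> x _; rewrite lee_fin sqr_ge0.
  - move=> x _; rewrite limn_einf_lim; apply: lime_ge; first exact: is_cvg_einfs.
    apply: nearW => k; apply: le_ereal_inf_tmp => _ [i _ <-].
    by rewrite /q lee_fin sqr_ge0.
  - apply: filterS gE => x + Dx => /(_ Dx) fg.
    have qc : q k x @[k --> \oo] --> ((f n x - g x) ^+ 2)%:E.
      apply: cvg_EFin; first exact: nearW.
      rewrite /q /= expr2; under eq_fun do rewrite /= expr2.
      by apply: cvgM; apply: cvgB => //; exact: cvg_cst.
    by rewrite (cvg_limn_einf_sup qc).1.
  - apply: le_trans (fatou _ mD mq _) _; first by move=> k x _; rewrite lee_fin sqr_ge0.
    rewrite -[leRHS](@cvg_limn_einf_sup _ (fun=> e%:E) e%:E (cvg_cst _)).1.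
    rewrite !limn_einf_lim.
    apply: lee_lim; [exact: is_cvg_einfs|exact: is_cvg_einfs|].
    exists N => // k /= Nk; apply: le_ereal_inf_tmp => _ [i /= ki <-].
    apply: (@le_trans _ _ (\int[mu]_(x in D) q i x)%E); first by apply: ereal_inf_lbound;
      exists i.
    rewrite ipD_sqE; last exact: sqintB.
    rewrite lee_fin ltW// hN//; apply: leq_trans Nk _; exact: leq_trans ki (k_phi i).
  - by apply/measurable_EFinP; apply: measurable_funX; exact: measurable_funB.
have sfg : exists n, sqint (fun x => f n x - g x).
  have [N hN] := key 1 ltr01; exists N; apply: sqint_ge0_lty; first exact: measurable_funB.
  by apply: le_lt_trans (hN N _) _ => //; rewrite ltry.
have sg : sqint g.
  have [n sn] := sfg; have := sqintB mD (sf n) sn.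
  by under eq_fun do rewrite opprB addrC subrK.
(* Fatou's lemma yields only a weak inequality, so it is applied with e/2. *)
exists g => // e e0; have e2 : 0 < e / 2 by rewrite divr_gt0.
have [N hN] := key _ e2; exists N => n Nn.
have := hN _ Nn; rewrite ipD_sqE; last exact: sqintB.
by rewrite lee_fin => h; apply: le_lt_trans h _; lra.
Qed.

End riesz_fischer.

(** * Riesz representation for semidefinite forms *)

(** The leading coefficient may vanish, because the forms below are only semidefinite; in that case
    a nonzero linear coefficient would let the polynomial take the value -1. *)
Lemma quadratic_ge0_discr (R : realFieldType) (a b c : R) :
  0 <= c -> (forall t, 0 <= a + 2 * t * b + t ^+ 2 * c) -> b ^+ 2 <= a * c.
Proof.
rewrite le_eqVlt => /predU1P[c0|c0] h; last first.
- have := h (- b / c); have cc : c^-1 * c = 1 by rewrite mulVf// gt_eqF.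
  have ci : 0 < c^-1 by rewrite invr_gt0.
  rewrite (_ : a + _ + _ = a - b ^+ 2 * c^-1); last by field; rewrite gt_eqF.
  by rewrite subr_ge0 ler_pdivrMr.
- rewrite -c0 mulr0; suff -> : b = 0 by rewrite expr0n.
  apply/eqP; apply: contraT => b0; have := h (- (a + 1) / (2 * b)).
  rewrite -c0 mulr0 addr0 (_ : a + _ = - 1); last by field.
  by rewrite ler0N1.
Qed.

(** By the inequality of arithmetic and geometric means, y is at most sqrt(m x), hence at most (m +
    x)/2. With x = a v v and y = L v this bounds the functional minimized in [psd_riesz] from
    below. *)
Lemma sub_double_ge (R : realDomainType) (x y m : R) :
  0 <= x -> 0 <= m -> y ^+ 2 <= m * x -> - m <= x - 2 * y.
Proof.
move=> x0 m0 xy; rewrite leNgt; apply/negP => h.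
have h1 : 0 < 2 * y - x - m by lra.
have h2 : 0 < 2 * y + x + m by lra.
by have := sqr_ge0 (x - m); have := mulr_gt0 h1 h2; lra.
Qed.

Section psd_form.
Context {R : realType} {V : lmodType R} (S : set V) (a : V -> V -> R).
Hypothesis S_lin : forall k u v, S u -> S v -> S (k *: u + v).
Hypothesis a_sym : forall u v, S u -> S v -> a u v = a v u.
Hypothesis a_lin : forall k u v w, S u -> S v -> S w ->
  a (k *: u + v) w = k * a u w + a v w.
Hypothesis a_ge0 : forall u, S u -> 0 <= a u u.

Lemma psd_linr k u v w : S u -> S v -> S w -> a w (k *: u + v) = k * a w u + a w v.
Proof.
move=> Su Sv Sw; rewrite a_sym//; last exact: S_lin.
by rewrite a_lin// (a_sym Su)// (a_sym Sv).
Qed.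

Lemma psd_expand t u v : S u -> S v ->
  a (t *: v + u) (t *: v + u) = a u u + 2 * t * a u v + t ^+ 2 * a v v.
Proof.
move=> Su Sv; have Sw := S_lin t Sv Su.
by rewrite a_lin// !psd_linr// (a_sym Sv Su); ring.
Qed.

Lemma psd_CS u v : S u -> S v -> a u v ^+ 2 <= a u u * a v v.
Proof.
move=> Su Sv; apply: quadratic_ge0_discr; first exact: a_ge0; move=> t;
  rewrite -psd_expand//.
by apply: a_ge0; exact: S_lin.
Qed.

(* The form is only semidefinite, since functions are not identified with their
   classes. Minimizing a v v - 2 L v over S, the parallelogram law makes every
   minimizing sequence a Cauchy sequence. *)
Lemma psd_riesz (L : V -> R) (M : R) :
  S !=set0 ->
  (forall u : nat -> V, (forall n, S (u n)) ->
     (forall e : R, 0 < e -> exists N, forall n m, (N <= n)%N -> (N <= m)%N ->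
        a (u n - u m) (u n - u m) < e) ->
     exists2 l, S l & forall e : R, 0 < e -> exists N, forall n, (N <= n)%N ->
        a (u n - l) (u n - l) < e) ->
  (forall k u v, S u -> S v -> L (k *: u + v) = k * L u + L v) ->
  (forall u, S u -> L u ^+ 2 <= M * a u u) ->
  exists2 u, S u & forall v, S v -> a u v = L v.
Proof.
move=> [v0 Sv0] cmpl L_lin L_bnd.
have SB u v : S u -> S v -> S (u - v).
  by move=> Su Sv; rewrite -[- v]scaleN1r addrC; exact: S_lin.
pose J v := a v v - 2 * L v.
(* The sign of [M] is not prescribed, while the lower bound for [J] needs a nonnegative constant. *)
pose M1 := Num.max M 0.
have JM v : S v -> - M1 <= J v.
  move=> Sv; have := L_bnd _ Sv; have := a_ge0 Sv; rewrite /J.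
  have M1M : M <= M1 by rewrite le_max lexx.
  have M10 : 0 <= M1 by rewrite le_max lexx orbT.
  move: (a v v) (L v) => x y x0 xy.
  have : y ^+ 2 <= M1 * x by apply: le_trans xy _; exact: ler_wpM2r.
  exact: sub_double_ge.
pose I := [set J v | v in S].
have I0 : I !=set0 by exists (J v0), v0.
have Ilb : has_lbound I by exists (- M1) => _ [v Sv <-]; exact: JM.
have Iinf : has_inf I by split.
have uP n : exists u, S u /\ J u < inf I + n.+1%:R^-1.
  have n0 : 0 < n.+1%:R^-1 :> R by rewrite invr_gt0.
  by have [_ [u Su <-] hu] := inf_adherent n0 Iinf; exists u.
pose u n := projT1 (cid (uP n)).
have Su n : S (u n) by rewrite /u; case: cid => x [].
have uJ n : J (u n) < inf I + n.+1%:R^-1 by rewrite /u; case: cid => x [].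
have J_inf v : S v -> inf I <= J v by move=> Sv; apply: ge_inf => //; exists v.
have par n m : a (u n - u m) (u n - u m) <= 2 * (n.+1%:R^-1 + m.+1%:R^-1).
  have e1 : u n - u m = (-1) *: u m + u n by rewrite scaleN1r addrC.
  rewrite e1 psd_expand//.
  have S0 : S 0 by rewrite -(subrr (u 0%N)); exact: SB.
  (* The midpoint of [u m] and [u n], written so that the hypotheses on combinations [k *: u + v]
     apply. *)
  pose w := 2^-1 *: (1 *: u m + u n) + 0.
  have Sw : S w by apply: S_lin => //; apply: S_lin.
  have a0l v : S v -> a 0 v = 0.
    move=> Sv; have := @a_lin (-1) v v v Sv Sv Sv; rewrite scaleN1r addNr => ->.
    by rewrite mulN1r addNr.
  have L0 : L 0 = 0.
    have := L_lin (-1) _ _ S0 S0; rewrite scaleN1r addNr; lra.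
  have Smn : S (1 *: u m + u n) by exact: S_lin.
  have := J_inf _ Sw; rewrite /J /w psd_expand// !a0l// !L_lin// L0.
  rewrite psd_expand//.
  have := uJ n; have := uJ m; rewrite /J.
  move: (n.+1%:R^-1 : R) (m.+1%:R^-1 : R) => x y.
  by lra.
have [l Sl ul] : exists2 l, S l & forall e : R, 0 < e -> exists N, forall n, (N <= n)%N ->
        a (u n - l) (u n - l) < e.
  apply: cmpl => // e e0.
  have e4 : 0 < e / 4 by rewrite divr_gt0.
  have [N _ /= hN] := near_infty_natSinv_lt (PosNum e4).
  exists N => n m Nn Nm; apply: le_lt_trans (par n m) _.
  have := hN n Nn; have := hN m Nm => /=.
  move: (n.+1%:R^-1 : R) (m.+1%:R^-1 : R) => x y.
  by lra.
exists l => // v Sv.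
(* [J] at t v + u n is at least the infimum, which exceeds J (u n) - 1/(n+1). The resulting
   quadratic inequality in t bounds its linear coefficient a (u n) v - L v. *)
have key n : (a (u n) v - L v) ^+ 2 <= n.+1%:R^-1 * a v v.
  apply: quadratic_ge0_discr; first exact: a_ge0; move=> t.
  have Sw : S (t *: v + u n) by exact: S_lin.
  have := J_inf _ Sw; rewrite /J psd_expand// L_lin//.
  have := uJ n; rewrite /J; move: (n.+1%:R^-1 : R) => x.
  by lra.
(* The Cauchy-Schwarz inequality transfers the estimate from [u n] to the limit [l]. *)
have key2 n : (a l v - L v) ^+ 2 <= 2 * (a (u n - l) (u n - l) * a v v) + 2 * (n.+1%:R^-1
  * a v v).
  have Sd := SB _ _ (Su n) Sl.
  have := psd_CS Sd Sv.
  rewrite {1}(_ : u n - l = (-1) *: l + u n); last by rewrite scaleN1r addrC.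
  rewrite a_lin// => h1; have h2 := key n.
  have h3 : (a l v - L v) ^+ 2 <= 2 * (-1 * a l v + a (u n) v) ^+ 2 + 2 * (a (u n) v - L
    v) ^+ 2.
    rewrite -subr_ge0 (_ :
      _ - _ = (-1 * a l v + a (u n) v + (a (u n) v - L v)) ^+ 2) ?sqr_ge0//; by ring.
  by apply: le_trans h3 _; apply: lerD; rewrite ler_pM2l.
apply/eqP; rewrite -subr_eq0 -sqrf_eq0 eq_le sqr_ge0 andbT.
apply/ler_addgt0Pr => e e0; rewrite add0r.
have A0 := a_ge0 Sv.
(* Adding 1 keeps the denominator positive when [v] has zero energy. *)
have A1 : 0 < a v v + 1 by lra.
have e4 : 0 < e / (4 * (a v v + 1)) by rewrite divr_gt0// mulr_gt0.
have [N1 _ /= hN] := near_infty_natSinv_lt (PosNum e4).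
have [N2 hN2] := ul _ e4.
have h1 := hN (maxn N1 N2) (leq_maxl _ _).
have h2 := hN2 (maxn N1 N2) (leq_maxr _ _).
apply: le_trans (key2 (maxn N1 N2)) _.
move: h1 h2 => /=; move: ((maxn N1 N2).+1%:R^-1 : R) (a (u _ - l) _) => x y.
have : e / (4 * (a v v + 1)) * (a v v + 1) = e / 4 by field; rewrite gt_eqF.
move: (e / (4 * (a v v + 1))) e4 => z z0 ze xz yz.
have : x * a v v <= z * a v v by apply: ler_wpM2r => //; exact: ltW.
have : y * a v v <= z * a v v by apply: ler_wpM2r => //; exact: ltW.
by lra.
Qed.

End psd_form.

(** * Smooth functions and integration by parts *)

Lemma dist_split_le (R : realFieldType) (p q r e : R) :
  `|q - p| < e / 2 -> `|r - p| < e / 2 -> `|q - r| <= e.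
Proof.
move=> h1 h2; rewrite (_ : q - r = (q - p) - (r - p)); last by ring.
by apply: le_trans (ler_normB _ _) _; lra.
Qed.

Section line_derivatives.
Context {R : realType} {V : normedModType R}.
Implicit Types (f : V -> R) (x v : V).

Lemma line_is_derive f x v (t : R) : derivable f (x + t *: v) v ->
  is_derive t 1 (fun s : R => f (x + s *: v)) ('D_v f (x + t *: v)).
Proof.
move=> df.
have E : (fun h => h^-1 *: (((fun s : R =>
  f (x + s *: v)) \o shift t) (h *: 1) - f (x + t *: v))) =
   (fun h => h^-1 *: ((f \o shift (x + t *: v)) (h *: v) - f (x + t *: v))).
  apply/funext => h /=; congr (_ *: (f _ - _)).
  by rewrite [h *: 1]mulr1 scalerDl addrCA addrA.
by split; rewrite /derivable /derive E.
Qed.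

Lemma line_MVT f x v (h : R) : 0 < h -> (forall y, derivable f y v) ->
  exists2 c : R, 0 < c < h & f (x + h *: v) - f x = h * 'D_v f (x + c *: v).
Proof.
move=> h0 df.
have [|//||c ch E] := @MVT R (fun s : R => f (x + s *: v)) (fun s =>
  'D_v f (x + s *: v)) 0 h.
- exact: h0.
- by move=> s _; exact: line_is_derive.
- apply: derivable_within_continuous => s _.
  by have [] := @line_is_derive f x v s (df _).
exists c; first by move: ch; rewrite in_itv.
by move: E; rewrite scale0r addr0 subr0 mulrC.
Qed.

Lemma derivable_shift f x v y :
  (forall z, derivable f z v) -> derivable (fun z => f (z + y)) x v.
Proof.
move=> df; have := df (x + y); rewrite /derivable.
rewrite (_ : (fun h => _ *: ((f \o _) _ - _)) = (fun h => h^-1 *: (((fun z : V =>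
  f (z + y)) \o shift x) (h *: v) - f (x + y))))//.
by apply/funext => h /=; rewrite addrA.
Qed.

Lemma derive_shift f x v y : 'D_v (fun z => f (z + y)) x = 'D_v f (x + y).
Proof.
have E : (fun h => h^-1 *: (((fun z : V => f (z + y)) \o shift x) (h *: v) - f (x + y))) =
   (fun h => h^-1 *: ((f \o shift (x + y)) (h *: v) - f (x + y))).
  by apply/funext => h /=; rewrite addrA.
by rewrite /derive E.
Qed.

(* The second difference is symmetric in u and v, which yields the symmetry of
   second derivatives. *)
Lemma second_difference f x u v (h : R) : 0 < h ->
  (forall y, derivable f y u) -> (forall y, derivable ('D_u f) y v) ->
  exists c d : R, [/\ 0 < c < h, 0 < d < h &
    f (x + h *: u + h *: v) - f (x + h *: u) - (f (x + h *: v) - f x) =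
    h * (h * 'D_v ('D_u f) (x + c *: u + d *: v))].
Proof.
move=> h0 du duv.
pose g z := f (z + h *: v) - f z.
have dfs z : derivable (fun z => f (z + h *: v)) z u by exact: derivable_shift.
have dg z : derivable g z u by exact: (derivableB (dfs z) (du z)).
have [c ch gE] := line_MVT x h0 dg.
have Dg : 'D_u g (x + c *: u) = 'D_u f (x + c *: u + h *: v) - 'D_u f (x + c *: u).
  by rewrite (deriveB (dfs _) (du _)) derive_shift.
have [d dh E] := line_MVT (x + c *: u) h0 duv.
exists c, d; split => //; rewrite -E -Dg -gE /g; ring.
Qed.

(** Both orders of differentiation evaluate the same second difference, so the two mixed derivatives
    agree when taken at two suitable points close to [x]; continuity at [x] does the rest. *)
Lemma derive_comm f x u v :
  (forall y, derivable f y u) -> (forall y, derivable f y v) ->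
  (forall y, derivable ('D_u f) y v) -> (forall y, derivable ('D_v f) y u) ->
  {for x, continuous ('D_v ('D_u f))} -> {for x, continuous ('D_u ('D_v f))} ->
  'D_v ('D_u f) x = 'D_u ('D_v f) x.
Proof.
move=> du dv duv dvu cvu cuv.
apply/eqP; rewrite -subr_eq0 -normr_eq0 eq_le normr_ge0 andbT.
apply/ler_addgt0Pr => e e0; rewrite add0r.
have e2 : 0 < e / 2 by rewrite divr_gt0.
have /cvgrPdist_lt/(_ _ e2)/nbhs_ballP[r1 /= r10 h1] := cvu.
have /cvgrPdist_lt/(_ _ e2)/nbhs_ballP[r2 /= r20 h2] := cuv.
(* Steps shorter than min(r1, r2) / M in both directions keep the intermediate points in both balls;
   the 1 prevents division by zero. *)
pose M := `|u| + `|v| + 1.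
have M0 : 0 < M by rewrite ltr_wpDl// addr_ge0.
pose h := Num.min r1 r2 / M.
have h0 : 0 < h by rewrite divr_gt0// lt_min r10.
have close (c d : R) (a b : V) : `|a| + `|b| + 1 = M -> 0 < c < h -> 0 < d < h ->
    `|x - (x + c *: a + d *: b)| < Num.min r1 r2.
  move=> abM /andP[c0 ch] /andP[d0 dh].
  rewrite -addrA opprD addNKr normrN.
  apply: le_lt_trans (ler_normD _ _) _; rewrite !normrZ !gtr0_norm//.
  apply: (@le_lt_trans _ _ (h * (`|a| + `|b|))).
    by rewrite mulrDr lerD// ler_wpM2r// ltW.
  apply: (@lt_le_trans _ _ (h * M)); first by rewrite ltr_pM2l// -abM ltrDl.
  by rewrite /h divfK// gt_eqF.
have [c1 [d1 [c1h d1h E1]]] := second_difference x h0 du duv.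
have [c2 [d2 [c2h d2h E2]]] := second_difference x h0 dv dvu.
have E : 'D_v ('D_u f) (x + c1 *: u + d1 *: v) = 'D_u ('D_v f) (x + c2 *: v + d2 *: u).
  apply: (mulfI (lt0r_neq0 h0)); apply: (mulfI (lt0r_neq0 h0)).
  apply: (etrans (esym E1)); apply: (etrans _ E2); rewrite [x + h *: v + h *: u]addrAC.
  by move: (f _) (f _) (f _) (f _) => p q r s; ring.
have b1 : ball x r1 (x + c1 *: u + d1 *: v).
  have := close _ _ _ _ (erefl M) c1h d1h.
  by rewrite lt_min -ball_normE => /andP[].
have b2 : ball x r2 (x + c2 *: v + d2 *: u).
  have vuM : `|v| + `|u| + 1 = M by rewrite /M (addrC `|v|).
  have := close _ _ _ _ vuM c2h d2h.
  by rewrite lt_min -ball_normE => /andP[].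
have {}k1 : `|'D_v ('D_u f) x - 'D_v ('D_u f) (x + c1 *: u + d1 *: v)| < e / 2 := h1 _ b1.
have {}k2 : `|'D_u ('D_v f) x - 'D_v ('D_u f) (x + c1 *: u + d1 *: v)| < e / 2.
  by rewrite E; exact: h2.
exact: dist_split_le k1 k2.
Qed.

Lemma derive_zero_outside f (K : set V) x v : closed K ->
  (forall y, ~ K y -> f y = 0) -> ~ K x -> 'D_v f x = 0.
Proof.
move=> cK f0 Kx.
rewrite -(derive_cst (0 : R) x v); apply: near_eq_derive.
near=> y; apply: f0; near: y.
by apply: open_nbhs_nbhs; split => //; exact: closed_openC.
Unshelve. all: by end_near. Qed.

Lemma derivable_cst0 x v : derivable ((fun=> 0) : V -> R) x v.
Proof. exact: (derivable_cst (0 : R)). Qed.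

Lemma continuous_lin (T : topologicalType) (k : R) (f g : T -> R) :
  continuous f -> continuous g -> continuous (fun t : T => k * f t + g t).
Proof.
move=> cf cg t; apply: cvgD; last exact: cg.
by apply: cvgM; [exact: cvg_cst|exact: cf].
Qed.

Lemma continuous_add (T : topologicalType) (f g : T -> R) :
  continuous f -> continuous g -> continuous (fun t : T => f t + g t).
Proof. by move=> cf cg t; apply: cvgD; [exact: cf|exact: cg]. Qed.

Lemma continuous_mul (T : topologicalType) (f g : T -> R) :
  continuous f -> continuous g -> continuous (fun t : T => f t * g t).
Proof. by move=> cf cg t; apply: cvgM; [exact: cf|exact: cg]. Qed.

Lemma derivable_lin (k : R) f g x v : derivable f x v -> derivable g x v ->
  derivable (fun y => k * f y + g y) x v.
Proof. by move=> df dg; have h := derivableZ (k := k) df; exact: (derivableD h dg). Qed.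

Lemma derive_lin (k : R) f g x v : derivable f x v -> derivable g x v ->
  'D_v (fun y => k * f y + g y) x = k * 'D_v f x + 'D_v g x.
Proof.
move=> df dg; have h := derivableZ (k := k) df.
have := deriveD h dg; rewrite (deriveZ _ df); exact: id.
Qed.

End line_derivatives.

Section smooth_functions.
Context {R : realType} {n : nat}.
Implicit Types (f g : 'rV[R]_n -> R) (i j : 'I_n) (s : seq 'I_n).
Local Notation E i := (delta_mx ord0 i : 'rV[R]_n).
Local Notation dv s f := (foldr (@partial R n) f s).

Lemma smooth_continuous f : smooth f -> continuous f.
Proof. by move=> /(_ [::])[]. Qed.

Lemma smooth_derivable f i x : smooth f -> derivable f x (E i).
Proof. by move=> /(_ [::])[_]. Qed.

Lemma smooth_dv f s : smooth f -> smooth (dv s f).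
Proof. by move=> sf t; have := sf (t ++ s); rewrite foldr_cat. Qed.

Lemma smooth_partial f i : smooth f -> smooth (partial i f).
Proof. exact: (@smooth_dv f [:: i]). Qed.

Lemma partial_lin k f g i :
  (forall x, derivable f x (E i)) -> (forall x, derivable g x (E i)) ->
  partial i (fun x => k * f x + g x) = (fun x => k * partial i f x + partial i g x).
Proof.
move=> df dg; apply/funext => x; rewrite /partial.
exact: derive_lin.
Qed.

Lemma dv_lin k f g s : smooth f -> smooth g ->
  dv s (fun x => k * f x + g x) = (fun x => k * dv s f x + dv s g x).
Proof.
move=> sf sg; elim: s => [//|i s /= ->].
by apply: partial_lin => x; apply: smooth_derivable; exact: smooth_dv.
Qed.

Lemma smooth_lin k f g : smooth f -> smooth g -> smooth (fun x => k * f x + g x).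
Proof.
move=> sf sg s; rewrite dv_lin//; split.
  by apply: continuous_lin; apply: smooth_continuous; exact: smooth_dv.
by move=> i x; apply: derivable_lin; apply: smooth_derivable; exact: smooth_dv.
Qed.

Lemma dv0 s : dv s ((fun=> 0) : 'rV[R]_n -> R) = (fun=> 0).
Proof.
elim: s => [//|i s /= ->]; apply/funext => x; exact: (derive_cst (0 : R)).
Qed.

Lemma smooth0 : smooth ((fun=> 0) : 'rV[R]_n -> R).
Proof.
move=> s; rewrite dv0.
by split; [exact: cst_continuous|move=> i x; exact: derivable_cst0].
Qed.

Lemma smoothZ k f : smooth f -> smooth (fun x => k * f x).
Proof.
move=> sf; rewrite (_ : (fun x => _) = (fun x => k * f x + 0));
  last by apply/funext => x; rewrite addr0.
exact: (smooth_lin _ sf smooth0).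
Qed.

Lemma smooth_sum I (r : seq I) (k : I -> R) (F : I -> 'rV[R]_n -> R) :
  (forall l, smooth (F l)) -> smooth (fun x => \sum_(l <- r) k l * F l x).
Proof.
move=> h; elim: r => [|l r IH].
  by rewrite (_ : (fun x => _) = (fun=> 0)) ?funeqE => [|x];
    [exact: smooth0|rewrite big_nil].
rewrite (_ : (fun x => _) = (fun x => k l * F l x + \sum_(l <- r) k l * F l x));
  last by apply/funext => x; rewrite big_cons.
exact: smooth_lin.
Qed.

Lemma dv_sum I (r : seq I) (k : I -> R) (F : I -> 'rV[R]_n -> R) s :
  (forall l, smooth (F l)) ->
  dv s (fun x => \sum_(l <- r) k l * F l x) = (fun x => \sum_(l <- r) k l * dv s (F l) x).
Proof.
move=> h; elim: r => [|l r IH].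
  by under eq_fun do rewrite big_nil; rewrite dv0; apply/funext => x; rewrite big_nil.
under eq_fun do rewrite big_cons; rewrite dv_lin//; last exact: smooth_sum.
by rewrite IH; apply/funext => x; rewrite big_cons.
Qed.

Lemma partial_comm f i j : smooth f -> partial i (partial j f) = partial j (partial i f).
Proof.
move=> sf; apply/funext => x; rewrite /partial; apply: derive_comm => [y|y|y|y||].
- exact: smooth_derivable.
- exact: smooth_derivable.
- exact: (smooth_derivable (smooth_partial j sf)).
- exact: (smooth_derivable (smooth_partial i sf)).
- exact: (smooth_continuous (smooth_partial i (smooth_partial j sf))).
- exact: (smooth_continuous (smooth_partial j (smooth_partial i sf))).
Qed.

(** In [ibp] the outermost derivative of one factor becomes the innermost one on the other factor;
    this commutation restores the order. *)
Lemma dv_partial f i s : smooth f -> dv s (partial i f) = partial i (dv s f).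
Proof.
move=> sf; elim: s => [//|j s /= ->].
by rewrite partial_comm//; exact: smooth_dv.
Qed.

(** A multi-index spelled out as a word of directions, so that induction on lists applies and the
    order of the derivative is the length of the word. *)
Definition multi_seq k (al : {ffun 'I_n -> 'I_k}) : seq 'I_n :=
  flatten [seq nseq (al i) i | i <- enum 'I_n].

Lemma multi_partialE k (al : {ffun 'I_n -> 'I_k}) f :
  multi_partial al f = dv (multi_seq al) f.
Proof.
rewrite /multi_partial /multi_seq; elim: (enum _) => [//|i r /= ->].
by rewrite foldr_cat; elim: (al i : nat) => [//|m /= ->].
Qed.

Lemma size_multi_seq k (al : {ffun 'I_n -> 'I_k}) :
  size (multi_seq al) = (\sum_i al i)%N.
Proof.
rewrite size_flatten /shape -map_comp sumnE big_map big_enum.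
by apply: eq_bigr => i _; rewrite /= size_nseq.
Qed.

Lemma dv_zero_outside f (K : set 'rV[R]_n) s : closed K ->
  (forall x, ~ K x -> f x = 0) -> forall x, ~ K x -> dv s f x = 0.
Proof.
move=> cK f0; elim: s => [//|i s /= IH] x Kx; exact: (derive_zero_outside _ cK IH).
Qed.

End smooth_functions.

(** * Integrals of derivatives of functions with compact support *)

Lemma continuous_cbox_integrable {R : realType} n (f : 'rV[R]_n -> R) (a b : 'rV[R]_n) :
  continuous f -> (forall x, ~ cbox a b x -> f x = 0) ->
  (lebesgue_rV n).-integrable setT (EFin \o f).
Proof.
move=> cf f0.
have -> : EFin \o f = (EFin \o f) \_ (cbox a b).
  apply/funext => x /=; rewrite patchE; case: ifPn => // /negP xab /=.
  by rewrite f0// => h; apply: xab; rewrite inE.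
apply/(integrable_mkcond _ (measurable_cbox a b)).1.
apply: measurable_bounded_integrable => //.
- exact: measurable_cbox.
- exact: lebesgue_cbox_fin.
- by apply: measurable_funTS; exact: continuous_rV_measurable.
have /compact_bounded[M [Mr hM]] : compact (f @` cbox a b).
  by apply: continuous_compact; [exact: continuous_subspaceT|exact: compact_cbox].
exists M; split => // y My x xab.
by apply: hM My _ _; exists x.
Qed.

Lemma integral_derive_compact_support {R : realType} (f : R -> R) (a b : R) :
  (forall t, derivable f t 1) -> continuous ('D_1 f) ->
  (forall t, ~ `[a, b]%classic t -> f t = 0) ->
  (\int[@lebesgue_measure R]_t ('D_1 f t)%:E = 0)%E.
Proof.
move=> df cf f0.
(* The endpoints of the enlarged interval lie where [f] vanishes; minimum and maximum take care of
   the case b < a. *)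
pose a' := Num.min a b - 1; pose b' := Num.max a b + 1.
have [ma mb] : Num.min a b <= a /\ b <= Num.max a b by rewrite ge_min le_max !lexx orbT.
have mab : Num.min a b <= Num.max a b by rewrite ge_min !le_max !lexx.
have a'b' : a' < b' by rewrite /a' /b'; lra.
have fcont t : {for t, continuous f}.
  by apply: differentiable_continuous; apply/derivable1_diffP.
have -> : (\int[@lebesgue_measure R]_t ('D_1 f t)%:E = \int[@lebesgue_measure R]_(t in
  `[a', b']) ('D_1 f t)%:E)%E.
  rewrite [RHS]integral_mkcond; apply: eq_integral => t _; rewrite patchE.
  case: ifPn => // /negP tab.
  rewrite (@derive_zero_outside R R f `[a, b]%classic)//; first exact: interval_closed.
  move=> h; apply: tab; rewrite inE/= in_itv/=; move: h; rewrite /= in_itv/= => /andP[? ?].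
  by rewrite /a' /b'; apply/andP; split; lra.
rewrite (@continuous_FTC2 _ _ f)//.
- rewrite !f0 ?subee// /= in_itv/= /a' /b'; apply/negP; rewrite negb_and -!ltNge.
    by apply/orP; left; lra.
  by apply/orP; right; lra.
- exact: continuous_subspaceT.
- split; first by move=> t _.
    by apply: cvg_at_right_filter; exact: fcont.
  by apply: cvg_at_left_filter; exact: fcont.
- by move=> t _; rewrite derive1E.
Qed.

Section partial_rV_cons.
Context {R : realType} {n : nat}.
Implicit Types (F : 'rV[R]_n.+1 -> R) (x : 'rV[R]_n) (t : R).

Lemma rV_cons_shift0 (h t : R) x :
  h *: delta_mx ord0 ord0 + rV_cons (t, x) = rV_cons (h * 1 + t, x).
Proof.
apply/rowP => i; rewrite /rV_cons !mxE /= mulr1; case: (unliftP ord0 i) => [j ->|->] /=.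
  by rewrite mulr0 add0r.
by rewrite mulr1.
Qed.

Lemma rV_cons_shift (j : 'I_n) (h t : R) x :
  h *: delta_mx ord0 (lift ord0 j) + rV_cons (t, x) = rV_cons (t, h *: delta_mx ord0 j + x).
Proof.
apply/rowP => i; rewrite /rV_cons !mxE /=; case: (unliftP ord0 i) => [k ->|->] /=.
  by rewrite !mxE (inj_eq lift_inj).
by rewrite mulr0 add0r.
Qed.

Lemma derivable_rV_cons0 F x t : derivable F (rV_cons (t, x)) (delta_mx ord0 ord0) ->
  derivable (fun s : R => F (rV_cons (s, x))) t 1.
Proof.
have E : (fun h => h^-1 *: (((fun s : R =>
  F (rV_cons (s, x))) \o shift t) (h *: 1) - F (rV_cons (t, x)))) =
   (fun h => h^-1 *: ((F \o shift (rV_cons (t,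
     x))) (h *: delta_mx ord0 ord0) - F (rV_cons (t, x)))).
  by apply/funext => h /=; rewrite rV_cons_shift0.
by rewrite /derivable -E.
Qed.

Lemma derive_rV_cons0 F x t :
  'D_1 (fun s : R => F (rV_cons (s, x))) t = partial ord0 F (rV_cons (t, x)).
Proof.
have E : (fun h => h^-1 *: (((fun s : R =>
  F (rV_cons (s, x))) \o shift t) (h *: 1) - F (rV_cons (t, x)))) =
   (fun h => h^-1 *: ((F \o shift (rV_cons (t,
     x))) (h *: delta_mx ord0 ord0) - F (rV_cons (t, x)))).
  by apply/funext => h /=; rewrite rV_cons_shift0.
by rewrite /partial /derive -E.
Qed.

Lemma derivable_rV_cons F (j : 'I_n) x t :
  derivable F (rV_cons (t, x)) (delta_mx ord0 (lift ord0 j)) ->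
  derivable (fun y : 'rV[R]_n => F (rV_cons (t, y))) x (delta_mx ord0 j).
Proof.
have E : (fun h => h^-1 *: (((fun y : 'rV[R]_n =>
  F (rV_cons (t, y))) \o shift x) (h *: delta_mx ord0 j) - F (rV_cons (t, x)))) =
   (fun h => h^-1 *: ((F \o shift (rV_cons (t,
     x))) (h *: delta_mx ord0 (lift ord0 j)) - F (rV_cons (t, x)))).
  by apply/funext => h /=; rewrite rV_cons_shift.
by rewrite /derivable -E.
Qed.

Lemma partial_rV_cons F (j : 'I_n) x t :
  partial j (fun y : 'rV[R]_n =>
    F (rV_cons (t, y))) x = partial (lift ord0 j) F (rV_cons (t, x)).
Proof.
have E : (fun h => h^-1 *: (((fun y : 'rV[R]_n =>
  F (rV_cons (t, y))) \o shift x) (h *: delta_mx ord0 j) - F (rV_cons (t, x)))) =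
   (fun h => h^-1 *: ((F \o shift (rV_cons (t,
     x))) (h *: delta_mx ord0 (lift ord0 j)) - F (rV_cons (t, x)))).
  by apply/funext => h /=; rewrite rV_cons_shift.
by rewrite /partial /derive -E.
Qed.

Lemma rV_cons_ball (t s : R) x y e : ball t e s -> ball x e y ->
  ball (rV_cons (t, x)) e (rV_cons (s, y)).
Proof.
move=> ts [e0 xy]; split => // i j; rewrite (ord1 i) /rV_cons !mxE /=.
by case: (unlift ord0 j) => [k|] //=.
Qed.

Lemma continuous_rV_cons0 x : continuous (fun t : R => rV_cons (t, x)).
Proof.
move=> t B /nbhs_ballP[e /= e0 eB]; apply/nbhs_ballP; exists e => //= s ts.
by apply/eB/rV_cons_ball => //; exact: ballxx.
Qed.

Lemma continuous_rV_cons t : continuous (fun x : 'rV[R]_n => rV_cons (t, x)).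
Proof.
move=> x B /nbhs_ballP[e /= e0 eB]; apply/nbhs_ballP; exists e => //= s ts.
by apply/eB/rV_cons_ball => //; exact: ballxx.
Qed.

Lemma cbox_rV_cons (a b : 'rV[R]_n.+1) t x : cbox a b (rV_cons (t, x)) <->
  `[a ord0 ord0, b ord0 ord0]%classic t /\ cbox (rV_uncons a).2 (rV_uncons b).2 x.
Proof.
split=> [h|[]].
  split; first by have := h ord0; rewrite /rV_cons mxE unlift_none /= in_itv.
  by move=> i; have := h (lift ord0 i); rewrite /rV_cons !mxE liftK.
rewrite /= in_itv/= => h1 h2 i; rewrite /rV_cons mxE.
case: (unliftP ord0 i) => [j ->|->] //=.
by have := h2 j; rewrite !mxE.
Qed.

End partial_rV_cons.

(** If i is the first direction, Fubini's theorem puts the integral along it inside, where the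
    fundamental theorem of calculus applies. Otherwise the inner integral runs over a slice at a
    fixed first coordinate, to which the induction hypothesis applies. *)
Lemma integral_partial_compact_support {R : realType} n (i : 'I_n) (F : 'rV[R]_n -> R) a b :
  (forall x, derivable F x (delta_mx ord0 i)) -> continuous (partial i F) ->
  (forall x, ~ cbox a b x -> F x = 0) ->
  (\int[lebesgue_rV n]_x (partial i F x)%:E = 0)%E.
Proof.
elim: n => [|n IH] in i F a b *; first by case: i.
move=> dF cF F0.
have pF0 x : ~ cbox a b x -> partial i F x = 0.
  by apply: derive_zero_outside => //; exact: closed_cbox.
have iF := continuous_cbox_integrable cF pF0.
case: (unliftP ord0 i) => [j ij|i0]; last first.
  rewrite i0 in dF cF iF pF0 *; rewrite (integral_rVS_G iF).
  apply: integral0_eq => x _.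
  under eq_integral do rewrite /= -derive_rV_cons0.
  apply: (@integral_derive_compact_support _ _ (a ord0 ord0) (b ord0 ord0)).
  - by move=> t; apply: derivable_rV_cons0; exact: dF.
  - have -> : 'D_1 (fun s : R => F (rV_cons (s, x))) = partial ord0 F \o (fun t : R =>
    rV_cons (t, x)).
      by apply/funext => t; rewrite derive_rV_cons0.
    by move=> t; apply: continuous_comp; [exact: continuous_rV_cons0|exact: cF].
  - by move=> t tab; apply: F0 => /cbox_rV_cons[].
rewrite ij in dF cF iF pF0 *; rewrite (integral_rVS_F iF).
apply: integral0_eq => t _.
under eq_integral do rewrite /= -partial_rV_cons.
apply: (@IH j _ (rV_uncons a).2 (rV_uncons b).2).
- by move=> x; apply: derivable_rV_cons; exact: dF.
- rewrite (_ : partial j _ = partial (lift ord0 j) F \o (fun x : 'rV[R]_n =>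
  rV_cons (t, x))); last first.
    by apply/funext => x; rewrite partial_rV_cons.
  by move=> x; apply: continuous_comp; [exact: continuous_rV_cons|exact: cF].
- by move=> x xab; apply: F0 => /cbox_rV_cons[].
Qed.

Section integration_by_parts.
Context {R : realType} {n : nat}.
Local Notation mu := (lebesgue_rV (R := R) n).
Local Notation dv s f := (foldr (@partial R n) f s).
Implicit Types (f g : 'rV[R]_n -> R).

Lemma smooth_mul_integrable f g a b : smooth f -> smooth g ->
  (forall x, ~ cbox a b x -> f x = 0) ->
  mu.-integrable setT (EFin \o (fun x => f x * g x)).
Proof.
move=> sf sg f0; apply: (@continuous_cbox_integrable _ _ _ a b).
  by apply: continuous_mul; exact: smooth_continuous.
by move=> x xab; rewrite f0// mul0r.
Qed.

Lemma ibp1 i f g a b : smooth f -> smooth g ->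
  (forall x, ~ cbox a b x -> f x = 0) ->
  (\int[mu]_x (partial i f x * g x) = - \int[mu]_x (f x * partial i g x))%R.
Proof.
move=> sf sg f0.
have pE : partial i (fun x => f x * g x) = (fun x =>
  f x * partial i g x + partial i f x * g x).
  apply/funext => x; rewrite /partial [partial i f x * g x]mulrC.
  have := deriveM (smooth_derivable (i := i) (x := x) sf) (smooth_derivable sg).
  exact: id.
have pf0 x : ~ cbox a b x -> partial i f x = 0.
  by apply: derive_zero_outside => //; exact: closed_cbox.
have i1 := smooth_mul_integrable sf (smooth_partial i sg) f0.
have i2 := smooth_mul_integrable (smooth_partial i sf) sg pf0.
apply/eqP; rewrite -addr_eq0 -RintegralD// /Rintegral.
have := @integral_partial_compact_support R n i (fun x => f x * g x) a b.
rewrite pE => H.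
under eq_integral do rewrite addrC.
rewrite H//.
- move=> x; exact: (derivableM (smooth_derivable (i := i) (x :=
  x) sf) (smooth_derivable sg)).
- apply: (@continuous_add _ _ (fun x => f x * partial i g x) (fun x =>
  partial i f x * g x)).
    by apply: continuous_mul;
      [exact: smooth_continuous|exact: (smooth_continuous (smooth_partial i sg))].
  by apply: continuous_mul;
    [exact: (smooth_continuous (smooth_partial i sf))|exact: smooth_continuous].
- by move=> x xab; rewrite f0// mul0r.
Qed.

Lemma ibp s f g a b : smooth f -> smooth g ->
  (forall x, ~ cbox a b x -> f x = 0) ->
  (\int[mu]_x (dv s f x * g x) = (-1) ^+ size s * \int[mu]_x (f x * dv s g x))%R.
Proof.
elim: s g => [|i s IH] g sf sg f0 /=; first by rewrite expr0 mul1r.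
have dvf0 : forall x, ~ cbox a b x -> dv s f x = 0.
  by apply: dv_zero_outside; [exact: closed_cbox|exact: f0].
rewrite (ibp1 i (smooth_dv s sf) sg dvf0) (IH _ sf (smooth_partial i sg) f0).
by rewrite (dv_partial i s sg) exprS mulN1r mulNr.
Qed.

End integration_by_parts.

(** * Bump functions and the fundamental lemma *)

Section flat_functions.
Context {R : realType}.
Implicit Types (P : {poly R}) (t : R).

(** For [P] = 1 this is the classical function exp(-1/t), which vanishes to infinite order at 0. The
    polynomial factor closes the family under differentiation, so that derivatives of all orders are
    treated at once. *)
Definition flat P t : R := if 0 < t then P.[t^-1] * expR (- t^-1) else 0.

(* For t > 0, the derivative of P(1/t) exp(-1/t) is
   (1/t)^2 (P - P')(1/t) exp(-1/t). *)
Definition flat_deriv P : {poly R} := 'X ^+ 2 * (P - P^`()).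

Lemma flat_le0 P t : t <= 0 -> flat P t = 0.
Proof. by rewrite /flat leNgt => /negbTE ->. Qed.

(** In terms of y = 1/t the claim is a bound of y^k by a multiple of exp(y), which follows from a
    single term of the exponential series. *)
Lemma expR_invr_bound (k : nat) : exists M :
  R, forall t, 0 < t -> expR (- t^-1) <= M * t ^+ k.
Proof.
exists (k.+1`!%:R + 1) => t t0.
have y0 : 0 < t^-1 by rewrite invr_gt0.
have f0 : 0 < k.+1`!%:R :> R by rewrite ltr0n fact_gt0.
rewrite expRN -ler_pV2 ?inE ?unitfE ?gt_eqF ?mulr_gt0 ?invr_gt0 ?expR_gt0 ?exprn_gt0
  ?ltr_wpDl//.
rewrite invrK invfM -exprVn.
move: (t^-1) y0 => y y0; case: k f0 => [|k] f0.
  rewrite expr0 mulr1; apply: (@le_trans _ _ 1); last by rewrite -expR0 ler_expR ltW.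
  by rewrite invf_le1 ?addr_gt0// lerDr ltW.
have := expR_ge1Dxn k (ltW y0); apply: le_trans.
have f1 : 0 < k.+1`!%:R :> R by rewrite ltr0n fact_gt0.
apply: (@le_trans _ _ (y ^+ k.+1 / k.+1`!%:R)); last by rewrite lerDr.
rewrite mulrC ler_wpM2l ?exprn_ge0 ?(ltW y0)// lef_pV2 ?posrE ?addr_gt0//.
by apply: ler_wpDr => //; rewrite ler_nat factS leq_pmull.
Qed.

(** Induction on the polynomial: multiplying [P] by its variable costs one power of t, hence the use
    of the induction hypothesis at [k.+1]. *)
Lemma flat_bound P (k : nat) : exists M : R, forall t, `|flat P t| <= M * `|t| ^+ k.
Proof.
suff : exists M : R, 0 <= M /\ forall t, 0 < t -> `|flat P t| <= M * t ^+ k.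
  move=> [M [M0 h]]; exists M => t; have [t0|t0] := ltP 0 t;
    first by rewrite (gtr0_norm t0) h.
  by rewrite flat_le0// normr0 mulr_ge0// exprn_ge0.
elim/poly_ind: P k => [|P c IH] k.
  by exists 0; split => // t t0; rewrite /flat t0 horner0 mul0r normr0 mul0r.
have [M [M0 hM]] := IH k.+1; have [C hC] := expR_invr_bound k.
have C0 : 0 <= C.
  by have := hC 1 ltr01; rewrite expr1n mulr1; apply: le_trans; rewrite expR_ge0.
exists (M + `|c| * C); split; first by rewrite addr_ge0// mulr_ge0.
move=> t t0; have := hM t t0; have := hC t t0; rewrite /flat t0 hornerMXaddC.
have tt : t^-1 * t = 1 by rewrite mulVf// gt_eqF.
have i0 : 0 < t^-1 by rewrite invr_gt0.
move: (t^-1) tt i0 (expR_ge0 (- t^-1)) => y ty y0.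
move: (expR _) => x x0 h1 h2.
rewrite mulrDl; apply: le_trans (ler_normD _ _) _; rewrite mulrDl; apply: lerD.
  rewrite mulrAC normrM (gtr0_norm y0).
  apply: le_trans (ler_wpM2r (ltW y0) h2) _.
  by rewrite exprSr -!mulrA [t * y]mulrC ty mulr1.
by rewrite normrM (ger0_norm x0) -mulrA ler_wpM2l.
Qed.

Lemma flat_is_derive P t : is_derive t 1 (flat P) (flat (flat_deriv P) t).
Proof.
have [t0|t0|t0] := ltgtP t 0; last 2 first.
- have tn0 : t != 0 by rewrite gt_eqF.
  pose h s : R := P.[s^-1] * expR (- s^-1).
  have hi : is_derive t 1 (fun s : R => s^-1) (- t ^- 2 *: 1).
    by apply: (@is_deriveV _ id t 1 1) => //; exact: is_derive_id.
  have hp : is_derive t 1 (horner P \o (fun s : R =>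
    s^-1)) (P^`().[t^-1] * (- t ^- 2 *: 1)).
    exact: is_derive1_comp.
  have hn : is_derive t 1 (fun s : R => - s^-1) (- (- t ^- 2 *: 1)) by exact: is_deriveN.
  have he : is_derive t 1 (expR \o (fun s : R =>
    - s^-1)) (expR (- t^-1) * (- (- t ^- 2 *: 1))).
    exact: is_derive1_comp.
  have hh : is_derive t 1 h (flat (flat_deriv P) t).
    have hm := is_deriveM hp he; apply: (is_derive_eq hm).
    rewrite /flat t0 /flat_deriv !hornerE /=.
    rewrite -!exprVn; move: (t^-1) (expR _) (P.[_]) (P^`().[_]) => y e p q.
    rewrite /GRing.scale/=; ring.
  apply: (@near_eq_is_derive _ _ _ h) => //.
  near=> s; rewrite /flat /h; suff -> : 0 < s by [].
  near: s; exact: lt_nbhsr.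
- rewrite t0 flat_le0//.
  have H : (fun h : R =>
    h^-1 *: ((flat P \o shift 0) (h *: 1) - flat P 0)) x @[x --> 0^'] --> (0 : R).
    (* A quadratic bound makes the difference quotient at 0 of order |h|. *)
    have [M hM] := flat_bound P 2.
    apply/cvgrPdist_lt => e e0; near=> h.
    have hn0 : h != 0 by near: h; exact: nbhs_dnbhs_neq.
    rewrite /= sub0r normrN addr0 [h *: 1]mulr1 (flat_le0 _ (lexx 0)) subr0 normrZ normfV.
    have hp : 0 < `|h| by rewrite normr_gt0.
    rewrite ltr_pdivrMl//; apply: le_lt_trans (hM h) _.
    rewrite expr2 mulrCA ltr_pM2l//.
    apply: (@le_lt_trans _ _ ((`|M| + 1) * `|h|)).
      by rewrite ler_wpM2r// (le_trans (ler_norm _))// lerDl.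
    rewrite -ltr_pdivlMl ?ltr_wpDl//.
    near: h; apply: dnbhs0_lt; rewrite mulr_gt0 ?invr_gt0 ?ltr_wpDl//.
  split; first by apply/cvg_ex; exists 0.
  exact: cvg_lim H.
- rewrite flat_le0 ?ltW//; apply: (@near_eq_is_derive _ _ _ (cst 0)) => //.
  near=> s; rewrite /= flat_le0//; apply: ltW.
  near: s; exact: lt_nbhsl.
Unshelve. all: by end_near. Qed.

Lemma flat_continuous P : continuous (flat P).
Proof.
by move=> t; apply: differentiable_continuous; apply/derivable1_diffP;
  have [] := flat_is_derive P t.
Qed.

End flat_functions.

Section elementary_smooth.
Context {R : realType} {n : nat}.
Local Notation E i := (delta_mx ord0 i : 'rV[R]_n).

(* Closed under partial derivatives by construction, so that all its members
   are smooth. *)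
Inductive flat_algebra : ('rV[R]_n -> R) -> Prop :=
| flat_atom P i a b : flat_algebra (fun x => flat P (a * x ord0 i + b))
| flat_cst c : flat_algebra (fun=> c)
| flat_add f g : flat_algebra f -> flat_algebra g -> flat_algebra (fun x => f x + g x)
| flat_mul f g : flat_algebra f -> flat_algebra g -> flat_algebra (fun x => f x * g x).

(** Along the direction [E j] the argument of [flat] is an affine function of the step, so the chain
    rule in one variable suffices. *)
Lemma flat_atom_is_derive P (i j : 'I_n) (a b : R) (x : 'rV[R]_n) :
  is_derive x (E j) (fun x => flat P (a * x ord0 i + b))
    (a * (j == i)%:R * flat (flat_deriv P) (a * x ord0 i + b)).
Proof.
pose c := a * (j == i)%:R; pose y := a * x ord0 i + b.
have hd : is_derive (0 : R) (1 : R) (flat P \o (fun h : R =>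
  c * h + y)) (flat (flat_deriv P) (c * 0 + y) * (c * 1)).
  apply: is_derive1_comp; first exact: flat_is_derive.
  have -> : (fun h : R => c * h + y) = (fun h => c *: id h + cst y h) by [].
  rewrite -[c * 1]addr0; exact: is_deriveD.
have E1 : (fun h : R => h^-1 *: (((fun x : 'rV[R]_n =>
  flat P (a * x ord0 i + b)) \o shift x) (h *: E j) - flat P (a * x ord0 i + b)))
   = (fun h : R => h^-1 *: (((flat P \o (fun h : R =>
     c * h + y)) \o shift 0) (h *: 1) - (flat P \o (fun h : R => c * h + y)) 0)).
  apply/funext => h /=; rewrite mulr0 add0r addr0 !mxE eqxx /= eq_sym;
    congr (_ *: (flat P _ - _)).
  by rewrite /c /y [h *: 1]mulr1; ring.
have [h1 h2] := hd.
split; first by rewrite /derivable E1.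
by rewrite /derive E1; move: h2; rewrite /derive => ->; rewrite mulr0 add0r mulr1 mulrC.
Qed.

Lemma flat_algebra_deriv f : flat_algebra f ->
  [/\ continuous f, forall i x, derivable f x (E i) & forall i, flat_algebra (partial i f)].
Proof.
elim => {f} [P i a b|c|f g _ [cf df ef] _ [cg dg eg]|f g hf [cf df ef] hg [cg dg eg]].
- split.
  + move=> x; apply: (@continuous_comp _ _ _ (fun x : 'rV[R]_n =>
    a * x ord0 i + b) (flat P)); last exact: flat_continuous.
    by apply: (@continuous_lin R _ a (fun x : 'rV[R]_n => x ord0 i) (fun=> b));
      [exact: coord_continuous|exact: cst_continuous].
  + by move=> j x; have [] := flat_atom_is_derive P i j a b x.
  + move=> j; rewrite (_ : partial j _ = fun x => (fun=> a * (j == i)%:R) x * (fun x =>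
    flat (flat_deriv P) (a * x ord0 i + b)) x).
      by apply: flat_mul; [exact: flat_cst|exact: flat_atom].
    by apply/funext => x; have [_] := flat_atom_is_derive P i j a b x.
- split; [exact: cst_continuous|by move=> i x; exact: (derivable_cst c)|].
  move=> i; rewrite (_ : partial i _ = fun=> 0); first exact: flat_cst.
  by apply/funext => x; exact: (derive_cst c).
- split.
  + exact: continuous_add.
  + by move=> i x; exact: (derivableD (df i x) (dg i x)).
  + move=> i; rewrite (_ : partial i _ = fun x => partial i f x + partial i g x);
    first exact: flat_add.
    by apply/funext => x; exact: (deriveD (df i x) (dg i x)).
- split.
  + exact: continuous_mul.
  + by move=> i x; exact: (derivableM (df i x) (dg i x)).
  + move=> i; rewrite (_ : partial i _ = fun x =>
    f x * partial i g x + g x * partial i f x).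
      by apply: flat_add; apply: flat_mul.
    by apply/funext => x; exact: (deriveM (df i x) (dg i x)).
Qed.

Lemma flat_algebra_smooth f : flat_algebra f -> smooth f.
Proof.
move=> hf s; suff : flat_algebra (foldr (@partial R n) f s) by move/flat_algebra_deriv =>
  [].
by elim: s => [//|i s /=] /flat_algebra_deriv[].
Qed.

Lemma flat_algebra_prod I (r : seq I) (F : I -> 'rV[R]_n -> R) :
  (forall i, flat_algebra (F i)) -> flat_algebra (fun x => \prod_(i <- r) F i x).
Proof.
move=> h; elim: r => [|i r IH].
  by rewrite (_ : (fun x => _) = (fun=> 1)) ?funeqE => [|x];
    [exact: flat_cst|rewrite big_nil].
rewrite (_ : (fun x => _) = (fun x => F i x * \prod_(i <- r) F i x));
  last by apply/funext => x; rewrite big_cons.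
exact: flat_mul.
Qed.

End elementary_smooth.

Section box_bump.
Context {R : realType} {n : nat}.
Implicit Types (a b x : 'rV[R]_n).

(* Supported in the closed box, and tends to the indicator function of the open
   box as k tends to infinity. *)
Definition box_bump a b (k : nat) x : R :=
  \prod_(i < n) (flat 1 (k%:R * x ord0 i - k%:R * a ord0 i) * flat 1 (- k%:R * x ord0 i +
    k%:R * b ord0 i)).

Lemma box_bump_smooth a b k : smooth (box_bump a b k).
Proof.
apply: flat_algebra_smooth; apply: flat_algebra_prod => i.
by apply: flat_mul; exact: flat_atom.
Qed.

Lemma flat1E (t : R) : 0 < t -> flat 1 t = expR (- t^-1).
Proof. by move=> t0; rewrite /flat t0 hornerC mul1r. Qed.

Lemma flat1_itv (t : R) : 0 <= flat 1 t <= 1.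
Proof.
have [t0|t0] := ltP 0 t; last by rewrite flat_le0// lexx ler01.
by rewrite flat1E// expR_ge0 expR_le1 oppr_le0 invr_ge0 ltW.
Qed.

Lemma box_bump_itv a b k x : 0 <= box_bump a b k x <= 1.
Proof.
rewrite /box_bump; apply: (big_ind (fun y : R => 0 <= y <= 1)).
- by rewrite ler01 lexx.
- by move=> y z /andP[? ?] /andP[? ?]; rewrite mulr_ge0// mulr_ile1.
by move=> i _; have /andP[? ?] := flat1_itv (k%:R * x ord0 i - k%:R * a ord0 i);
  have /andP[? ?] := flat1_itv (- k%:R * x ord0 i + k%:R * b ord0 i);
    rewrite mulr_ge0// mulr_ile1.
Qed.

Lemma box_bump_outside a b k x : ~ box a b x -> box_bump a b k x = 0.
Proof.
move=> /existsNP[i /negP]; rewrite negb_and -!leNgt => h.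
apply/eqP; rewrite /box_bump (bigD1 i)//= mulf_eq0; apply/orP; left.
rewrite mulf_eq0; case/orP: h => h; apply/orP; [left|right]; rewrite flat_le0//.
  by rewrite -mulrBr mulr_ge0_le0 ?ler0n// subr_le0.
by rewrite mulNr addrC -mulrBr mulr_ge0_le0 ?ler0n// subr_le0.
Qed.

Lemma flat1_cvg (t : R) : 0 < t -> flat 1 (k%:R * t) @[k --> \oo] --> (1 : R).
Proof.
move=> t0.
have E : \forall k \near \oo, expR (- (k%:R^-1 * t^-1)) = flat 1 (k%:R * t).
  by exists 1%N => // k /= k0; rewrite flat1E ?invfM// mulr_gt0// ltr0n.
apply: cvg_trans (near_eq_cvg E) _.
suff : expR (- (k%:R^-1 * t^-1)) @[k --> \oo] --> expR (- (0 * t^-1)) by rewrite mul0r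
  oppr0 expR0.
apply: continuous_cvg; first exact: continuous_expR.
apply: cvgN; apply: cvgM; last exact: cvg_cst.
apply/cvgrPdist_lt => e e0; near=> k.
rewrite sub0r normrN ger0_norm ?invr_ge0//.
have k0 : 0 < k%:R :> R by rewrite ltr0n; near: k; exists 1%N.
rewrite -[ltRHS]invrK ltf_pV2 ?posrE ?invr_gt0//.
near: k; exact: nbhs_infty_gtr.
Unshelve. all: by end_near. Qed.

Lemma cvg_prod1 I (r : seq I) (F : I -> nat -> R) :
  (forall i, F i k @[k --> \oo] --> (1 : R)) ->
  \prod_(i <- r) F i k @[k --> \oo] --> (1 : R).
Proof.
move=> h; elim: r => [|i r IH].
  by under eq_fun do rewrite big_nil; exact: cvg_cst.
have -> : (fun k => \prod_(j <- i :: r) F j k) = (fun k => F i k * \prod_(j <- r) F j k).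
  by apply/funext => k; rewrite big_cons.
by have := cvgM (h i) IH; rewrite mulr1; exact.
Qed.

Lemma box_bump_cvg a b x : box a b x -> box_bump a b k x @[k --> \oo] --> (1 : R).
Proof.
move=> xab; rewrite /box_bump; apply: cvg_prod1 => i.
have /andP[ai bi] := xab i; rewrite -[X in _ --> X]mulr1; apply: cvgM.
  by under eq_fun do rewrite -mulrBr; apply: flat1_cvg; rewrite subr_gt0.
by under eq_fun do rewrite mulNr addrC -mulrBr; apply: flat1_cvg; rewrite subr_gt0.
Qed.

Lemma box_bump_test a b k (D : set 'rV[R]_n) : cbox a b `<=` D ->
  test_function D (box_bump a b k).
Proof.
move=> abD.
have H : closure [set x | box_bump a b k x != 0] `<=` cbox a b.
  apply: (@subset_trans _ (closure (cbox a b))); last by rewrite -(closure_id _).1//;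
    exact: closed_cbox.
  apply: closure_subset => x /= /eqP x0; apply: box_cbox; apply: contrapT => h.
  by apply: x0; exact: box_bump_outside.
split; [exact: box_bump_smooth| |exact: subset_trans H abD].
by apply: (subclosed_compact _ (@compact_cbox _ _ a b) H); exact: closed_closure.
Qed.

End box_bump.

(** * The fundamental lemma of the calculus of variations *)

Lemma ae_forall_countable d (T : measurableType d) (R : realType)
    (mu : {measure set T -> \bar R}) (I : countType) (P : I -> T -> Prop) :
  (forall i, {ae mu, forall x, P i x}) -> {ae mu, forall x, forall i, P i x}.
Proof.
move=> h; have h' (m : nat) : {ae mu, forall x, forall i, unpickle m = Some i -> P i x}.
  case E : (unpickle m) => [i|]; last by apply: aeW.
  by apply: filterS (h i) => x hx _ [<-].
by apply: filterS (ae_foralln h') => x hx i; exact: hx (pickle i) i (pickleK i).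
Qed.

Lemma ae_open_cover {R : realType} n (D : set 'rV[R]_n) (P : 'rV[R]_n -> Prop) :
  open D ->
  (forall a b, cbox a b `<=` D -> {ae lebesgue_rV n, forall x, box a b x -> P x}) ->
  {ae lebesgue_rV n, forall x, D x -> P x}.
Proof.
move=> /open_cbox_cover[I [a [b [abD DE]]]] h.
have h2 k : {ae lebesgue_rV n, forall x, box (a k) (b k) x -> P x} by apply: h; exact: abD.
by have := ae_forall_countable h2; apply: filterS => x hx; rewrite DE => -[k _ xk];
  exact: hx xk.
Qed.

Section fundamental_lemma.
Context {R : realType} {n : nat} (D : set 'rV[R]_n).
Hypothesis oD : open D.
Local Notation mu := (lebesgue_rV (R := R) n).

(** A closed box has finite measure, so |g| <= 1 + g^2 gives integrability on it even when [D] has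
    infinite measure. *)
Lemma sqint_cbox_integrable (g : 'rV[R]_n -> R) a b : cbox a b `<=` D -> sqint mu D g ->
  mu.-integrable (cbox a b) (EFin \o g).
Proof.
move=> abD [mg gi]; have mD := open_rV_measurable oD.
have mc := @measurable_cbox _ _ a b.
have i1 : mu.-integrable (cbox a b) (EFin \o (fun x => 1 + g x ^+ 2)).
  apply: (@integrableD _ _ _ mu _ mc (EFin \o (fun=> 1)) (EFin \o (fun x => g x ^+ 2))).
    apply: measurable_bounded_integrable => //; first exact: lebesgue_cbox_fin.
    by exists 1; split => // M M1 x _; rewrite /= normr1 ltW.
  exact: integrableS gi.
apply: le_integrable i1 => //.
  by apply/measurable_EFinP; exact: measurable_funS mg.
move=> x _ /=; rewrite lee_fin [leRHS]ger0_norm ?addr_ge0 ?sqr_ge0//.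
by rewrite -(real_normK (num_real (g x))); have := sqr_ge0 (`|g x| - 1); nra.
Qed.

(** The bump functions stay between 0 and 1 and tend to 1 on the box, so their vanishing integrals
    against [g] pass to the limit by dominated convergence, with |g| as the dominating function. *)
Lemma fundamental_lemma_box (g : 'rV[R]_n -> R) a b : cbox a b `<=` D -> sqint mu D g ->
  (forall phi, test_function D phi -> (\int[mu]_(x in D) (g x * phi x))%R = 0) ->
  (\int[mu]_(x in box a b) (g x)%:E = 0)%E.
Proof.
move=> abD sg h; have mD := open_rV_measurable oD.
have mb := @measurable_box _ _ a b.
have [mg gi] := sg.
have gab := sqint_cbox_integrable abD sg.
have gb : mu.-integrable (box a b) (EFin \o g) by apply: integrableS gab => //;
  [exact: measurable_cbox|exact: box_cbox].
have bD : box a b `<=` D by apply: subset_trans abD; exact: box_cbox.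
pose G k x := (g x * box_bump a b k x)%:E.
have mbb k : measurable_fun setT (box_bump a b k : 'rV[R]_n -> R).
  by apply: continuous_rV_measurable; apply: smooth_continuous; exact: box_bump_smooth.
have GI k : (\int[mu]_(x in box a b) G k x = 0)%E.
  have := h _ (@box_bump_test _ _ a b k D abD); rewrite /Rintegral.
  have -> : (\int[mu]_(x in D) (g x * box_bump a b k x)%:E = \int[mu]_(x in box a b) G k
    x)%E.
    rewrite -[in RHS](setIidr bD) integral_mkcondr; apply: eq_integral => x xD.
    rewrite patchE; case: ifPn => // /negP xab; rewrite /G box_bump_outside ?mulr0//.
    by move=> xb; apply: xab; rewrite inE.
  have Gi : mu.-integrable (box a b) (G k).
    apply: le_integrable gb => //.
      by apply/measurable_EFinP; apply: measurable_funM;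
        [exact: measurable_funS mg|exact: measurable_funTS].
    move=> x _ /=; rewrite lee_fin normrM; have /andP[b0 b1] := box_bump_itv a b k x.
    by rewrite (ger0_norm b0) ler_piMr.
  by move=> h0; rewrite -(fineK (integrable_fin_num mb Gi)) h0.
have mG k : measurable_fun (box a b) (G k).
  by apply/measurable_EFinP; apply: measurable_funM;
    [exact: measurable_funS mg|exact: measurable_funTS].
have mgE : measurable_fun (box a b) (EFin \o g) by apply/measurable_EFinP;
  exact: measurable_funS mg.
have cG : {ae mu, forall x, box a b x -> G k x @[k --> \oo] --> (EFin \o g) x}.
  apply: aeW => x xab; apply: cvg_EFin; first exact: nearW.
  have := cvgM (cvg_cst (g x)) (box_bump_cvg xab); rewrite mulr1; exact.
have dG : {ae mu, forall x, forall k, box a b x -> (`|G k x| <= (abse \o (EFin \o g)) x)%E}.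
  apply: aeW => x k xab; rewrite /= lee_fin normrM;
    have /andP[b0 b1] := box_bump_itv a b k x.
  by rewrite (ger0_norm b0) ler_piMr.
have [_ _] := dominated_convergence mb mG mgE cG (integrable_abse gb) dG.
rewrite (_ : [sequence _]_k = fun=> 0%E); last by apply/funext => k; exact: GI.
move=> H; have := cvg_unique _ H (cvg_cst 0%E) => //; exact.
Qed.

Lemma fundamental_lemma (g : 'rV[R]_n -> R) : sqint mu D g ->
  (forall phi, test_function D phi -> (\int[mu]_(x in D) (g x * phi x))%R = 0) ->
  g = (fun=> 0) %[ae mu in D].
Proof.
move=> sg h; apply: ae_open_cover => // a b abD.
have mD := open_rV_measurable oD; have [mg gi] := sg.
have mb := @measurable_box _ _ a b; have mc := @measurable_cbox _ _ a b.
have gb : mu.-integrable (box a b) (EFin \o g).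
  by apply: (integrableS mc) (sqint_cbox_integrable abD sg) => //; exact: box_cbox.
(* By Dynkin's theorem, the integral of g vanishes over all measurable parts of
   the box, since it does so over all smaller boxes. *)
pose DD := [set E : set 'rV[R]_n | measurable E /\ (\int[mu]_(x in box a b `&` E) (g
  x)%:E = 0)%E].
have gE E : measurable E -> mu.-integrable (box a b `&` E) (EFin \o g).
  by move=> mE; apply: integrableS gb => //; exact: measurableI.
have IB : (\int[mu]_(x in box a b) (g x)%:E = 0)%E by exact: fundamental_lemma_box.
have dynDD : dynkin DD.
  split.
  - by split => //; rewrite setIT.
  - move=> E [mE E0]; split; first exact: measurableC.
    have := IB; rewrite -{1}(setIT (box a b)) -(setUv E) setIUr integral_setU_EFin//.
    + by rewrite E0 add0e.
    + exact: measurableI.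
    + by apply: measurableI => //; exact: measurableC.
    + by rewrite -setIUr setUv setIT; apply: measurable_funS mg => //;
      apply: subset_trans abD; exact: box_cbox.
    + by apply/disj_setPS => x [[_ ?] [_ ?]].
  - move=> F tF DF; split; first by apply: bigcupT_measurable => k; have [] := DF k.
    rewrite setI_bigcupr integral_bigcup//.
    + by apply: eseries0 => k _ _; have [] := DF k.
    + apply/trivIsetP => i j _ _ ij; move/trivIsetP : tF => /(_ i j I I ij) Fij.
      by rewrite setIACA Fij setI0.
    + by move=> k; apply: measurableI => //; have [] := DF k.
    + by rewrite -setI_bigcupr; apply: gE; apply: bigcupT_measurable => k; have [] := DF k.
have boxDD : boxes `<=` DD.
  move=> _ [a' [b' ->]]; split; first exact: measurable_box.
  rewrite box_setI; apply: fundamental_lemma_box => //; apply: subset_trans abD.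
  by move=> x xab i; have := xab i;
    rewrite !mxE ge_max le_min => /andP[/andP[-> _] /andP[-> _]].
have measDD E : measurable E -> DD E.
  rewrite measurable_boxesE => mE.
  apply: (lambda_system_subset boxes_setI _ boxDD _ mE) => //.
  exact/dynkin_lambda_system.
have H : ae_eq mu (box a b) (EFin \o g) (EFin \o (fun=> 0)).
  apply: integral_ae_eq => //; first exact: measurable_cst.
  move=> E Eab mE; have [_] := measDD _ mE.
  by rewrite setIidr// => ->; rewrite integral0.
by apply: filterS H => x + xab => /(_ xab) [].
Qed.

End fundamental_lemma.

(** * Spaces of U-valued functions *)

Section mdot_theory.
Context {R : realType} {m n : nat}.
Implicit Types (M N P : 'M[R]_(m, n)).

Lemma mdotC M N : mdot M N = mdot N M.
Proof. by apply: eq_bigr => i _; apply: eq_bigr => j _; rewrite mulrC. Qed.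

Lemma mdot_linl k M N P : mdot (k *: M + N) P = k * mdot M P + mdot N P.
Proof.
rewrite /mdot mulr_sumr -big_split/=; apply: eq_bigr => i _.
rewrite mulr_sumr -big_split/=; apply: eq_bigr => j _.
by rewrite !mxE mulrDl mulrA.
Qed.

Lemma mdot0l M : mdot 0 M = 0.
Proof. by rewrite /mdot big1// => i _; rewrite big1// => j _; rewrite mxE mul0r. Qed.

Lemma mdotZl k M N : mdot (k *: M) N = k * mdot M N.
Proof. by rewrite -[k *: M]addr0 mdot_linl mdot0l addr0. Qed.

Lemma mdotZr k M N : mdot M (k *: N) = k * mdot M N.
Proof. by rewrite mdotC mdotZl mdotC. Qed.

Lemma mdotDl M N P : mdot (M + N) P = mdot M P + mdot N P.
Proof. by rewrite -[M]scale1r mdot_linl mul1r scale1r. Qed.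

Lemma mdot_suml I (r : seq I) (F : I -> 'M[R]_(m, n)) N :
  mdot (\sum_(i <- r) F i) N = \sum_(i <- r) mdot (F i) N.
Proof.
elim: r => [|i r IH]; first by rewrite !big_nil mdot0l.
by rewrite !big_cons mdotDl IH.
Qed.

Lemma mdot_ge0 M : 0 <= mdot M M.
Proof. by apply: sumr_ge0 => i _; apply: sumr_ge0 => j _; rewrite -expr2 sqr_ge0. Qed.

Lemma mdot_delta M i j : mdot M (delta_mx i j) = M i j.
Proof.
rewrite /mdot (bigD1 i)//= (bigD1 j)//= !mxE !eqxx mulr1 !big1 ?addr0//.
  by move=> k ki; rewrite big1// => l _; rewrite !mxE (negbTE ki) mulr0.
by move=> l lj; rewrite !mxE (negbTE lj) andbF mulr0.
Qed.

Lemma mdot_CS M N : mdot M N ^+ 2 <= mdot M M * mdot N N.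
Proof.
apply: (@psd_CS R 'M[R]_(m, n) setT (@mdot R m n)) => //.
- by move=> *; exact: mdotC.
- by move=> *; exact: mdot_linl.
- by move=> *; exact: mdot_ge0.
Qed.

Lemma enorm_ge0 M : 0 <= enorm M. Proof. exact: sqrtr_ge0. Qed.

Lemma enorm_sq M : enorm M ^+ 2 = mdot M M.
Proof. by rewrite /enorm sqr_sqrtr// mdot_ge0. Qed.

Lemma mdot_le_enorm M N : mdot M N <= enorm M * enorm N.
Proof.
rewrite /enorm -sqrtrM ?mdot_ge0//; apply: le_trans (ler_norm _) _.
by rewrite -sqrtr_sqr ler_wsqrtr// mdot_CS.
Qed.

Lemma coord_le_enorm M i j : `|M i j| <= enorm M.
Proof.
rewrite -sqrtr_sqr ler_wsqrtr// /mdot (bigD1 i)//= (bigD1 j)//= -expr2.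
rewrite -addrA lerDl addr_ge0//; first by apply: sumr_ge0 => l _; rewrite -expr2 sqr_ge0.
by apply: sumr_ge0 => k _; apply: sumr_ge0 => l _; rewrite -expr2 sqr_ge0.
Qed.

End mdot_theory.

Section range_projection.
Context {R : realType} {d : nat}.

(* Projecting onto U restores the symmetry constraint, which L2U imposes at
   every point, after taking limits of the entries. *)
Definition rproj (U : range_space) : range_mx R d U -> range_mx R d U :=
  match U return range_mx R d U -> range_mx R d U with
  | SymMatrices => fun M => 2^-1 *: (M + M^T)
  | _ => id
  end.

Lemma rproj_in_range U (M : range_mx R d U) : in_range (rproj M).
Proof.
case: U M => //= M; rewrite linearZ/= linearD/= trmxK; congr (_ *: _).
by rewrite addrC.
Qed.

Lemma rproj_id U (M : range_mx R d U) : in_range M -> rproj M = M.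
Proof.
case: U M => //= M ->; by apply/matrixP => i j; rewrite !mxE; field.
Qed.

Lemma rproj_lin U k (M N : range_mx R d U) : rproj (k *: M + N) = k *: rproj M + rproj N.
Proof.
case: U M N => //= M N; rewrite linearP/= scalerA mulrC -scalerA -scalerDr; congr (_ *: _).
by rewrite scalerDr addrACA.
Qed.

Lemma rproj_sum U I (r : seq I) (c : I -> R) (F : I -> range_mx R d U) :
  rproj (\sum_(i <- r) c i *: F i) = \sum_(i <- r) c i *: rproj (F i).
Proof.
elim: r => [|i r IH]; last by rewrite !big_cons rproj_lin IH.
by rewrite !big_nil; case: U F => //= F; rewrite linear0 addr0 scaler0.
Qed.

Lemma mdot_rproj U (M N : range_mx R d U) : mdot (rproj M) N = mdot M (rproj N).
Proof.
case: U M N => //= M N; rewrite mdotZl mdotZr !mdotDl; congr (_ * _).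
rewrite [RHS]mdotC mdotDl ![mdot _ M]mdotC; congr (_ + _).
rewrite /mdot exchange_big/=; apply: eq_bigr => i _; apply: eq_bigr => j _.
by rewrite !mxE.
Qed.

(** The projection is self-adjoint and idempotent, hence orthogonal and a contraction. *)
Lemma mdot_rproj_le U (M : range_mx R d U) : mdot (rproj M) (rproj M) <= mdot M M.
Proof.
have E : mdot (rproj M) (rproj M) = mdot M (rproj M).
  by rewrite mdot_rproj (rproj_id (rproj_in_range _)).
have := mdot_CS M (rproj M); rewrite -E expr2.
have := mdot_ge0 (rproj M); rewrite le_eqVlt => /predU1P[<- _|p0]; first exact: mdot_ge0.
by rewrite ler_pM2r.
Qed.

Lemma in_range_lin U k (M N : range_mx R d U) :
  in_range M -> in_range N -> in_range (k *: M + N).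
Proof. by move=> /rproj_id hM /rproj_id hN; rewrite -hM -hN -rproj_lin;
  exact: rproj_in_range. Qed.

Lemma in_range0 U : in_range (0 : range_mx R d U).
Proof. by case: U => //=; rewrite linear0. Qed.

Lemma in_range_sum U I (r : seq I) (c : I -> R) (F : I -> range_mx R d U) :
  (forall i, in_range (F i)) -> in_range (\sum_(i <- r) c i *: F i).
Proof.
move=> h; elim: r => [|i r IH]; first by rewrite big_nil; exact: in_range0.
by rewrite big_cons; exact: in_range_lin.
Qed.

(** A matrix unit need not lie in U, but its projection does, so single entries can be tested with
    U-valued test functions. *)
Lemma in_range_coord U (M : range_mx R d U) i j : in_range M ->
  M i j = mdot M (rproj (delta_mx i j)).
Proof. by move=> hM; rewrite -mdot_rproj (rproj_id hM) mdot_delta. Qed.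

(** The measurability assumption on the tensor concerns fixed elements of U; this expansion extends
    it to variable arguments in [tensor_L2U]. *)
Lemma in_range_expand U (M : range_mx R d U) : in_range M ->
  M = \sum_(p : 'I_(range_rows d U) * 'I_(range_cols d U)) M p.1 p.2 *: rproj (delta_mx
    p.1 p.2).
Proof.
move=> hM; rewrite -rproj_sum -{1}(rproj_id hM); congr rproj.
rewrite {1}[M]matrix_sum_delta pair_big/=.
by [].
Qed.

End range_projection.

Section L2_theory.
Context {R : realType} {d : nat} (D : set 'rV[R]_d).
Hypothesis oD : open D.
Notation mu := (lebesgue_rV (R := R) d).
Implicit Types (u v f : 'rV[R]_d -> R).

Lemma L2_sqint v : L2 D v <-> sqint mu D v.
Proof. exact: (Lfun2_sqint _ (open_rV_measurable oD)). Qed.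

Lemma L2_lin k u v : L2 D u -> L2 D v -> L2 D (fun x => k * u x + v x).
Proof. by move=> /L2_sqint hu /L2_sqint hv; apply/L2_sqint;
  exact: (sqint_lin (open_rV_measurable oD)). Qed.

Lemma ip_L2C u v : ip_L2 D u v = ip_L2 D v u.
Proof. exact: ipDC. Qed.

Lemma ip_L2_linl k u v f : L2 D u -> L2 D v -> L2 D f ->
  ip_L2 D (fun x => k * u x + v x) f = k * ip_L2 D u f + ip_L2 D v f.
Proof. by move=> /L2_sqint hu /L2_sqint hv /L2_sqint hf;
  exact: (ipD_linl (open_rV_measurable oD)). Qed.

Lemma ip_L2_linr k u v f : L2 D u -> L2 D v -> L2 D f ->
  ip_L2 D f (fun x => k * u x + v x) = k * ip_L2 D f u + ip_L2 D f v.
Proof. by move=> *; rewrite ip_L2C ip_L2_linl// !(ip_L2C f). Qed.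

Lemma ip_L2_ge0 u : 0 <= ip_L2 D u u.
Proof. exact: ipD_ge0. Qed.

Lemma ip_L2_CS u v : L2 D u -> L2 D v -> ip_L2 D u v ^+ 2 <= ip_L2 D u u * ip_L2 D v v.
Proof.
apply: (@psd_CS R ('rV[R]_d -> R) (L2 D) (ip_L2 D)).
- by move=> k {}u {}v; exact: L2_lin.
- by move=> *; exact: ip_L2C.
- by move=> k {}u {}v f; exact: ip_L2_linl.
- by move=> *; exact: ip_L2_ge0.
Qed.

Lemma norm_L2_sq u : norm_L2 D u ^+ 2 = ip_L2 D u u.
Proof. by rewrite sqr_sqrtr// ip_L2_ge0. Qed.

Lemma ip_L2_ae u u' v : L2 D u -> L2 D u' -> L2 D v -> u = u' %[ae mu in D] ->
  ip_L2 D u v = ip_L2 D u' v.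
Proof.
move=> /L2_sqint[mu' _] /L2_sqint[mu'' _] /L2_sqint[mv _].
exact: (ipD_ae (open_rV_measurable oD)).
Qed.

Lemma norm_L2_eq0 u : L2 D u -> ip_L2 D u u = 0 -> u = (fun=> 0) %[ae mu in D].
Proof. by move=> /L2_sqint hu; exact: (ipD_eq0 (open_rV_measurable oD)). Qed.

Lemma L2_sub u v : L2 D u -> L2 D v -> L2 D (fun x => u x - v x).
Proof.
move=> hu hv; rewrite (_ : (fun x => _) = (fun x => -1 * v x + u x)); first exact: L2_lin.
by apply/funext => x; rewrite mulN1r addrC.
Qed.

Lemma ip_L2_subl u v f : L2 D u -> L2 D v -> L2 D f ->
  ip_L2 D (fun x => u x - v x) f = ip_L2 D u f - ip_L2 D v f.
Proof.
move=> hu hv hf; rewrite (_ : (fun x => _) = (fun x => -1 * v x + u x)).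
  by rewrite ip_L2_linl// mulN1r addrC.
by apply/funext => x; rewrite mulN1r addrC.
Qed.

End L2_theory.

Section L2U_theory.
Context {R : realType} {d : nat} (D : set 'rV[R]_d) (U : range_space).
Hypothesis oD : open D.
Notation mu := (lebesgue_rV (R := R) d).
Implicit Types (w z : 'rV[R]_d -> range_mx R d U).

Lemma L2U_sqint w i j : L2U U D w -> sqint mu D (fun x => w x i j).
Proof. by move=> [h _]; apply/(L2_sqint oD). Qed.

Lemma L2U_lin k w z : L2U U D w -> L2U U D z -> L2U U D (fun x => k *: w x + z x).
Proof.
move=> hw hz; split => [i j|x Dx].
  have := L2_lin oD k (hw.1 i j) (hz.1 i j).
  by congr (L2 _ _); apply/funext => x; rewrite !mxE.
by apply: in_range_lin; [exact: hw.2|exact: hz.2].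
Qed.

Lemma mdot_integrable w z : (forall i j, L2 D (fun x => w x i j)) ->
  (forall i j, L2 D (fun x => z x i j)) ->
  mu.-integrable D (EFin \o (fun x => mdot (w x) (z x))).
Proof.
move=> hw hz; have mD := open_rV_measurable oD.
rewrite (_ : EFin \o _ = fun x => (\sum_i \sum_j ((EFin \o (fun x =>
  (w x i j * z x i j)%R)) x))%E).
  apply: integrable_sum => // i _; apply: integrable_sum => // j _.
  by apply: sqint_mul_integrable => //; exact/(L2_sqint oD).
by apply/funext => x /=; rewrite /mdot -sumEFin; apply: eq_bigr => i _; rewrite -sumEFin.
Qed.

Lemma ip_L2UC w z : ip_L2U D w z = ip_L2U D z w.
Proof. by apply: eq_Rintegral => x _; rewrite mdotC. Qed.

Lemma ip_L2U_linl k w w' z : L2U U D w -> L2U U D w' -> L2U U D z ->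
  ip_L2U D (fun x => k *: w x + w' x) z = k * ip_L2U D w z + ip_L2U D w' z.
Proof.
move=> hw hw' hz; have mD := open_rV_measurable oD.
have iw := mdot_integrable hw.1 hz.1; have iw' := mdot_integrable hw'.1 hz.1.
rewrite /ip_L2U; under eq_Rintegral do rewrite mdot_linl.
rewrite RintegralD// ?RintegralZl//.
by rewrite (_ : _ \o _ = (fun x => k%:E * (EFin \o (fun x => mdot (w x) (z x))) x)%E)//;
  exact: integrableZl.
Qed.

Lemma ip_L2U_ge0 w : 0 <= ip_L2U D w w.
Proof. by apply: Rintegral_ge0 => x _; exact: mdot_ge0. Qed.

Lemma ip_L2U_CS w z : L2U U D w -> L2U U D z ->
  ip_L2U D w z ^+ 2 <= ip_L2U D w w * ip_L2U D z z.
Proof.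
apply: (@psd_CS R ('rV[R]_d -> range_mx R d U) (L2U U D) (ip_L2U D)).
- by move=> k {}w {}z; exact: L2U_lin.
- by move=> *; exact: ip_L2UC.
- by move=> k {}w {}z w'; exact: ip_L2U_linl.
- by move=> *; exact: ip_L2U_ge0.
Qed.

Lemma norm_L2U_sq w : norm_L2U D w ^+ 2 = ip_L2U D w w.
Proof. by rewrite sqr_sqrtr// ip_L2U_ge0. Qed.

Lemma mdot_measurable w z : L2U U D w -> L2U U D z -> measurable_fun D (fun x =>
  mdot (w x) (z x)).
Proof.
by move=> hw hz; apply/measurable_EFinP; exact: measurable_int (mdot_integrable hw.1 hz.1).
Qed.

Lemma ip_L2U_ae w w' z : L2U U D w -> L2U U D w' -> L2U U D z ->
  w = w' %[ae mu in D] -> ip_L2U D w z = ip_L2U D w' z.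
Proof.
move=> hw hw' hz ww'; have mD := open_rV_measurable oD; congr fine.
apply: ae_eq_integral => //.
- by apply/measurable_EFinP; exact: mdot_measurable.
- by apply/measurable_EFinP; exact: mdot_measurable.
by apply: filterS ww' => x + Dx => /(_ Dx) ->.
Qed.

Lemma ip_L2U_sum w z : (forall i j, L2 D (fun x => w x i j)) ->
  (forall i j, L2 D (fun x => z x i j)) ->
  ip_L2U D w z = \sum_i \sum_j ip_L2 D (fun x => w x i j) (fun x => z x i j).
Proof.
move=> hw hz; have mD := open_rV_measurable oD.
have h i j : mu.-integrable D (EFin \o (fun x => w x i j * z x i j)).
  by apply: sqint_mul_integrable => //; exact/(L2_sqint oD).
rewrite /ip_L2U /mdot (Rintegral_sum mD) => [|i]; last exact: integrable_Rsum.
by apply: eq_bigr => i _; rewrite (Rintegral_sum mD).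
Qed.

Lemma norm_L2U_eq0 w : L2U U D w -> ip_L2U D w w = 0 -> w = (fun=> 0) %[ae mu in D].
Proof.
move=> hw; rewrite (ip_L2U_sum hw.1 hw.1) => /eqP.
rewrite psumr_eq0; last by move=> i _; apply: sumr_ge0 => j _; exact: ip_L2_ge0.
move=> /allP h.
have H p : {ae mu, forall x, D x -> w x p.1 p.2 = 0}.
  have := h p.1 (mem_index_enum _) => /=.
  rewrite psumr_eq0; last by move=> j _; exact: ip_L2_ge0.
  move=> /allP /(_ p.2 (mem_index_enum _)) /= /eqP.
  by apply: norm_L2_eq0 => //; exact: hw.1.
have := ae_forall_countable H; apply: filterS => x hx Dx.
by apply/matrixP => i j; rewrite mxE; exact: (hx (i, j)).
Qed.

Lemma L2U_rproj (w : 'rV[R]_d -> range_mx R d U) : (forall i j, L2 D (fun x => w x i j)) ->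
  L2U U D (fun x => rproj (w x)).
Proof.
move=> h; split => [i j|x _]; last exact: rproj_in_range.
case: U w h i j => //= w h i j.
rewrite (_ : (fun x => _) = (fun x => 2^-1 * w x i j + (2^-1 * w x j i + 0))).
  by do 2 apply: (L2_lin oD) => //; apply/(L2_sqint oD); exact: sqint0.
by apply/funext => x; rewrite !mxE mulrDr addr0.
Qed.

(** Each entry has a limit in L2 of its own. Projecting the matrix of these limits onto U does not
    increase the distance to [w n], whose values on [D] are fixed by the projection. *)
Lemma L2U_complete (w : nat -> 'rV[R]_d -> range_mx R d U) : (forall n, L2U U D (w n)) ->
  (forall e : R, 0 < e -> exists N, forall n m, (N <= n)%N -> (N <= m)%N ->
     ip_L2U D (fun x => w n x - w m x) (fun x => w n x - w m x) < e) ->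
  exists2 g, L2U U D g & forall e : R, 0 < e -> exists N, forall n, (N <= n)%N ->
     ip_L2U D (fun x => w n x - g x) (fun x => w n x - g x) < e.
Proof.
move=> hw cw; have mD := open_rV_measurable oD.
have comp_le n z i j : L2U U D z -> L2U U D (w n) ->
    ip_L2 D (fun x => w n x i j - z x i j) (fun x => w n x i j - z x i j) <=
    ip_L2U D (fun x => w n x - z x) (fun x => w n x - z x).
  move=> hz hwn; have hd : L2U U D (fun x => w n x - z x).
    have := L2U_lin (-1) hz hwn; congr (L2U _ _); apply/funext => x.
    by rewrite scaleN1r addrC.
  have E : (fun x => w n x i j - z x i j) = (fun x =>
    (w n x - z x) i j) by apply/funext => x; rewrite !mxE.
  rewrite E (ip_L2U_sum hd.1 hd.1) (bigD1 i)//= (bigD1 j)//= -addrA lerDl addr_ge0//.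
    by apply: sumr_ge0 => l _; exact: ip_L2_ge0.
  by apply: sumr_ge0 => k _; apply: sumr_ge0 => l _; exact: ip_L2_ge0.
have hc (p : 'I_(range_rows d U) * 'I_(range_cols d U)) : exists g, sqint mu D g /\
    forall e : R, 0 < e -> exists N, forall n, (N <= n)%N ->
     ip_L2 D (fun x => w n x p.1 p.2 - g x) (fun x => w n x p.1 p.2 - g x) < e.
  have [||g sg hg] := @sqint_complete _ _ R mu D mD (fun n x => w n x p.1 p.2).
  - by move=> n; exact: L2U_sqint.
  - move=> e /cw[N hN]; exists N => n m Nn Nm.
    by apply: le_lt_trans (hN n m Nn Nm); exact: comp_le.
  by exists g.
pose g p := projT1 (cid (hc p)).
have gs p : sqint mu D (g p) by rewrite /g; case: cid => x [].
have gc p (e : R) : 0 < e -> exists N, forall n, (N <= n)%N ->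
     ip_L2 D (fun x => w n x p.1 p.2 - g p x) (fun x => w n x p.1 p.2 - g p x) < e.
  by rewrite /g; case: (cid (hc p)) => x [? h] /=; exact: h.
pose G x : range_mx R d U := \matrix_(i, j) g (i, j) x.
have hG : L2U U D (fun x => rproj (G x)).
  apply: L2U_rproj => i j; apply/(L2_sqint oD); rewrite (_ : (fun x => _) = g (i, j))//.
  by apply/funext => x; rewrite mxE.
exists (fun x => rproj (G x)) => // e e0.
(* One more than the number of entries, so that the entrywise errors e/K add up to strictly less
   than e. *)
pose K : R := (#|{: 'I_(range_rows d U) * 'I_(range_cols d U)}|.+1)%:R.
have K0 : 0 < K by rewrite ltr0n.
have eK0 : 0 < e / K by rewrite divr_gt0.
pose N p := projT1 (cid (gc p _ eK0)).
have hN p n : (N p <= n)%N -> ip_L2 D (fun x => w n x p.1 p.2 - g p x) (fun x =>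
  w n x p.1 p.2 - g p x) < e / K.
  by rewrite /N; case: cid => x h; exact: h.
exists (\max_p N p)%N => n Nn.
have hd : L2U U D (fun x => w n x - rproj (G x)).
  have := L2U_lin (-1) hG (hw n); congr (L2U _ _); apply/funext => x.
  by rewrite scaleN1r addrC.
have hZ i j : L2 D (fun x => (w n x - G x) i j).
  apply/(L2_sqint oD); have := sqintB mD (L2U_sqint i j (hw n)) (gs (i, j)).
  by congr (sqint _ _ _); apply/funext => x; rewrite !mxE.
have pw x : D x -> mdot (w n x - rproj (G x)) (w n x - rproj (G x)) <= mdot (w n x - G x)
  (w n x - G x).
  move=> Dx; have := rproj_id ((hw n).2 x Dx) => wE.
  rewrite (_ : w n x - rproj (G x) = rproj (w n x - G x)); first exact: mdot_rproj_le.
  by have := rproj_lin (-1) (G x) (w n x); rewrite !scaleN1r addrC => ->; rewrite wE addrC.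
apply: (@le_lt_trans _ _ (ip_L2U D (fun x => w n x - G x) (fun x => w n x - G x))).
  apply: le_Rintegral => //; [exact: (mdot_integrable hd.1 hd.1)|exact: mdot_integrable].
rewrite (ip_L2U_sum hZ hZ) pair_big/=.
apply: (@le_lt_trans _ _ (\sum_(p : 'I_(range_rows d U) * 'I_(range_cols d U)) e / K)).
  apply: ler_sum => -[i j] _ /=.
  rewrite (_ : (fun x => _) = (fun x => w n x i j - g (i, j) x));
    last by apply/funext => x; rewrite !mxE.
  have Nij : (N (i, j) <= n)%N by apply: leq_trans Nn; exact: (leq_bigmax (i, j)).
  exact: ltW (hN (i, j) n Nij).
rewrite sumr_const -[_ *+ _]mulr_natr mulrAC ltr_pdivrMr// ltr_pM2l// ltr_nat.
by rewrite ltnS.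
Qed.

Lemma L2U_sub w z : L2U U D w -> L2U U D z -> L2U U D (fun x => w x - z x).
Proof.
move=> hw hz; rewrite (_ : (fun x => _) = (fun x => -1 *: z x + w x)); first exact: L2U_lin.
by apply/funext => x; rewrite scaleN1r addrC.
Qed.

Lemma ip_L2U_subl w z y : L2U U D w -> L2U U D z -> L2U U D y ->
  ip_L2U D (fun x => w x - z x) y = ip_L2U D w y - ip_L2U D z y.
Proof.
move=> hw hz hy; rewrite (_ : (fun x => _) = (fun x => -1 *: z x + w x)).
  by rewrite ip_L2U_linl// mulN1r addrC.
by apply/funext => x; rewrite scaleN1r addrC.
Qed.

End L2U_theory.

(** * Differential operators in the sense of distributions *)

Section test_functions_theory.
Context {R : realType} {d : nat}.
Notation mu := (lebesgue_rV (R := R) d).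
Implicit Types (D : set 'rV[R]_d) (phi : 'rV[R]_d -> R).
Local Notation dv s f := (foldr (@partial R d) f s).

Lemma test_smooth D phi : test_function D phi -> smooth phi.
Proof. by case. Qed.

Lemma test_support0 D phi x : test_function D phi -> ~ D x -> phi x = 0.
Proof.
move=> [_ _ sD] Dx; apply/eqP; apply: contrapT => /negP h; apply: Dx; apply: sD.
exact: subset_closure.
Qed.

Lemma test_cbox D phi : test_function D phi ->
  exists a b, forall x, ~ cbox a b x -> phi x = 0.
Proof.
move=> [_ /compact_bounded[M [Mr hM]] _].
pose c : R := `|M| + 1.
exists (\row_i (- c)), (\row_i c) => x xc; apply/eqP; apply: contrapT => /negP h;
  apply: xc => i.
rewrite !mxE -ler_norml; apply: (@le_trans _ _ `|x|).
  by rewrite [leRHS]/Num.norm/= mx_normrE; apply/bigmax_geP; right; exists (ord0, i).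
apply: hM; last exact: subset_closure.
by rewrite /c ltr_pwDr// ler_norm.
Qed.

Lemma test_dv D phi s : test_function D phi -> test_function D (dv s phi).
Proof.
move=> [sp cp pD].
have H : closure [set x | dv s phi x != 0] `<=` closure [set x | phi x != 0].
  apply: (@subset_trans _ (closure (closure [set x | phi x != 0]))); last first.
    by rewrite -(closure_id _).1//; exact: closed_closure.
  apply: closure_subset => x /= /eqP x0; apply: contrapT => h; apply: x0.
  apply: (dv_zero_outside s _ _ h); first exact: closed_closure.
  by move=> y hy; apply/eqP; apply: contrapT => /negP y0; apply: hy; exact: subset_closure.
split; [exact: smooth_dv| |exact: subset_trans H pD].
by apply: (subclosed_compact _ cp H); exact: closed_closure.
Qed.

Lemma testZ D phi k : test_function D phi -> test_function D (fun x => k * phi x).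
Proof.
move=> [sp cp pD].
have H : closure [set x | k * phi x != 0] `<=` closure [set x | phi x != 0].
  by apply: closure_subset => x /=; rewrite mulf_eq0 negb_or => /andP[].
split; [exact: smoothZ| |exact: subset_trans H pD].
by apply: (subclosed_compact _ cp H); exact: closed_closure.
Qed.

Lemma test_subset D D' phi : D `<=` D' -> test_function D phi -> test_function D' phi.
Proof. by move=> DD' [? ? h]; split => //; exact: subset_trans h DD'. Qed.

Lemma test_L2 D D' phi : open D' -> test_function D phi -> L2 D' phi.
Proof.
move=> oD' tp; apply/(L2_sqint oD'); have [a [b p0]] := test_cbox tp.
have sp := test_smooth tp.
split; first by apply: measurable_funTS; apply: continuous_rV_measurable;
  exact: smooth_continuous.
have := smooth_mul_integrable sp sp p0.
move=> /(integrableS measurableT (open_rV_measurable oD') (@subsetT _ _)).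
by congr (_.-integrable _ _); apply/funext => x /=; rewrite expr2.
Qed.

Lemma Rintegral_subdomain (D D' : set 'rV[R]_d) (f : 'rV[R]_d -> R) : D `<=` D' ->
  (forall x, ~ D x -> f x = 0) ->
  (\int[mu]_(x in D) f x = \int[mu]_(x in D') f x)%R.
Proof.
move=> DD' f0; rewrite -{1}(setIidr DD') Rintegral_mkcondr; apply: eq_Rintegral => x _.
by rewrite patchE; case: ifPn => // /negP h; rewrite f0// => Dx; apply: h; rewrite inE.
Qed.

(** All integrands vanish outside [D], so the integration by parts takes place on the whole space
    and produces no boundary term. *)
Lemma ibp_L2 D s f g : test_function D f -> smooth g ->
  ip_L2 D (dv s f) g = (-1) ^+ size s * ip_L2 D f (dv s g).
Proof.
move=> tf sg; have [a [b f0]] := test_cbox tf; rewrite /ip_L2.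
rewrite !(@Rintegral_subdomain D setT)//.
- exact: (ibp s (test_smooth tf) sg f0).
- by move=> x Dx; rewrite (test_support0 tf Dx) mul0r.
- by move=> x Dx; rewrite (test_support0 (test_dv s tf) Dx) mul0r.
Qed.

End test_functions_theory.

Section operator_theory.
Context {R : realType} {d : nat} {U : range_space} (A : diffop R d U).
Notation mu := (lebesgue_rV (R := R) d).
Implicit Types (D : set 'rV[R]_d) (phi v f : 'rV[R]_d -> R)
  (Phi w g z : 'rV[R]_d -> range_mx R d U).
Local Notation dv s f := (foldr (@partial R d) f s).

Lemma coef_mdot_smooth D Phi B : test_functionU U D Phi ->
  smooth (fun x => mdot B (Phi x)) /\
  forall s, dv s (fun x => mdot B (Phi x)) =
    (fun x => \sum_(p : 'I_(range_rows d U) * 'I_(range_cols d U)) B p.1 p.2 * dv s (fun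
      x => Phi x p.1 p.2) x).
Proof.
move=> [tP _].
have E : (fun x => mdot B (Phi x)) = (fun x =>
  \sum_(p : 'I_(range_rows d U) * 'I_(range_cols d U)) B p.1 p.2 * Phi x p.1 p.2).
  by apply/funext => x; rewrite /mdot pair_big.
have sP p : smooth (fun x => Phi x p.1 p.2) by exact: test_smooth (tP _ _).
rewrite E; split; first exact: smooth_sum.
by move=> s; rewrite dv_sum.
Qed.

Lemma L2_sum D I (r : seq I) (k : I -> R) (F : I -> 'rV[R]_d -> R) : open D ->
  (forall i, L2 D (F i)) -> L2 D (fun x => \sum_(i <- r) k i * F i x).
Proof.
move=> oD h; apply/(L2_sqint oD); apply: (sqint_sum (open_rV_measurable oD)) => i.
by apply: (sqintZ (open_rV_measurable oD)); apply/(L2_sqint oD).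
Qed.

Lemma smooth_op_L2U D D' phi : open D' -> test_function D phi ->
  L2U U D' (smooth_op A phi).
Proof.
move=> oD' tp; split => [i j|x _]; last first.
  by apply: in_range_sum => al; exact: diffop_coef_range.
rewrite (_ : (fun x => _) = (fun x =>
  \sum_al diffop_coef A al i j * dv (multi_seq al) phi x)).
  by apply: L2_sum => // al; exact: test_L2 (test_dv _ tp).
apply/funext => x; rewrite /smooth_op summxE; apply: eq_bigr => al _.
by rewrite mxE multi_partialE mulrC.
Qed.

Lemma smooth_adj_term_L2 D D' Phi B s : open D' -> test_functionU U D Phi ->
  L2 D' (dv s (fun x => mdot B (Phi x))).
Proof.
move=> oD' tP; have [_ ->] := coef_mdot_smooth B tP.
by apply: L2_sum => // p; apply: test_L2 => //; apply: test_dv; exact: tP.1.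
Qed.

Lemma smooth_adjE Phi x : smooth_adj A Phi x =
  \sum_(al : {ffun 'I_d -> 'I_(diffop_order A).+1})
    (-1) ^+ (\sum_i al i)%N * dv (multi_seq al) (fun y =>
      mdot (diffop_coef A al) (Phi y)) x.
Proof. by apply: eq_bigr => al _; rewrite multi_partialE. Qed.

Lemma smooth_adj_L2 D D' Phi : open D' -> test_functionU U D Phi ->
  L2 D' (smooth_adj A Phi).
Proof.
move=> oD' tP; rewrite (funext (smooth_adjE Phi)).
by apply: L2_sum => // al; exact: (smooth_adj_term_L2 _ _ oD' tP).
Qed.

Lemma testU_L2U D D' Phi : open D' -> test_functionU U D Phi -> L2U U D' Phi.
Proof. by move=> oD' [tP rP]; split => [i j|x _ //]; exact: test_L2 (tP i j). Qed.

(** Integration by parts term by term, the sign of each term coming from the length of the word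
    [multi_seq al]. Hence on test functions the distributional operators A and A^* are the classical
    ones. *)
Lemma smooth_op_adj D phi Phi : open D -> test_function D phi -> test_functionU U D Phi ->
  ip_L2U D (smooth_op A phi) Phi = ip_L2 D phi (smooth_adj A Phi).
Proof.
move=> oD tp tP; have mD := open_rV_measurable oD.
pose m al x := mdot (diffop_coef A al) (Phi x).
have Lphi : L2 D phi by exact: test_L2 tp.
transitivity (\sum_al ip_L2 D (dv (multi_seq al) phi) (m al)).
  rewrite /ip_L2 -Rintegral_sum//; last first.
    move=> al; apply: sqint_mul_integrable => //; apply/(L2_sqint oD).
      exact: test_L2 (test_dv _ tp).
    exact: (smooth_adj_term_L2 (diffop_coef A al) [::] oD tP).
  apply: eq_Rintegral => x _; rewrite /smooth_op mdot_suml; apply: eq_bigr => al _.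
  by rewrite mdotZl multi_partialE.
transitivity (\sum_(al : {ffun 'I_d -> 'I_(diffop_order A).+1}) ip_L2 D phi (fun x =>
  (-1) ^+ (\sum_i al i)%N * dv (multi_seq al) (m al) x)).
  apply: eq_bigr => al _; rewrite (ibp_L2 _ tp (coef_mdot_smooth _ tP).1) size_multi_seq.
  rewrite [RHS]ip_L2C [RHS](ipDZl mD).
  - by rewrite [ipD _ _ _ _]ipDC.
  - by apply/(L2_sqint oD); exact: smooth_adj_term_L2 tP.
  - exact/(L2_sqint oD).
rewrite /ip_L2 -Rintegral_sum//; last first.
  move=> al; apply: sqint_mul_integrable => //; first exact/(L2_sqint oD).
  by apply: (sqintZ mD); apply/(L2_sqint oD); exact: smooth_adj_term_L2 tP.
by apply: eq_Rintegral => x _; rewrite smooth_adjE mulr_sumr.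
Qed.

Lemma test_distr_op D phi :
  open D -> test_function D phi -> distr_op A D phi (smooth_op A phi).
Proof. by move=> oD tp Phi tP; exact: smooth_op_adj. Qed.

Lemma test_distr_adj D Phi :
  open D -> test_functionU U D Phi -> distr_adj A D Phi (smooth_adj A Phi).
Proof. by move=> oD tP phi tp; rewrite ip_L2C ip_L2UC smooth_op_adj. Qed.

Lemma smooth_adj_outside D Phi x :
  test_functionU U D Phi -> ~ D x -> smooth_adj A Phi x = 0.
Proof.
move=> tP Dx; rewrite smooth_adjE big1// => al _.
have [_ ->] := coef_mdot_smooth (diffop_coef A al) tP;
  rewrite [X in _ * X]big1 ?mulr0// => p _.
by rewrite (test_support0 (test_dv _ (tP.1 p.1 p.2)) Dx) mulr0.
Qed.

Lemma testU_outside D Phi x : test_functionU U D Phi -> ~ D x -> Phi x = 0.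
Proof.
by move=> tP Dx; apply/matrixP => i j; rewrite mxE (test_support0 (tP.1 i j) Dx).
Qed.

(** A test function on the smaller set [D'] is one on [D], and it annihilates all integrands outside
    [D']. *)
Lemma distr_op_sub D D' v g : D' `<=` D -> distr_op A D v g -> distr_op A D' v g.
Proof.
move=> D'D h Phi tP.
have tP' : test_functionU U D Phi by split => [i j|];
  [exact: test_subset D'D (tP.1 i j)|exact: tP.2].
have := h _ tP'; rewrite /ip_L2U /ip_L2.
rewrite -(@Rintegral_subdomain _ _ D' D)//; last first.
  by move=> x Dx; rewrite (testU_outside tP Dx) mdotC mdot0l.
move=> ->; rewrite -(@Rintegral_subdomain _ _ D' D)//.
by move=> x Dx; rewrite (smooth_adj_outside tP Dx) mulr0.
Qed.

Lemma L2U_test0 D g : open D -> L2U U D g ->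
  (forall Phi, test_functionU U D Phi -> ip_L2U D g Phi = 0) ->
  g = (fun=> 0) %[ae mu in D].
Proof.
move=> oD hg h; have mD := open_rV_measurable oD.
have H (p : 'I_(range_rows d U) * 'I_(range_cols d U)) :
  {ae mu, forall x, D x -> g x p.1 p.2 = 0}.
  pose B : range_mx R d U := rproj (delta_mx p.1 p.2).
  apply: (@fundamental_lemma _ _ D oD (fun x => g x p.1 p.2)); first exact: L2U_sqint.
  move=> phi tp; rewrite -[RHS](h (fun x => phi x *: B)).
    apply: eq_Rintegral => x /set_mem Dx; rewrite mdotZr mulrC; congr (_ * _).
    by apply: in_range_coord; exact: hg.2.
  split => [i j|x].
    rewrite (_ : (fun x => _) = (fun x => B i j * phi x)); first exact: testZ.
    by apply/funext => x; rewrite !mxE mulrC.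
  by rewrite -[_ *: _]addr0; apply: in_range_lin; [exact: rproj_in_range|exact: in_range0].
have := ae_forall_countable H; apply: filterS => x hx Dx.
by apply/matrixP => i j; rewrite mxE; exact: (hx (i, j)).
Qed.

Lemma L2_test0 D f : open D -> L2 D f ->
  (forall phi, test_function D phi -> ip_L2 D f phi = 0) -> f = (fun=> 0) %[ae mu in D].
Proof. by move=> oD /(L2_sqint oD) hf h; exact: fundamental_lemma. Qed.

Lemma distr_op_unique D v g g' : open D -> L2U U D g -> L2U U D g' ->
  distr_op A D v g -> distr_op A D v g' -> g = g' %[ae mu in D].
Proof.
move=> oD hg hg' dg dg'.
suff : (fun x => -1 *: g' x + g x) = (fun=> 0) %[ae mu in D].
  by apply: filterS => x + Dx => /(_ Dx) /eqP; rewrite scaleN1r addrC subr_eq0 => /eqP.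
apply: L2U_test0 => //; first exact: L2U_lin.
move=> Phi tP; rewrite ip_L2U_linl//; last exact: testU_L2U tP.
by rewrite dg// dg'// mulN1r addNr.
Qed.

Lemma distr_adj_unique D w f f' : open D -> L2 D f -> L2 D f' ->
  distr_adj A D w f -> distr_adj A D w f' -> f = f' %[ae mu in D].
Proof.
move=> oD hf hf' df df'.
suff : (fun x => -1 * f' x + f x) = (fun=> 0) %[ae mu in D].
  by apply: filterS => x + Dx => /(_ Dx) /eqP; rewrite mulN1r addrC subr_eq0 => /eqP.
apply: L2_test0 => //; first exact: L2_lin.
move=> phi tp; rewrite ip_L2_linl//; last exact: test_L2 tp.
by rewrite df// df'// mulN1r addNr.
Qed.

Lemma op_L2P D v : has_op A D v -> L2U U D (op_L2 A D v) /\ distr_op A D v (op_L2 A D v).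
Proof.
move=> [g hg dg]; rewrite /op_L2.
by have := @xgetPex _ (fun=> 0) [set g | L2U U D g /\ distr_op A D v g] (ex_intro _ g
  (conj hg dg)).
Qed.

Lemma adj_L2P D w : has_adj A D w -> L2 D (adj_L2 A D w) /\ distr_adj A D w (adj_L2 A D w).
Proof.
move=> [f hf df]; rewrite /adj_L2.
by have := @xgetPex _ (fun=> 0) [set f | L2 D f /\ distr_adj A D w f] (ex_intro _ f (conj
  hf df)).
Qed.

Lemma op_L2_eq D v g :
  open D -> L2U U D g -> distr_op A D v g -> op_L2 A D v = g %[ae mu in D].
Proof.
move=> oD hg dg; have [h1 h2] := op_L2P (ex_intro2 _ _ g hg dg).
exact: distr_op_unique h2 dg.
Qed.

Lemma adj_L2_eq D w f :
  open D -> L2 D f -> distr_adj A D w f -> adj_L2 A D w = f %[ae mu in D].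
Proof.
move=> oD hf df; have [h1 h2] := adj_L2P (ex_intro2 _ _ f hf df).
exact: distr_adj_unique h2 df.
Qed.

Lemma distr_op_lin D k v v' g g' : open D -> L2 D v -> L2 D v' -> L2U U D g -> L2U U D g' ->
  distr_op A D v g -> distr_op A D v' g' ->
  distr_op A D (fun x => k * v x + v' x) (fun x => k *: g x + g' x).
Proof.
move=> oD hv hv' hg hg' dg dg' Phi tP.
rewrite ip_L2U_linl//; last exact: testU_L2U tP.
rewrite ip_L2_linl//; last exact: smooth_adj_L2 tP.
by rewrite dg// dg'.
Qed.

(** [op_L2] chooses a representative for each function separately, so linearity comes from the
    uniqueness of distributional images and holds only almost everywhere. *)
Lemma H_op_lin D k v v' : open D -> H_op A D v -> H_op A D v' ->
  H_op A D (fun x => k * v x + v' x) /\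
  op_L2 A D (fun x => k * v x + v' x) = (fun x =>
    k *: op_L2 A D v x + op_L2 A D v' x) %[ae mu in D].
Proof.
move=> oD [Lv /op_L2P[h1 h2]] [Lv' /op_L2P[h1' h2']].
have d' := distr_op_lin k oD Lv Lv' h1 h1' h2 h2'.
have l' := L2U_lin oD k h1 h1'.
split; last exact: op_L2_eq.
by split; [exact: L2_lin|exists (fun x => k *: op_L2 A D v x + op_L2 A D v' x)].
Qed.

Lemma test_H_op D phi : open D -> test_function D phi -> H_op A D phi.
Proof.
move=> oD tp; split; first exact: test_L2 tp.
by exists (smooth_op A phi); [exact: smooth_op_L2U tp|exact: test_distr_op].
Qed.

Lemma test_H_adj D Phi : open D -> test_functionU U D Phi -> H_adj A D Phi.
Proof.
move=> oD tP; split; first exact: testU_L2U tP.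
by exists (smooth_adj A Phi); [exact: smooth_adj_L2 tP|exact: test_distr_adj].
Qed.

(** For a test function, the vanishing of the boundary pairing with [w] is the identity that defines
    A^* w. *)
Lemma test_H0 D phi : open D -> test_function D phi -> H0_op A D phi.
Proof.
move=> oD tp; split; first exact: test_H_op.
move=> w [Lw hw]; have [h1 h2] := adj_L2P hw.
have Lp := test_L2 oD tp; have Lop := smooth_op_L2U oD tp.
have [ho _] := op_L2P (test_H_op oD tp).2.
rewrite /trace_boundary (ip_L2U_ae oD ho Lop Lw); last first.
  by apply: op_L2_eq => //; exact: test_distr_op.
by rewrite ip_L2UC -h2// ip_L2C subrr.
Qed.

End operator_theory.

(** * Meshes *)

Section mesh.
Context {R : realType} {d : nat} (Omega : set 'rV[R]_d) {N : nat} (T :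
  'I_N -> set 'rV[R]_d).
Notation mu := (lebesgue_rV (R := R) d).

Lemma hyperplane_ae (p : 'rV[R]_d) (c : R) : p != 0 -> {ae mu, forall x, mdot p x != c}.
Proof.
move=> p0; exists [set x | mdot p x = c]; split.
- exact: measurable_hyperplane.
- exact: hyperplane_null.
by move=> x /= /negP; rewrite negbK => /eqP.
Qed.

(* The boundaries of the elements lie in finitely many hyperplanes. *)
Lemma regular_mesh_ae kappa : regular_mesh Omega kappa T ->
  {ae mu, forall x, Omega x -> exists i, T i x}.
Proof.
move=> [Tpoly _ Tcl _].
have H i : {ae mu, forall x, closure (T i) x -> T i x}.
  have [[_ _ _ [s [s0 sT]]] _] := Tpoly i.
  have Hs : {ae mu, forall x, forall k :
    nat, (k < size s)%N -> mdot (nth (0, 0) s k).1 x != (nth (0, 0) s k).2}.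
    apply: ae_foralln => k; have [ks|ks] := ltnP k (size s); last by apply: aeW.
    apply: filterS (hyperplane_ae _ (s0 _ (mem_nth _ ks))) => x hx _; exact: hx.
  apply: filterS Hs => x hx cx; apply: contrapT => Tx.
  have [p ps /eqP] := sT x (conj cx Tx); apply/negP.
  by have := hx (index p s); rewrite index_mem nth_index//; exact.
have := ae_forall_countable H; apply: filterS => x hx Ox.
have : closure Omega x by exact: subset_closure.
by rewrite Tcl => -[i _ cx]; exists i; exact: hx.
Qed.

Hypothesis oO : open Omega.
Hypothesis oT : forall i, open (T i).
Hypothesis T_sub : forall i, T i `<=` Omega.
Hypothesis T_inj : forall i j x, T i x -> T j x -> i = j.
Hypothesis T_ae : {ae mu, forall x, Omega x -> exists i, T i x}.

Lemma mesh_patch_sum (f : 'I_N -> 'rV[R]_d -> R) i x : T i x ->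
  \sum_j (f j \_ (T j)) x = f i x.
Proof.
move=> Tx; rewrite (bigD1 i)//= patchE mem_set// big1 ?addr0// => j ji.
rewrite patchE; case: ifPn => // /set_mem Tjx; exfalso; move/eqP: ji; apply.
exact: T_inj Tjx Tx.
Qed.

Lemma mesh_integral (f : 'rV[R]_d -> R) : mu.-integrable Omega (EFin \o f) ->
  (\int[mu]_(x in Omega) f x = \sum_i \int[mu]_(x in T i) f x)%R.
Proof.
move=> fi; have mO := open_rV_measurable oO.
have mT i := open_rV_measurable (@oT i).
have iT i : mu.-integrable Omega (EFin \o (f \_ (T i))).
  rewrite -restrict_EFin; apply/integrable_restrict => //; rewrite setIidr//.
  by apply: integrableS fi.
transitivity (\int[mu]_(x in Omega) (\sum_i (f \_ (T i)) x))%R.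
  congr fine; apply: ae_eq_integral => //.
  - exact: measurable_int fi.
  - exact: measurable_int (integrable_Rsum mO iT _).
  apply: filterS T_ae => x h /h[i Ti]; congr EFin.
  by rewrite (@mesh_patch_sum (fun=> f) i x).
rewrite (Rintegral_sum mO)//; apply: eq_bigr => i _.
by rewrite -Rintegral_mkcondr setIidr.
Qed.

Lemma sqint_restrict i (f : 'rV[R]_d -> R) : sqint mu Omega f -> sqint mu (T i) f.
Proof.
move=> [mf fi]; split; first by apply: measurable_funS mf => //; exact: open_rV_measurable.
by apply: integrableS fi => //; exact: open_rV_measurable.
Qed.

Lemma sqint_patch i (f : 'rV[R]_d -> R) : sqint mu (T i) f -> sqint mu Omega (f \_ (T i)).
Proof.
move=> [mf fi]; have mO := open_rV_measurable oO; have mT := open_rV_measurable (@oT i).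
split; first by apply/measurable_restrict => //; rewrite setIidr.
rewrite (_ : _ \o _ = (EFin \o (fun x => f x ^+ 2)) \_ (T i)).
  by apply/integrable_restrict => //; rewrite setIidr.
by apply/funext => x /=; rewrite !patchE; case: ifPn => // _; rewrite /= expr0n.
Qed.

Context {U : range_space}.
Implicit Types (w z g : 'rV[R]_d -> range_mx R d U).

Lemma L2U_restrict i w : L2U U Omega w -> L2U U (T i) w.
Proof.
move=> hw; split => [a b|x Tx]; last by apply: hw.2; exact: T_sub Tx.
by apply/(L2_sqint (@oT i)); apply: sqint_restrict; exact: L2U_sqint.
Qed.

Lemma mesh_ip w z : L2U U Omega w -> L2U U Omega z ->
  ip_L2U Omega w z = \sum_i ip_L2U (T i) w z.
Proof. by move=> hw hz; apply: mesh_integral; exact: (mdot_integrable oO hw.1 hz.1). Qed.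

(** The glued function is zero off the elements, so that the symmetry constraint holds at every
    point of [Omega], also on the skeleton. *)
Lemma mesh_glue (h : 'I_N -> 'rV[R]_d -> range_mx R d U) : (forall i, L2U U (T i) (h i)) ->
  exists2 g, L2U U Omega g & forall i x, T i x -> g x = h i x.
Proof.
move=> hh.
pose g x : range_mx R d U := \matrix_(a, b) \sum_i ((fun x => h i x a b) \_ (T i)) x.
have gE i x : T i x -> g x = h i x.
  by move=> Tx; apply/matrixP => a b;
    rewrite mxE (@mesh_patch_sum (fun i x => h i x a b) i x).
have gout x : ~ (exists i, T i x) -> g x = 0.
  move=> Tx; apply/matrixP => a b; rewrite !mxE big1// => i _; rewrite patchE.
  by case: ifPn => // /set_mem Ti; exfalso; apply: Tx; exists i.
exists g => //; split => [a b|x Ox].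
  apply/(L2_sqint oO);
    rewrite (_ : (fun x => _) = (fun x => \sum_i ((fun x => h i x a b) \_ (T i)) x)).
    apply: (sqint_sum (open_rV_measurable oO)) => i; apply: sqint_patch; exact: L2U_sqint.
  by apply/funext => x; rewrite mxE.
have [[i Ti]|/gout ->] := pselect (exists i, T i x); last exact: in_range0.
by rewrite (gE i)//; exact: (hh i).2.
Qed.

End mesh.

(** * The weak formulation and the hybrid problem *)

Lemma ip_limit_arith (R : realFieldType) (x y Z F t e p q r : R) :
  0 <= Z -> 0 <= F -> t * (Z + F + 1) = e / 4 -> 0 < t ->
  (p - q) ^+ 2 <= x * Z -> (p - r) ^+ 2 <= y * F -> x < t -> y < t ->
  (q - r) ^+ 2 <= e.
Proof.
move=> Z0 F0 te t0 h1 h2 xt yt.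
have h3 : x * Z <= t * Z by apply: ler_wpM2r => //; exact: ltW.
have h4 : y * F <= t * F by apply: ler_wpM2r => //; exact: ltW.
have h5 : (q - r) ^+ 2 <= 2 * (p - q) ^+ 2 + 2 * (p - r) ^+ 2.
  rewrite -subr_ge0 (_ : _ - _ = (p - q + (p - r)) ^+ 2) ?sqr_ge0//; ring.
have : 0 <= t * Z by rewrite mulr_ge0// ltW.
have : 0 <= t * F by rewrite mulr_ge0// ltW.
move: te; rewrite !mulrDr mulr1; lra.
Qed.

Section tensor.
Context {R : realType} {d : nat} {U : range_space} (Omega : set 'rV[R]_d).
Notation mu := (lebesgue_rV (R := R) d).
Context (C : 'rV[R]_d -> {linear range_mx R d U -> range_mx R d U}) (K c : R).
Hypothesis oO : open Omega.
Hypothesis C_range : forall x M, Omega x -> in_range M -> in_range (C x M).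
Hypothesis C_meas : forall M i j, in_range M -> measurable_fun Omega (fun x => C x M i j).
Hypothesis C_bnd : {ae mu, forall x, Omega x -> forall M, in_range M ->
  enorm (C x M) <= K * enorm M}.
Hypothesis C_sym : {ae mu, forall x, Omega x -> forall M N, in_range M -> in_range N ->
  mdot (C x M) N = mdot M (C x N)}.
Hypothesis c_gt0 : 0 < c.
Hypothesis C_pos : {ae mu, forall x, Omega x -> forall M, in_range M ->
  c * enorm M ^+ 2 <= mdot (C x M) M}.
Implicit Types (w z : 'rV[R]_d -> range_mx R d U) (D : set 'rV[R]_d).

Lemma enorm_sqint D w : open D -> L2U U D w -> sqint mu D (fun x => enorm (w x)).
Proof.
move=> oD hw; split.
  apply: measurableT_comp; last exact: mdot_measurable.
  by apply: continuous_measurable_fun; exact: sqrt_continuous.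
have := mdot_integrable oD hw.1 hw.1.
by congr (_.-integrable _ _); apply/funext => x /=; rewrite enorm_sq.
Qed.

Lemma tensor_L2U D w : open D -> D `<=` Omega -> L2U U D w -> L2U U D (fun x => C x (w x)).
Proof.
move=> oD DO hw; have mD := open_rV_measurable oD; have mO := open_rV_measurable oO.
split => [i j|x Dx]; last by apply: C_range; [exact: DO|exact: hw.2].
apply/(L2_sqint oD); apply: (@sqint_ae_le _ _ _ mu D mD _ (fun x => K * enorm (w x))).
- apply: (@eq_measurable_fun _ _ _ _ _ (fun x =>
  \sum_(p : 'I_(range_rows d U) * 'I_(range_cols d U))
     w x p.1 p.2 * C x (rproj (delta_mx p.1 p.2)) i j)).
    move=> x /set_mem Dx /=;
      rewrite [in RHS](in_range_expand (hw.2 x Dx)) linear_sum summxE.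
    by apply: eq_bigr => p _; rewrite linearZ mxE.
  apply: measurable_sum => p; apply: measurable_funM.
    by have [] := L2U_sqint oD p.1 p.2 hw.
  by apply: measurable_funS (C_meas _ _ _) => //; exact: rproj_in_range.
- by apply: (sqintZ mD); exact: enorm_sqint.
apply: filterS C_bnd => x h Dx; have := h (DO _ Dx) _ (hw.2 x Dx) => {}h.
by apply: le_trans (coord_le_enorm _ _ _) _; apply: le_trans h _; exact: ler_norm.
Qed.

Lemma tensor_ae D w z : w = z %[ae mu in D] -> (fun x => C x (w x)) = (fun x =>
  C x (z x)) %[ae mu in D].
Proof. by apply: filterS => x + Dx => /(_ Dx) ->. Qed.

Lemma ip_tensor_sym w z : L2U U Omega w -> L2U U Omega z ->
  ip_L2U Omega (fun x => C x (w x)) z = ip_L2U Omega (fun x => C x (z x)) w.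
Proof.
move=> hw hz; have mO := open_rV_measurable oO.
have hCw := tensor_L2U oO (@subset_refl _ _) hw;
  have hCz := tensor_L2U oO (@subset_refl _ _) hz.
congr fine; apply: ae_eq_integral => //.
- by apply/measurable_EFinP; exact: mdot_measurable.
- by apply/measurable_EFinP; exact: mdot_measurable.
apply: filterS C_sym => x h Ox; congr EFin; rewrite h//;
  [exact: mdotC|exact: hw.2|exact: hz.2].
Qed.

Lemma ip_tensor_ge w : L2U U Omega w ->
  c * ip_L2U Omega w w <= ip_L2U Omega (fun x => C x (w x)) w.
Proof.
move=> hw; have mO := open_rV_measurable oO.
have hCw := tensor_L2U oO (@subset_refl _ _) hw.
have iw := mdot_integrable oO hw.1 hw.1.
rewrite /ip_L2U -RintegralZl//; apply: ae_le_Rintegral => //.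
- by rewrite (_ : _ \o _ = (fun x => c%:E * (EFin \o (fun x =>
  mdot (w x) (w x))) x)%E)//; exact: integrableZl.
- exact: mdot_integrable hCw.1 hw.1.
by apply: filterS C_pos => x h Ox; have := h Ox _ (hw.2 x Ox); rewrite enorm_sq.
Qed.

Lemma ip_tensor_le w : L2U U Omega w ->
  ip_L2U Omega (fun x => C x (w x)) w <= K * ip_L2U Omega w w.
Proof.
move=> hw; have mO := open_rV_measurable oO.
have hCw := tensor_L2U oO (@subset_refl _ _) hw.
have iw := mdot_integrable oO hw.1 hw.1.
rewrite /ip_L2U -RintegralZl//; apply: ae_le_Rintegral => //.
- exact: mdot_integrable hCw.1 hw.1.
- by rewrite (_ : _ \o _ = (fun x => K%:E * (EFin \o (fun x =>
  mdot (w x) (w x))) x)%E)//; exact: integrableZl.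
apply: filterS C_bnd => x h Ox; have := h Ox _ (hw.2 x Ox) => {}h.
apply: le_trans (mdot_le_enorm _ _) _; rewrite -enorm_sq expr2 mulrA.
by rewrite ler_wpM2r// enorm_ge0.
Qed.

Lemma ip_tensor_sq_le w : L2U U Omega w ->
  ip_L2U Omega (fun x => C x (w x)) (fun x => C x (w x)) <= K ^+ 2 * ip_L2U Omega w w.
Proof.
move=> hw; have mO := open_rV_measurable oO.
have hCw := tensor_L2U oO (@subset_refl _ _) hw.
have iw := mdot_integrable oO hw.1 hw.1.
rewrite /ip_L2U -RintegralZl//; apply: ae_le_Rintegral => //.
- exact: mdot_integrable hCw.1 hCw.1.
- by rewrite (_ : _ \o _ = (fun x => (K ^+ 2)%:E * (EFin \o (fun x =>
  mdot (w x) (w x))) x)%E)//; exact: integrableZl.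
apply: filterS C_bnd => x h Ox; have := h Ox _ (hw.2 x Ox) => {}h.
by rewrite -!enorm_sq -exprMn lerXn2r// nnegrE ?enorm_ge0// (le_trans _ h)// enorm_ge0.
Qed.

(** * The energy form on H_0(A) and its weak solutions *)

Context (A : diffop R d U) (P : R).
Hypothesis P_gt0 : 0 < P.
Hypothesis PF : forall v, H0_op A Omega v ->
  norm_L2 Omega v <= P * norm_L2U Omega (op_L2 A Omega v).
Local Notation O := (op_L2 A Omega).
Local Notation H0 := (H0_op A Omega).
Implicit Types (u v f : 'rV[R]_d -> R).

Lemma H_op_L2U v : H_op A Omega v -> L2U U Omega (O v).
Proof. by move=> [_ /op_L2P[]]. Qed.

Lemma H0_L2U v : H0 v -> L2U U Omega (O v).
Proof. by move=> [/H_op_L2U]. Qed.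

Lemma H0_L2 v : H0 v -> L2 Omega v.
Proof. by move=> [[]]. Qed.

Lemma H0_lin k u v : H0 u -> H0 v -> H0 (fun x => k * u x + v x).
Proof.
move=> [hu tu] [hv tv]; have [huv E] := H_op_lin k oO hu hv.
split => // w hw; have [hw1 /adj_L2P[ha _]] := hw.
have := tu _ hw; have := tv _ hw; rewrite /trace_boundary.
have hOu := H_op_L2U hu; have hOv := H_op_L2U hv.
rewrite (ip_L2U_ae oO (H_op_L2U huv) (L2U_lin oO k hOu hOv) hw1 E).
rewrite (ip_L2U_linl oO)// (ip_L2_linl oO)//; [|exact: hu.1|exact: hv.1].
move=> /eqP; rewrite subr_eq0 => /eqP -> /eqP; rewrite subr_eq0 => /eqP ->.
by rewrite subrr.
Qed.

Lemma O_sub u v : H_op A Omega u -> H_op A Omega v ->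
  H_op A Omega (fun x => u x - v x) /\
  O (fun x => u x - v x) = (fun x => O u x - O v x) %[ae mu in Omega].
Proof.
move=> hu hv; have [h E] := H_op_lin (-1) oO hv hu.
have F : (fun x => u x - v x) = (fun x => -1 * v x + u x) by apply/funext => x;
  rewrite mulN1r addrC.
split; first by rewrite F.
by rewrite F; apply: filterS E => x + Ox => /(_ Ox) ->; rewrite scaleN1r addrC.
Qed.

Lemma H0_sub u v : H0 u -> H0 v -> H0 (fun x => u x - v x).
Proof.
move=> hu hv; have := H0_lin (-1) hv hu.
by congr (H0_op _ _ _); apply/funext => x; rewrite mulN1r addrC.
Qed.

Lemma PF_sq v : H0 v -> ip_L2 Omega v v <= P ^+ 2 * ip_L2U Omega (O v) (O v).
Proof.
move=> hv; rewrite -norm_L2_sq// -norm_L2U_sq// -exprMn lerXn2r// ?nnegrE ?sqrtr_ge0//.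
  by rewrite mulr_ge0 ?sqrtr_ge0// ltW.
exact: PF.
Qed.

Lemma ip_O_sub u v : H_op A Omega u -> H_op A Omega v ->
  ip_L2U Omega (O (fun x => u x - v x)) (O (fun x => u x - v x)) =
  ip_L2U Omega (fun x => O u x - O v x) (fun x => O u x - O v x).
Proof.
move=> hu hv; have [h E] := O_sub hu hv.
have hd := L2U_sub oO (H_op_L2U hu) (H_op_L2U hv); have hO := H_op_L2U h.
by rewrite (ip_L2U_ae oO hO hd hO E) ip_L2UC (ip_L2U_ae oO hO hd hd E).
Qed.

Definition energy u v : R := ip_L2U Omega (fun x => C x (O u x)) (O v).

Lemma energy_sym u v : H0 u -> H0 v -> energy u v = energy v u.
Proof. by move=> hu hv; apply: ip_tensor_sym; exact: H0_L2U. Qed.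

Lemma tensor_O_lin k u v : H_op A Omega u -> H_op A Omega v ->
  (fun x => C x (O (fun x => k * u x + v x) x)) =
  (fun x => k *: C x (O u x) + C x (O v x)) %[ae mu in Omega].
Proof.
move=> hu hv; have [_] := H_op_lin k oO hu hv; apply: filterS => x + Ox => /(_ Ox) ->.
by rewrite linearP.
Qed.

Lemma energy_linl k u v (y : 'rV[R]_d -> R) : H0 u -> H0 v -> H0 y ->
  energy (fun x => k * u x + v x) y = k * energy u y + energy v y.
Proof.
move=> hu hv hy; have Oy := H0_L2U hy.
have CO (z : 'rV[R]_d -> R) : H0 z -> L2U U Omega (fun x => C x (O z x)) by move=> hz;
  apply: tensor_L2U => //; exact: H0_L2U.
rewrite /energy (ip_L2U_ae oO (CO _ (H0_lin k hu hv)) (L2U_lin oO k (CO _ hu) (CO _ hv))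
  Oy).
  by rewrite (ip_L2U_linl oO)//; exact: CO.
by apply: tensor_O_lin; [exact: hu.1|exact: hv.1].
Qed.

Lemma energy_ge u : H0 u -> c * ip_L2U Omega (O u) (O u) <= energy u u.
Proof. by move=> hu; apply: ip_tensor_ge; exact: H0_L2U. Qed.

Lemma energy_ge0 u : H0 u -> 0 <= energy u u.
Proof.
by move=> hu; apply: le_trans (energy_ge hu); rewrite mulr_ge0 ?ip_L2U_ge0// ltW.
Qed.

(** The Cauchy-Schwarz inequality passes a tested identity to the limit. With test functions for [z]
    it identifies [g] as A v; with elements of H(A^* ) it preserves vanishing traces. *)
Lemma ip_limit (s : nat -> 'rV[R]_d -> R) v g z f :
  (forall n, H_op A Omega (s n)) -> L2 Omega v -> L2U U Omega g -> L2U U Omega z ->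
    L2 Omega f ->
  (forall e : R, 0 < e -> exists N, forall n, (N <= n)%N ->
     ip_L2 Omega (fun x => s n x - v x) (fun x => s n x - v x) < e) ->
  (forall e : R, 0 < e -> exists N, forall n, (N <= n)%N ->
     ip_L2U Omega (fun x => O (s n) x - g x) (fun x => O (s n) x - g x) < e) ->
  (forall n, ip_L2U Omega (O (s n)) z = ip_L2 Omega (s n) f) ->
  ip_L2U Omega g z = ip_L2 Omega v f.
Proof.
move=> hs hv hg hz hf cv cg E.
apply/eqP; rewrite -subr_eq0 -sqrf_eq0 eq_le sqr_ge0 andbT.
apply/ler_addgt0Pr => e e0; rewrite add0r.
pose Z := ip_L2U Omega z z; pose F := ip_L2 Omega f f.
have Z0 : 0 <= Z by exact: ip_L2U_ge0.
have F0 : 0 <= F by exact: ip_L2_ge0.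
have d0 : 0 < e / (4 * (Z + F + 1)) by rewrite divr_gt0// mulr_gt0// ltr_wpDl// addr_ge0.
have [N1 hN1] := cv _ d0; have [N2 hN2] := cg _ d0.
pose n := maxn N1 N2.
have := hN1 n (leq_maxl _ _); have := hN2 n (leq_maxr _ _).
have hd := L2_sub oO (hs n).1 hv; have hD := L2U_sub oO (H_op_L2U (hs n)) hg.
have := ip_L2_CS oO hd hf; have := ip_L2U_CS oO hD hz.
rewrite (ip_L2U_subl oO (H_op_L2U (hs n)) hg hz) (ip_L2_subl oO (hs n).1 hv hf) E -/Z -/F.
have := ip_L2_ge0 Omega (fun x => s n x - v x).
have := ip_L2U_ge0 Omega (fun x => O (s n) x - g x).
have dE : e / (4 * (Z + F + 1)) * (Z + F + 1) = e / 4.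
  by field; rewrite !gt_eqF// ltr_wpDl// addr_ge0.
move: (e / (4 * _)) dE d0 => t tE t0.
move: (ip_L2U _ _ (fun x => O _ x - _)) (ip_L2 _ (fun x => s n x - v x) _) => x y.
move: (ip_L2 _ (s n) f) (ip_L2U _ g z) (ip_L2 _ v f) => p q r.
by move=> *; exact: (@ip_limit_arith _ x y Z F t e p).
Qed.

Lemma trace_boundary_eq v w : H_op A Omega v -> H_adj A Omega w ->
  trace_boundary A Omega v w = 0 <-> ip_L2U Omega (O v) w = ip_L2 Omega v (adj_L2 A Omega
    w).
Proof. by move=> hv hw; rewrite /trace_boundary; split=> [/eqP|->];
  [rewrite subr_eq0 => /eqP|rewrite subrr]. Qed.

(** The Poincare-Friedrichs inequality makes a sequence that is Cauchy in ||A v|| also Cauchy in L2,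
    so v and A v have limits. That the limit lies in H_0(A) consists of two families of identities,
    both stable under [ip_limit]. *)
Lemma H0_complete (s : nat -> 'rV[R]_d -> R) : (forall n, H0 (s n)) ->
  (forall e : R, 0 < e -> exists N, forall n m, (N <= n)%N -> (N <= m)%N ->
     ip_L2U Omega (O (fun x => s n x - s m x)) (O (fun x => s n x - s m x)) < e) ->
  exists2 v, H0 v & forall e : R, 0 < e -> exists N, forall n, (N <= n)%N ->
     ip_L2U Omega (O (fun x => s n x - v x)) (O (fun x => s n x - v x)) < e.
Proof.
move=> hs cs; have mO := open_rV_measurable oO.
have hsop n : H_op A Omega (s n) := (hs n).1.
have [||g hg cg] := @L2U_complete _ _ Omega U oO (fun n => O (s n)).
- by move=> n; exact: H0_L2U.
- by move=> e /cs[N hN]; exists N => n m Nn Nm; rewrite -ip_O_sub//; exact: hN.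
have [||v hv cv] := @sqint_complete _ _ R mu Omega mO s.
- by move=> n; apply/(L2_sqint oO); exact: H0_L2.
- move=> e e0; have P20 : 0 < e / P ^+ 2 by rewrite divr_gt0// exprn_gt0.
  have [N hN] := cs _ P20; exists N => n m Nn Nm.
  apply: le_lt_trans (PF_sq (H0_sub (hs n) (hs m))) _.
  by rewrite mulrC -ltr_pdivlMr ?exprn_gt0//; exact: hN.
have {}hv : L2 Omega v by apply/(L2_sqint oO).
have lim := ip_limit hsop hv hg _ _ cv cg.
have dvg : distr_op A Omega v g.
  move=> Phi tP; apply: lim; [exact: testU_L2U tP|exact: smooth_adj_L2 tP|].
  by move=> n; have [_ /op_L2P[_]] := hsop n; exact.
have hvop : H_op A Omega v by split => //; exists g.
have Ov : O v = g %[ae mu in Omega] by exact: op_L2_eq.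
have hOv := H_op_L2U hvop.
exists v.
  split => // w hw; apply/trace_boundary_eq => //; have [hw1 /adj_L2P[ha _]] := hw.
  rewrite (ip_L2U_ae oO hOv hg hw1 Ov); apply: lim => // n.
  by apply/trace_boundary_eq => //; exact: (hs n).2.
move=> e /cg[N hN]; exists N => n Nn; rewrite ip_O_sub//.
have hd := L2U_sub oO (H_op_L2U (hsop n)) hOv;
  have hd' := L2U_sub oO (H_op_L2U (hsop n)) hg.
have E : (fun x => O (s n) x - O v x) = (fun x => O (s n) x - g x) %[ae mu in Omega].
  by apply: filterS Ov => x + Ox => /(_ Ox) ->.
by rewrite (ip_L2U_ae oO hd hd' hd E) ip_L2UC (ip_L2U_ae oO hd hd' hd' E); exact: hN.
Qed.

Definition weak_solution f u := H0 u /\ forall v, H0 v -> energy u v = ip_L2 Omega f v.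

Lemma H00 : H0 (fun=> 0).
Proof.
apply: (test_H0 A oO); split; first exact: smooth0.
  rewrite (_ : [set x | _] = set0); first by rewrite closure0; exact: compact0.
  by apply/seteqP; split => x //=; rewrite eqxx.
rewrite (_ : [set x | _] = set0); first by rewrite closure0.
by apply/seteqP; split => x //=; rewrite eqxx.
Qed.

Lemma weak_exists f : L2 Omega f -> exists u, weak_solution f u.
Proof.
move=> hf.
(* Origin of the constant: (f, u)^2 <= ||f||^2 P^2 ||A u||^2, and ||A u||^2 is at most the energy of
   u divided by c. *)
have [||||||||u hu E] := @psd_riesz R ('rV[R]_d ->
  R) H0 energy _ _ _ _ (ip_L2 Omega f) (ip_L2 Omega f f * (P ^+ 2 / c)).
- by move=> k u v; exact: H0_lin.
- exact: energy_sym.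
- by move=> k u v w; exact: energy_linl.
- exact: energy_ge0.
- by exists (fun=> 0); exact: H00.
- move=> s hs cs.
  (* Completeness is available in the norm ||A v||: coercivity leads from the energy to this norm,
     boundedness of [C] leads back. The sign of [K] is not prescribed, hence |K| + 1. *)
  have Kp : 0 < `|K| + 1 by rewrite ltr_wpDl.
  have [|v hv cv] := H0_complete hs.
    move=> e e0; have [|N hN] := cs (c * e); first by rewrite mulr_gt0.
    exists N => n m Nn Nm; have := hN n m Nn Nm.
    move=> h; have := le_lt_trans (energy_ge (H0_sub (hs n) (hs m))) h.
    by rewrite ltr_pM2l.
  exists v => // e e0; have [|N hN] := cv (e / (`|K| + 1)); first by rewrite divr_gt0.
  exists N => n Nn; have := hN n Nn; rewrite ltr_pdivlMr// mulrC; apply: le_lt_trans.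
  apply: le_trans (ip_tensor_le (H0_L2U (H0_sub (hs n) hv))) _.
  by rewrite ler_wpM2r ?ip_L2U_ge0// (le_trans (ler_norm _))// lerDl.
- by move=> k u v hu hv; rewrite ip_L2_linr//; exact: H0_L2.
- move=> u hu; apply: le_trans (ip_L2_CS oO hf (H0_L2 hu)) _.
  rewrite -mulrA ler_wpM2l ?ip_L2_ge0//; apply: le_trans (PF_sq hu) _.
  rewrite -(mulrA (P ^+ 2)) ler_wpM2l ?exprn_ge0 ?(ltW P_gt0)// ler_pdivlMl//;
    exact: energy_ge.
by exists u.
Qed.

Lemma weak_lin k f f' u u' : L2 Omega f -> L2 Omega f' ->
  weak_solution f u -> weak_solution f' u' ->
  weak_solution (fun x => k * f x + f' x) (fun x => k * u x + u' x).
Proof.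
move=> hf hf' [hu E] [hu' E']; split; first exact: H0_lin.
move=> v hv; rewrite energy_linl// E// E'// ip_L2_linl//; exact: H0_L2.
Qed.

Lemma weak_sub f f' u u' : L2 Omega f -> L2 Omega f' ->
  weak_solution f u -> weak_solution f' u' ->
  weak_solution (fun x => f x - f' x) (fun x => u x - u' x).
Proof.
move=> hf hf' wu wu'; have := weak_lin (-1) hf' hf wu' wu.
by congr weak_solution; apply/funext => x; rewrite mulN1r addrC.
Qed.

(** Testing with u itself gives c ||A u||^2 <= (f, u) <= ||f|| P ||A u||; one factor ||A u|| cancels
    unless it is zero. *)
Lemma weak_bound f u : L2 Omega f -> weak_solution f u ->
  ip_L2U Omega (O u) (O u) <= (P / c) ^+ 2 * ip_L2 Omega f f.
Proof.
move=> hf [hu E]; have h1 := energy_ge hu; have h2 := PF_sq hu.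
have := ip_L2_CS oO hf (H0_L2 hu); rewrite -E//.
move: h1 h2; have := ip_L2_ge0 Omega f; have := ip_L2U_ge0 Omega (O u).
move: (energy u u) (ip_L2 _ f f) (ip_L2 _ u u) (ip_L2U _ _ _) => a F uu N N0 F0 cN uN aF.
have [->|Nn0] := eqVneq N 0; first by rewrite mulr_ge0// sqr_ge0.
have Np : 0 < N by rewrite lt_def Nn0.
have h : (c * N) ^+ 2 <= F * (P ^+ 2 * N).
  apply: (@le_trans _ _ (a ^+ 2)).
    by rewrite lerXn2r// nnegrE ?(le_trans _ cN)// mulr_ge0// ltW.
  by apply: le_trans aF _; rewrite ler_wpM2l.
rewrite exprMn exprVn mulrAC ler_pdivlMr ?exprn_gt0//.
rewrite -(ler_pM2r Np); apply: le_trans (_ : _ <= (c * N) ^+ 2) _;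
  last by apply: le_trans h _; rewrite mulrCA mulrA.
by rewrite exprMn expr2 [N ^+ 2]expr2 le_eqVlt; apply/orP; left; apply/eqP; ring.
Qed.

(** The difference of two solutions solves the problem with zero data, so [weak_bound] and the
    Poincare-Friedrichs inequality annihilate it. *)
Lemma weak_unique f u u' : L2 Omega f -> weak_solution f u -> weak_solution f u' ->
  u' = u %[ae mu in Omega] /\ O u' = O u %[ae mu in Omega].
Proof.
move=> hf wu wu'; have w := weak_sub hf hf wu' wu.
have f0 : (fun x => f x - f x) = (fun=> 0) by apply/funext => x; rewrite subrr.
rewrite f0 in w; have [hw _] := w.
have z0 : ip_L2 Omega (fun=> 0) (fun=> 0) = 0.
  by rewrite /ip_L2; under eq_Rintegral do rewrite mul0r; rewrite /Rintegral integral0.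
have L20 : L2 Omega (fun=> 0) by apply/(L2_sqint oO); exact: sqint0.
have N0 : ip_L2U Omega (O (fun x => u' x - u x)) (O (fun x => u' x - u x)) = 0.
  by apply/eqP; rewrite eq_le ip_L2U_ge0 andbT; have := weak_bound L20 w; rewrite z0 mulr0.
split.
  have : ip_L2 Omega (fun x => u' x - u x) (fun x => u' x - u x) = 0.
    by apply/eqP; rewrite eq_le ip_L2_ge0 andbT; have := PF_sq hw; rewrite N0 mulr0.
  move=> /(norm_L2_eq0 oO (H0_L2 hw)); apply: filterS => x + Ox => /(_ Ox) /eqP.
  by rewrite subr_eq0 => /eqP.
have := norm_L2U_eq0 oO (H0_L2U hw) N0; have [_] := O_sub wu'.1.1 wu.1.1.
apply: filterS2 => x h1 h2 Ox; have := h2 Ox; rewrite h1// => /eqP.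
by rewrite subr_eq0 => /eqP.
Qed.

Lemma weak_strong f u : L2 Omega f -> weak_solution f u ->
  let q := fun x => C x (O u x) in
  [/\ L2U U Omega q, H_adj A Omega q & adj_L2 A Omega q = f %[ae mu in Omega]].
Proof.
move=> hf [hu E] q; have hq : L2U U Omega q by apply: tensor_L2U => //; exact: H0_L2U.
have dq : distr_adj A Omega q f.
  move=> phi tp; have h0 := test_H0 A oO tp; rewrite -E// /energy -/q.
  have Lop := smooth_op_L2U A oO tp.
  rewrite ip_L2UC (ip_L2U_ae oO (H0_L2U h0) Lop hq) 1?ip_L2UC//.
  by apply: op_L2_eq => //; exact: test_distr_op.
split => //; last exact: adj_L2_eq.
by split => //; exists f.
Qed.


(** * The hybrid problem on a mesh *)

Section hybrid.
Context {N : nat} (T : 'I_N -> set 'rV[R]_d) (Ht : set ('rV[R]_d -> R)).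
Hypothesis oT : forall i, open (T i).
Hypothesis T_sub : forall i, T i `<=` Omega.
Hypothesis T_inj : forall i j x, T i x -> T j x -> i = j.
Hypothesis T_ae : {ae mu, forall x, Omega x -> exists i, T i x}.
Hypothesis Ht_broken : Ht `<=` H_broken A Omega T.
Hypothesis H0_Ht : H0 `<=` Ht.

Definition broken_pairing w v := \sum_i ip_L2U (T i) w (op_L2 A (T i) v).

Lemma broken_op_L2U v i : H_broken A Omega T v -> L2U U (T i) (op_L2 A (T i) v).
Proof. by move=> [_ h]; have [] := op_L2P (h i). Qed.

(** The representatives on the element and on [Omega] are chosen independently; uniqueness on the
    element reconciles them. *)
Lemma op_restrict v i : H_op A Omega v -> op_L2 A (T i) v = O v %[ae mu in T i].
Proof.
move=> hv; apply: op_L2_eq => //; first exact: L2U_restrict (H_op_L2U hv).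
by have [_ /op_L2P[_]] := hv; apply: distr_op_sub; exact: T_sub.
Qed.

Lemma H_op_broken v : H_op A Omega v -> H_broken A Omega T v.
Proof.
move=> hv; split; first exact: hv.1.
move=> i; exists (O v); first exact: L2U_restrict (H_op_L2U hv).
by have [_ /op_L2P[_]] := hv; apply: distr_op_sub; exact: T_sub.
Qed.

Lemma broken_pairing_op w v : L2U U Omega w -> H_op A Omega v ->
  broken_pairing w v = ip_L2U Omega w (O v).
Proof.
move=> hw hv; rewrite (mesh_ip oO oT T_sub T_inj T_ae hw (H_op_L2U hv)).
apply: eq_bigr => i _; rewrite ip_L2UC [RHS]ip_L2UC.
apply: (ip_L2U_ae (@oT i)).
- exact: broken_op_L2U (H_op_broken hv).
- exact: L2U_restrict (H_op_L2U hv).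
- exact: L2U_restrict hw.
- exact: op_restrict.
Qed.

Lemma trace_skeletonE w (v : Ht) :
  trace_skeleton A Omega T w v = ip_L2 Omega (adj_L2 A Omega w) (val v) - broken_pairing
    w (val v).
Proof. by []. Qed.

(** On functions in H(A) the skeleton pairing is, up to sign, the pairing on the boundary of
    Omega. *)
Lemma trace_skeleton_H0 w (v : Ht) :
  H_adj A Omega w -> H0 (val v) -> trace_skeleton A Omega T w v = 0.
Proof.
move=> hw [hv tv]; rewrite trace_skeletonE broken_pairing_op//; last exact: hw.1.
by have := tv _ hw; rewrite trace_boundary_eq// => /esym E; rewrite ip_L2C ip_L2UC E subrr.
Qed.

(* The elementwise A v glue to some g in L2(Omega; U). The vanishing of all
   traces says (g, w) = (v, A^* w) for all w in H(A^* ): testing with test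
   functions, g = A v on Omega, and then v is in H_0(A). *)
Lemma trace_free_H0 (v : Ht) :
  (forall w, H_adj A Omega w -> trace_skeleton A Omega T w v = 0) -> H0 (val v).
Proof.
move=> tv; have hv := Ht_broken (set_valP v).
have [g hg gE] := mesh_glue oO oT T_sub T_inj (fun i => broken_op_L2U i hv).
have key w : H_adj A Omega w -> ip_L2U Omega g w = ip_L2 Omega (val v) (adj_L2 A Omega w).
  move=> hw; rewrite ip_L2UC (mesh_ip oO oT T_sub T_inj T_ae hw.1 hg) ip_L2C.
  have /eqP := tv w hw; rewrite trace_skeletonE subr_eq0 => /eqP ->.
  by apply: eq_bigr => i _; apply: eq_Rintegral => x /set_mem Tx; rewrite (gE i).
have dg : distr_op A Omega (val v) g.
  move=> Phi tP; have hP := test_H_adj A oO tP; rewrite key// ip_L2C [RHS]ip_L2C.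
  have [ha _] := adj_L2P hP.2; have hs := smooth_adj_L2 A oO tP.
  by apply: (ip_L2_ae oO ha hs hv.1); apply: adj_L2_eq => //; exact: test_distr_adj.
have hop : H_op A Omega (val v) by split; [exact: hv.1|exists g].
split => // w hw; apply/trace_boundary_eq => //; rewrite -key//.
by apply: (ip_L2U_ae oO (H_op_L2U hop) hg hw.1); exact: op_L2_eq.
Qed.

(** The hybrid equation contains the elementwise representatives of A u, the flux C A u contains the
    global one; this lemma passes from one to the other. *)
Lemma broken_tensor u v : H_op A Omega u -> H_broken A Omega T v ->
  \sum_i ip_L2U (T i) (fun x => C x (op_L2 A (T i) u x)) (op_L2 A (T i) v) =
  broken_pairing (fun x => C x (O u x)) v.
Proof.
move=> hu hv; apply: eq_bigr => i _; apply: (ip_L2U_ae (@oT i)).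
- by apply: tensor_L2U => //; exact: broken_op_L2U (H_op_broken hu).
- by apply: tensor_L2U => //; exact: L2U_restrict (H_op_L2U hu).
- exact: broken_op_L2U.
- by apply: tensor_ae; exact: op_restrict.
Qed.

Lemma H0_in_Ht v : H0 v -> exists v' : Ht, val v' = v.
Proof. by move=> /H0_Ht hv; exists (exist _ v (mem_set hv)). Qed.

(** Inside the integral the chosen representative of A^* q may be replaced by [f]. This turns the
    first hybrid equation into a formula for psi. *)
Lemma trace_skeleton_weak f u (v : Ht) : L2 Omega f -> weak_solution f u ->
  trace_skeleton A Omega T (fun x => C x (O u x)) v =
  ip_L2 Omega f (val v) - broken_pairing (fun x => C x (O u x)) (val v).
Proof.
move=> hf wu; have [_ hq aq] := weak_strong hf wu; have [hv _] := Ht_broken (set_valP v).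
by rewrite trace_skeletonE; congr (_ - _); apply: (ip_L2_ae oO) => //;
  have [] := adj_L2P hq.2.
Qed.

(** Reduces each claim about the hybrid problem to one about the weak problem in H_0(A), in which no
    mesh occurs. *)
Lemma hybrid_weak f (u : Ht) (psi : Ht -> R) : L2 Omega f ->
  hybrid_solution A Omega T C f u psi <->
  weak_solution f (val u) /\ psi = trace_skeleton A Omega T (fun x => C x (O (val u) x)).
Proof.
move=> hf; split=> [[[w hw wpsi] eq1 eq2]|[wu ->]].
  have hu : H0 (val u) by apply: trace_free_H0 => z hz; apply: eq2; exists z.
  have wu : weak_solution f (val u).
    split => // v hv; have [v' v'E] := H0_in_Ht hv; rewrite -v'E in hv *.
    rewrite -eq1 -wpsi trace_skeleton_H0// addr0 (broken_tensor hu.1);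
      last exact: H_op_broken hv.1.
    by rewrite broken_pairing_op//; [apply: tensor_L2U => //; exact: H0_L2U|exact: hv.1].
  split => //; apply/funext => v; rewrite (trace_skeleton_weak _ hf wu).
  rewrite -eq1 (broken_tensor hu.1); last exact: Ht_broken (set_valP v).
  by rewrite addrAC subrr add0r.
have [_ hq _] := weak_strong hf wu; have hu := wu.1.
split; first by exists (fun x => C x (O (val u) x)).
  move=> v; rewrite (trace_skeleton_weak _ hf wu) (broken_tensor hu.1);
    last exact: Ht_broken (set_valP v).
  by rewrite addrC subrK.
by move=> _ [z hz <-]; exact: trace_skeleton_H0.
Qed.

(** Makes the bound on u in [stability] independent of the mesh: for functions in H(A) the sums over
    elements recombine to integrals over Omega. *)
Lemma norm_broken_op v : H_op A Omega v ->
  norm_broken A Omega T v = Num.sqrt (ip_L2 Omega v v + ip_L2U Omega (O v) (O v)).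
Proof.
move=> hv; rewrite /norm_broken norm_L2_sq; congr (Num.sqrt (_ + _)).
rewrite (mesh_ip oO oT T_sub T_inj T_ae (H_op_L2U hv) (H_op_L2U hv)).
apply: eq_bigr => i _; rewrite norm_L2U_sq.
have h1 : L2U U (T i) (op_L2 A (T i) v) by exact: broken_op_L2U (H_op_broken hv).
have h2 : L2U U (T i) (O v) by exact: L2U_restrict (H_op_L2U hv).
have E : op_L2 A (T i) v = O v %[ae mu in T i] by exact: op_restrict.
by rewrite (ip_L2U_ae (@oT i) h1 h2 h1 E) ip_L2UC (ip_L2U_ae (@oT i) h1 h2 h2 E).
Qed.

(** A single extension bounds the infimum. In [stability] it is the flux C A u, whose norm in H(A^*
    ) does not involve the mesh. *)
Lemma norm_skeleton_le w : H_adj A Omega w ->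
  norm_skeleton A Omega T (trace_skeleton (Ht := Ht) A Omega T w) <= norm_adj A Omega w.
Proof.
move=> hw; apply: ge_inf; last by exists w.
by exists 0 => _ [z _ <-]; exact: sqrtr_ge0.
Qed.

(* ||u||^2 <= (P^2 + 1) (P/c)^2 ||f||^2 and
   ||psi||^2 <= ||C A u||^2 + ||f||^2 <= (K^2 (P/c)^2 + 1) ||f||^2. *)
Definition stability_constant : R :=
  Num.sqrt ((P ^+ 2 + 1) * (P / c) ^+ 2) + Num.sqrt (K ^+ 2 * (P / c) ^+ 2 + 1).

Lemma stability f u : L2 Omega f -> weak_solution f u ->
  norm_broken A Omega T u
  + norm_skeleton A Omega T (trace_skeleton (Ht := Ht) A Omega T (fun x => C x (O u x)))
  <= stability_constant * norm_L2 Omega f.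
Proof.
move=> hf wu; have [hu _] := wu; have [hq hadj aq] := weak_strong hf wu.
have B := weak_bound hf wu; have PFu := PF_sq hu; have F0 := ip_L2_ge0 Omega f.
have N0 := ip_L2U_ge0 Omega (O u).
rewrite mulrDl; apply: lerD.
  rewrite (norm_broken_op hu.1) /norm_L2 -sqrtrM; last first.
    by rewrite mulr_ge0 ?sqr_ge0// addr_ge0 ?sqr_ge0.
  apply: ler_wsqrtr; rewrite -mulrA mulrDl mul1r; apply: lerD => //.
  by apply: le_trans PFu _; rewrite ler_wpM2l ?sqr_ge0.
apply: le_trans (norm_skeleton_le hadj) _.
rewrite /norm_adj norm_L2U_sq norm_L2_sq /norm_L2 -sqrtrM; last first.
  by rewrite addr_ge0// mulr_ge0 ?sqr_ge0.
have [ha _] := adj_L2P hadj.2.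
apply: ler_wsqrtr; rewrite mulrDl mul1r; apply: lerD.
  by apply: le_trans (ip_tensor_sq_le (H0_L2U hu)) _;
    rewrite -(mulrA (K ^+ 2)) ler_wpM2l ?sqr_ge0.
by rewrite (ip_L2_ae oO ha hf ha aq) ip_L2C (ip_L2_ae oO ha hf hf aq).
Qed.

(** Puts psi' - psi into the form to which [stability] applies, the trace of the flux of a weak
    solution. Evaluating all traces by [trace_skeleton_weak] avoids comparing the chosen
    representatives of A^* q. *)
Lemma trace_skeleton_sub f f' u u' : L2 Omega f -> L2 Omega f' ->
  weak_solution f u -> weak_solution f' u' ->
  (fun v : Ht => trace_skeleton A Omega T (fun x => C x (O u x)) v -
                 trace_skeleton A Omega T (fun x => C x (O u' x)) v) =
  trace_skeleton A Omega T (fun x => C x (O (fun x => u x - u' x) x)).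
Proof.
move=> hf hf' wu wu'; apply/funext => v; have hv := Ht_broken (set_valP v).
have hff := L2_sub oO hf hf'; have wuu := weak_sub hf hf' wu wu'.
rewrite (trace_skeleton_weak v hff wuu) (trace_skeleton_weak v hf wu)
  (trace_skeleton_weak v hf' wu').
have E : broken_pairing (fun x => C x (O (fun x => u x - u' x) x)) (val v) =
    broken_pairing (fun x => C x (O u x)) (val v) - broken_pairing (fun x =>
      C x (O u' x)) (val v).
  rewrite /broken_pairing -sumrB; apply: eq_bigr => i _.
  have CT (z : 'rV[R]_d -> R) : H0 z -> L2U U (T i) (fun x => C x (O z x)).
    by move=> hz; apply: tensor_L2U => //; exact: L2U_restrict (H0_L2U hz).
  have vT : L2U U (T i) (op_L2 A (T i) (val v)) by exact: broken_op_L2U hv.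
  have q1 := CT _ wu.1; have q2 := CT _ wu'.1; have q3 := CT _ wuu.1.
  rewrite -(ip_L2U_subl (@oT i) q1 q2 vT); apply: (ip_L2U_ae (@oT i) q3 _ vT).
    exact: L2U_sub.
  have [_] := O_sub wu.1.1 wu'.1.1; apply: filterS => x h Tx.
  by rewrite h; [rewrite linearB|exact: T_sub Tx].
rewrite E (ip_L2_subl oO hf hf' hv.1).
move: (ip_L2 _ f _) (ip_L2 _ f' _) (broken_pairing _ _) (broken_pairing _ _) => p q r t.
by ring.
Qed.

(** Equality at every element of [Ht], although A u and A u' agree only almost everywhere: changing
    a flux on a null set alters no integral. *)
Lemma trace_skeleton_unique f u u' : L2 Omega f ->
  weak_solution f u -> weak_solution f u' ->
  trace_skeleton (Ht := Ht) A Omega T (fun x => C x (O u' x)) =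
  trace_skeleton A Omega T (fun x => C x (O u x)).
Proof.
move=> hf wu wu'; apply/funext => v; have hv := Ht_broken (set_valP v).
have E : broken_pairing (fun x => C x (O u' x)) (val v) =
    broken_pairing (fun x => C x (O u x)) (val v).
  apply: eq_bigr => i _; apply: (ip_L2U_ae (@oT i)).
  - by apply: tensor_L2U => //; exact: L2U_restrict (H0_L2U wu'.1).
  - by apply: tensor_L2U => //; exact: L2U_restrict (H0_L2U wu.1).
  - exact: broken_op_L2U hv.
  apply: tensor_ae; have [_] := weak_unique hf wu wu'.
  by apply: filterS => x h Tx; apply: h; exact: T_sub Tx.
by rewrite (trace_skeleton_weak v hf wu) (trace_skeleton_weak v hf wu') E.
Qed.

Lemma stability_constant_gt0 : 0 < stability_constant.
Proof.
rewrite /stability_constant ltr_wpDl ?sqrtr_ge0// sqrtr_gt0.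
by rewrite ltr_wpDl// mulr_ge0 ?sqr_ge0.
Qed.

Lemma hybrid_well_posed :
  [/\ forall f, L2 Omega f ->
        exists (u : Ht) (psi : Ht -> R), hybrid_solution A Omega T C f u psi /\
          forall (u' : Ht) (psi' : Ht -> R),
            hybrid_solution A Omega T C f u' psi' ->
            (val u' = val u %[ae mu in Omega]) /\ psi' = psi,
      forall f (u : Ht) (psi : Ht -> R),
        L2 Omega f -> hybrid_solution A Omega T C f u psi ->
        forall e : R, 0 < e -> exists2 delta : R, 0 < delta &
          forall f' (u' : Ht) (psi' : Ht -> R),
            L2 Omega f' -> hybrid_solution A Omega T C f' u' psi' ->
            norm_L2 Omega (fun x => f' x - f x) < delta ->
            norm_broken A Omega T (fun x => val u' x - val u x)
            + norm_skeleton A Omega T (fun v : Ht => psi' v - psi v) < e &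
      forall f (u : Ht) (psi : Ht -> R),
        L2 Omega f -> hybrid_solution A Omega T C f u psi ->
        [/\ norm_broken A Omega T (val u) + norm_skeleton A Omega T psi
              <= stability_constant * norm_L2 Omega f,
            H0 (val u),
            let q := fun x => C x (O (val u) x) in
              H_adj A Omega q /\ psi = trace_skeleton A Omega T q &
            adj_L2 A Omega (fun x => C x (O (val u) x)) = f %[ae mu in Omega]]].
Proof.
split.
- move=> f hf; have [u0 wu0] := weak_exists hf; have [u uE] := H0_in_Ht wu0.1.
  rewrite -uE in wu0; exists u, (trace_skeleton A Omega T (fun x => C x (O (val u) x))).
  split; first exact/hybrid_weak.
  move=> u' psi' /(hybrid_weak _ _ hf)[wu' ->].
  by split; [exact: (weak_unique hf wu0 wu').1|exact: trace_skeleton_unique hf wu0 wu'].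
- move=> f u psi hf /(hybrid_weak _ _ hf)[wu ->] e e0.
  have S0 := stability_constant_gt0.
  (* By linearity the stability bound applies to the difference of two solutions, so the dependence
     on f is even Lipschitz continuous. *)
  exists (e / stability_constant); first by rewrite divr_gt0.
  move=> f' u' psi' hf' /(hybrid_weak _ _ hf')[wu' ->]; rewrite ltr_pdivlMr// mulrC.
  rewrite (trace_skeleton_sub hf' hf wu' wu); apply: le_lt_trans.
  by apply: stability; [exact: L2_sub|exact: weak_sub].
move=> f u psi hf /(hybrid_weak _ _ hf)[wu ->].
have [_ hq aq] := weak_strong hf wu.
by split => //; [exact: stability|exact: wu.1].
Qed.

End hybrid.

End tensor.

Theorem theorem1 (R : realType) (d : nat) (d_gt0 : (0 < d)%N)
    (Omega : set 'rV[R]_d) (Omega_lip : bounded_lipschitz_domain Omega)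
    (U : range_space) (A : diffop R d U)
    (C : 'rV[R]_d -> {linear range_mx R d U -> range_mx R d U})
    (C_tensor : coefficient_tensor Omega C)
    (PF : poincare_friedrichs A Omega) :
  exists2 K : R, 0 < K &
  forall (kappa : R) (N : nat) (T : 'I_N -> set 'rV[R]_d),
  0 < kappa -> regular_mesh Omega kappa T ->
  forall Ht : set ('rV[R]_d -> R),
  closed_subspace_broken A Omega T Ht -> H0_op A Omega `<=` Ht ->
  [/\ (* existence and uniqueness *)
      forall f, L2 Omega f ->
        exists (u : Ht) (psi : Ht -> R), hybrid_solution A Omega T C f u psi /\
          forall (u' : Ht) (psi' : Ht -> R),
            hybrid_solution A Omega T C f u' psi' ->
            (val u' = val u %[ae lebesgue_rV (R := R) d in Omega]) /\ psi' = psi,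
      (* continuous dependence of the solution on f *)
      forall f (u : Ht) (psi : Ht -> R),
        L2 Omega f -> hybrid_solution A Omega T C f u psi ->
        forall e : R, 0 < e -> exists2 delta : R, 0 < delta &
          forall f' (u' : Ht) (psi' : Ht -> R),
            L2 Omega f' -> hybrid_solution A Omega T C f' u' psi' ->
            norm_L2 Omega (fun x => f' x - f x) < delta ->
            norm_broken A Omega T (fun x => val u' x - val u x)
            + norm_skeleton A Omega T (fun v => psi' v - psi v) < e &
      (* stability bound and characterization of the solution *)
      forall f (u : Ht) (psi : Ht -> R),
        L2 Omega f -> hybrid_solution A Omega T C f u psi ->
        [/\ norm_broken A Omega T (val u) + norm_skeleton A Omega T psi
              <= K * norm_L2 Omega f,
            H0_op A Omega (val u),
            let q := fun x => C x (op_L2 A Omega (val u) x) in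
              H_adj A Omega q /\ psi = trace_skeleton A Omega T q &
            adj_L2 A Omega (fun x => C x (op_L2 A Omega (val u) x)) = f
              %[ae lebesgue_rV (R := R) d in Omega]]].
Proof.
have [[oO _ _] _ _] := Omega_lip.
have [C_range C_meas [K C_bnd] C_sym [c c_gt0 C_pos]] := C_tensor.
have [P P_gt0 PF_P] := PF.
(* Chosen before [kappa], [T] and [Ht] are introduced: its ingredients are the bounds of [C] and the
   Poincare-Friedrichs constant. *)
exists (stability_constant K c P); first exact: stability_constant_gt0.
move=> kappa N T kappa_gt0 mesh Ht [Ht_broken _ _ _] H0_Ht.
have T_ae := regular_mesh_ae mesh; have [T_poly T_disj _ _] := mesh.
apply: hybrid_well_posed => //.
- by move=> i; have [[[]]] := T_poly i.
- by move=> i; have [] := T_poly i.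
- by move=> i j x Ti Tj; apply: (T_disj i j) => //; exists x.
Qed.
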